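(* Let $\Omega=D\times(0,1)$ and let $u$ be the minimizer of $$J(w)=\int_\Omega|\nabla w|^2\,dx+2\int_D\Big(\int_0^1w(x',x_n)\,dx_n\Big)^+dx'$$ among functions $w\in u+W^{1,2}_0(\Omega)$ (that is, with prescribed boundary values), where $u$ is constant on $D\times\{0\}$ and constant on $D\times\{1\}$. Then $$u\in W^{2,2}(D'\times(0,1))\quad\text{for any }D'\Subset D.$$
   Context: $\Omega=D\times(0,1)$ is a bounded domain in $\mathbb{R}^n$ ($n\ge2$) with piecewise smooth boundary; points are written $x=(x',x_n)$ with $x'\in D\subset\mathbb{R}^{n-1}$, $x_n\in(0,1)$. Functions are in $W^{1,2}(\Omega)$; boundary values are understood in the trace sense; $s^+=\max(s,0)$; $D'\Subset D$ means that $D'$ is open with compact closure contained in $D$. *)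

(* Defs.v *)
From HB Require Import structures.
From mathcomp Require Import all_boot all_order all_algebra.
From mathcomp Require Import all_classical all_reals all_analysis.

Set Implicit Arguments.
Unset Strict Implicit.
Unset Printing Implicit Defensive.

Import Order.TTheory GRing.Theory Num.Theory.
Import numFieldNormedType.Exports.

Local Open Scope classical_set_scope.
Local Open Scope ring_scope.

(** * Borel sigma-algebra and Lebesgue measure on [R^n] = ['rV[R]_n]

    A point [x = (x', x_n)] of ['rV[R]_n.+1] has last coordinate
    [x ord0 ord_max] and other coordinates [col' ord_max x]. *)

Definition rV_display : measure_display -> measure_display.
Proof. exact. Qed.

Section rV_measurable.
Context (R : realType) (n : nat).

Definition rV_coord (i : 'I_n) (x : 'rV[R]_n) : R := x ord0 i.

Let rV_set0 : g_sigma_preimage rV_coord set0.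
Proof. exact: sigma_algebra0. Qed.

Let rV_setC A : g_sigma_preimage rV_coord A -> g_sigma_preimage rV_coord (~` A).
Proof. exact: sigma_algebraC. Qed.

Let rV_bigcup (F : (set 'rV[R]_n)^nat) :
  (forall i, g_sigma_preimage rV_coord (F i)) ->
  g_sigma_preimage rV_coord (\bigcup_i F i).
Proof. exact: sigma_algebra_bigcup. Qed.

HB.instance Definition _ := @isMeasurable.Build
  (rV_display default_measure_display)
  'rV[R]_n (g_sigma_preimage rV_coord) rV_set0 rV_setC rV_bigcup.

Lemma measurable_rV_coord i : measurable_fun [set: 'rV[R]_n] (rV_coord i).
Proof.
move=> _ Y mY; rewrite setTI; apply: sub_sigma_algebra => /=.
rewrite -bigcup_seq/=; exists i => /=; first by rewrite mem_index_enum.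
by exists Y => //; rewrite setTI.
Qed.

Lemma measurable_fun_rVP d (T : measurableType d) (f : T -> 'rV[R]_n) :
  measurable_fun [set: T] f <->
  forall i, measurable_fun [set: T] (rV_coord i \o f).
Proof.
split=> [mf i|mf].
  by apply: measurableT_comp mf; exact: measurable_rV_coord.
have sub : g_sigma_preimage (fun i => rV_coord i \o f) `<=` measurable.
  apply: smallest_sub; first exact: sigma_algebra_measurable.
  rewrite -bigcup_seq/=; apply: bigcup_sub => i _ A [B mB <-].
  exact: (mf i).
by move=> _ A mA; rewrite g_sigma_preimage_comp in sub; apply: sub; exists A.
Qed.

End rV_measurable.

Section rV_snoc.
Context (R : realType) (n : nat).

Definition rV_snoc (x : 'rV[R]_n) (t : R) : 'rV[R]_n.+1 :=
  \row_i oapp (x ord0) t (unlift ord_max i).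

Definition rV_join (p : 'rV[R]_n * measurableTypeR R) : 'rV[R]_n.+1 :=
  rV_snoc p.1 p.2.

Lemma rV_snocK x t : col' ord_max (rV_snoc x t) = x.
Proof. by apply/rowP => i; rewrite !mxE liftK. Qed.

Lemma rV_snoc_last x t : rV_snoc x t ord0 ord_max = t.
Proof. by rewrite mxE unlift_none. Qed.

Lemma rV_snoc_eta (y : 'rV[R]_n.+1) :
  rV_snoc (col' ord_max y) (y ord0 ord_max) = y.
Proof.
apply/rowP => i; rewrite mxE; case: unliftP => [j ->|->//] /=.
by rewrite mxE.
Qed.

Lemma measurable_rV_join : measurable_fun setT rV_join.
Proof.
apply/measurable_fun_rVP => i.
have [j ij|ij] := unliftP ord_max i.
  rewrite (_ : _ \o _ = rV_coord j \o fst).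
    exact: measurableT_comp (measurable_rV_coord _) _.
  by apply/funext => p; rewrite /rV_coord/= mxE ij liftK.
rewrite (_ : _ \o _ = snd); first exact: measurable_snd.
by apply/funext => p; rewrite /rV_coord/= mxE ij unlift_none.
Qed.

Lemma measurable_rV_split :
  measurable_fun setT (fun y : 'rV[R]_n.+1 =>
    (col' ord_max y, y ord0 ord_max) : 'rV[R]_n * measurableTypeR R).
Proof.
apply: measurable_fun_pair.
  apply/measurable_fun_rVP => i.
  rewrite (_ : _ \o _ = rV_coord (lift ord_max i)).
    exact: measurable_rV_coord.
  by apply/funext => y; rewrite /rV_coord/= mxE.
exact: (measurable_rV_coord ord_max).
Qed.

Variable mu : {sigma_finite_measure set 'rV[R]_n -> \bar R}.

Definition snoc_measure : set 'rV[R]_n.+1 -> \bar R :=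
  pushforward (mu \x lebesgue_measure)%E rV_join.

Let snoc_measure0 : snoc_measure set0 = 0%E.
Proof. by rewrite /snoc_measure /pushforward preimage_set0 measure0. Qed.

Let snoc_measure_ge0 A : (0 <= snoc_measure A)%E.
Proof. by rewrite /snoc_measure /pushforward measure_ge0. Qed.

Let snoc_measure_sigma_additive : semi_sigma_additive snoc_measure.
Proof.
apply: measure_semi_sigma_additive; exact: measurable_rV_join.
Qed.

HB.instance Definition _ := isMeasure.Build _ _ _ snoc_measure
  snoc_measure0 snoc_measure_ge0 snoc_measure_sigma_additive.

Let snoc_measure_sigma_finite : sigma_finite setT snoc_measure.
Proof.
have /sigma_finiteP[F [FT ndF Foo]] := sigma_finiteT mu.
have /sigma_finiteP[G [GT ndG Goo]] := sigma_finiteT (@lebesgue_measure R).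
pose split_rV := fun y : 'rV[R]_n.+1 =>
  (col' ord_max y, y ord0 ord_max) : 'rV[R]_n * measurableTypeR R.
exists (fun k => split_rV @^-1` (F k `*` G k)).
  rewrite -preimage_bigcup (_ : \bigcup_k _ = setT) ?preimage_setT//.
  apply/seteqP; split=> // -[x t] _.
  have [i _ Fx] : (\bigcup_k F k) x by rewrite -FT.
  have [j _ Gt] : (\bigcup_k G k) t by rewrite -GT.
  exists (maxn i j) => //; split => /=.
    by move: x Fx; exact/subsetPset/ndF/leq_maxl.
  by move: t Gt; exact/subsetPset/ndG/leq_maxr.
move=> k; have [mF Fk] := Foo k; have [mG Gk] := Goo k; split.
  rewrite -[X in measurable X]setTI; apply: measurable_rV_split => //.
  exact: measurableX.
rewrite /snoc_measure /pushforward -comp_preimage (_ : _ \o _ = id); last first.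
  by apply/funext => -[x t]; rewrite /split_rV /rV_join/= rV_snocK rV_snoc_last.
by rewrite preimage_id product_measure1E// lte_mul_pinfty// ge0_fin_numE.
Qed.

HB.instance Definition _ := Measure_isSigmaFinite.Build _ _ _ snoc_measure
  snoc_measure_sigma_finite.

End rV_snoc.

Fixpoint rV_lebesgue_rec (R : realType) (n : nat) :
    {sigma_finite_measure set 'rV[R]_n -> \bar R} :=
  if n is n'.+1 then snoc_measure (rV_lebesgue_rec R n') else \d_(0 : 'rV[R]_0).

Definition rV_lebesgue (R : realType) (n : nat) : set 'rV[R]_n -> \bar R :=
  rV_lebesgue_rec R n.

HB.instance Definition _ (R : realType) (n : nat) :=
  SigmaFiniteMeasure.on (@rV_lebesgue R n).

Arguments rV_lebesgue {R n}.

(** * Smooth functions and test functions *)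

Section smooth.
Context (R : realType) (n : nat) (V : normedModType R).
Implicit Types f : 'rV[R]_n -> V.

Definition partial (i : 'I_n) f : 'rV[R]_n -> V :=
  fun x => 'D_(delta_mx ord0 i) f x.

(** The multi-index [alpha] is given as the list of the directions of
    differentiation, so that its order is [size alpha]. *)
Definition iter_partial (alpha : seq 'I_n) f : 'rV[R]_n -> V :=
  foldr partial f alpha.

Definition smooth f : Prop :=
  forall alpha, continuous (iter_partial alpha f) /\
    forall i x, derivable (iter_partial alpha f) x (delta_mx ord0 i).

End smooth.

Section sobolev.
Context (R : realType) (n : nat).
Implicit Types (Om : set 'rV[R]_n) (u v w g phi : 'rV[R]_n -> R).

(** [C_c^oo(Om)]; its elements are extended by 0 to the whole space *)
Definition test_function Om phi : Prop :=
  smooth phi /\ exists K : set 'rV[R]_n,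
    [/\ compact K, K `<=` Om & forall x, ~ K x -> phi x = 0].

(** * Sobolev spaces [W^{k,2}] *)

Definition L2 Om u : Prop := u \_ Om \in Lfun rV_lebesgue 2%:E.

Definition is_weak_derivative Om (alpha : seq 'I_n) u g : Prop :=
  forall phi, test_function Om phi ->
    \int[rV_lebesgue]_(x in Om) (u x * iter_partial alpha phi x) =
    (-1) ^+ size alpha * \int[rV_lebesgue]_(x in Om) (g x * phi x).

Definition sobolev (k : nat) Om u : Prop :=
  L2 Om u /\ forall alpha : seq 'I_n, (size alpha <= k)%N ->
    exists g, L2 Om g /\ is_weak_derivative Om alpha u g.

(** The weak derivative is unique up to a null set; this picks a
    representative (and 0 if there is no weak derivative in [L^2]). *)
Definition weak_derivative Om (alpha : seq 'I_n) u : 'rV[R]_n -> R :=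
  xget (cst 0) [set g | L2 Om g /\ is_weak_derivative Om alpha u g].

(** [|nabla u|^2] *)
Definition weak_grad_sq Om u : 'rV[R]_n -> R :=
  fun x => \sum_(i < n) (weak_derivative Om [:: i] u x) ^+ 2.

(** the norm of [W^{1,2}(Om)] *)
Definition sobolev1_norm Om u : \bar R :=
  ((\int[rV_lebesgue]_(x in Om) ((u x) ^+ 2 + weak_grad_sq Om u x)%:E)
    `^ 2^-1)%E.

Definition sobolev1_cvg Om (v : nat -> 'rV[R]_n -> R) u : Prop :=
  sobolev1_norm Om (v k \- u) @[k --> \oo] --> 0%E.

(** [W^{1,2}_0(Om)], the closure of [C_c^oo(Om)] in [W^{1,2}(Om)] *)
Definition sobolev10 Om u : Prop :=
  sobolev 1 Om u /\ exists phi : nat -> 'rV[R]_n -> R,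
    (forall k, test_function Om (phi k)) /\ sobolev1_cvg Om phi u.

End sobolev.

(** * Domains *)

Definition bounded_domain (R : realType) (n : nat) (Om : set 'rV[R]_n) : Prop :=
  [/\ Om !=set0, open Om, connected Om & bounded_set Om].

(** The boundary is a finite union of parametrized smooth hypersurfaces
    [Phi i @` K i]: the parameter region [K i] is compact, is the closure of its
    interior and has a boundary of measure zero; the smooth map [Phi i] is
    regular and injective in the interior of [K i]; and distinct pieces only meet
    along their edges. *)
Definition piecewise_smooth_boundary (R : realType) (m : nat)
    (Om : set 'rV[R]_m.+1) : Prop :=
  exists (N : nat) (K : 'I_N -> set 'rV[R]_m)
         (Phi : 'I_N -> 'rV[R]_m -> 'rV[R]_m.+1),
    [/\ forall i, [/\ compact (K i), K i = closure (interior (K i)) &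
          rV_lebesgue (K i `\` interior (K i)) = 0%E],
        forall i, [/\ smooth (Phi i), set_inj (interior (K i)) (Phi i) &
          forall y, interior (K i) y -> row_free (jacobian (Phi i) y)],
        forall i j, i != j ->
          Phi i @` interior (K i) `&` Phi j @` K j = set0 &
        closure Om `\` Om = \bigcup_i (Phi i @` K i)].

(** * The cylinder [D x (0,1)] *)

Section cylinder.
Context (R : realType) (m : nat).
Implicit Types (D : set 'rV[R]_m) (u w : 'rV[R]_m.+1 -> R).

Definition cylinder D : set 'rV[R]_m.+1 :=
  [set x | D (col' ord_max x) /\ 0 < x ord0 ord_max < 1].

Definition slice D (a : R) : set 'rV[R]_m.+1 :=
  [set x | D (col' ord_max x) /\ x ord0 ord_max = a].

(** [g] is the trace of [u] on [D x {a}], for [a = 0] or [a = 1]: the trace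
    operator is the continuous extension to [W^{1,2}] of the restriction of
    functions that are continuous up to [D x {a}]. *)
Definition is_trace D u (a : R) (g : 'rV[R]_m -> R) : Prop :=
  exists v : nat -> 'rV[R]_m.+1 -> R,
    [/\ forall k, sobolev 1 (cylinder D) (v k) /\
          {within cylinder D `|` slice D a, continuous (v k)},
        sobolev1_cvg (cylinder D) v u &
        Lnorm rV_lebesgue 2%:E (EFin \o
          (fun x' => v k (rV_snoc x' a) - g x') \_ D) @[k --> \oo] --> 0%E].

Definition constant_on_slice D u (a : R) : Prop :=
  exists c : R, is_trace D u a (cst c).

Definition energy D w : R :=
  \int[rV_lebesgue]_(x in cylinder D) weak_grad_sq (cylinder D) w x +
  2 * \int[rV_lebesgue]_(x' in D)
        Num.max (\int[lebesgue_measure]_(t in `]0, 1[) w (rV_snoc x' t)) 0.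

(** [u] minimizes the energy over [u + W^{1,2}_0(D x (0,1))] *)
Definition is_minimizer D u : Prop :=
  sobolev 1 (cylinder D) u /\
  forall w, sobolev 1 (cylinder D) w -> sobolev10 (cylinder D) (w \- u) ->
    energy D u <= energy D w.

End cylinder.

Definition compactly_contained (R : realType) (n : nat)
    (A B : set 'rV[R]_n) : Prop :=
  [/\ open A, compact (closure A) & closure A `<=` B].

(* Main.v *)
From HB Require Import structures.
Require Import Defs.
From mathcomp Require Import all_boot all_order all_algebra.
From mathcomp Require Import finmap.
From mathcomp Require Import all_classical all_reals all_analysis measurable_realfun.
From mathcomp Require Import ring lra.

(** The positive part is 1-Lipschitz, so comparing [u] with [u + e phi] gives
    [|int grad u . grad phi| <= int |phi|] for every test function [phi] of the
    cylinder: the distributional Laplacian of [u] is bounded. Subtract from [u]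
    the affine function of [x_n] with the same constant traces on the two faces.
    The difference has trace 0 on them, so its odd reflection across [x_n = 0]
    and [x_n = 1] is weakly differentiable in [D x (-1,2)]; odd reflections of
    test functions vanish on the faces, so the reflected function still has a
    bounded Laplacian. Multiplying by a cutoff that is 1 on [D' x (0,1)] gives a
    function [v] on the whole space with compact support and
    [|int v Lap psi| <= int G |psi|] for some [G] in [L^2]. Its mollifications [w]
    satisfy [|Lap w| <= G * rho], and [int |D^2 w|^2 = int (Lap w)^2] by two
    integrations by parts. Hence [phi |-> int v d_i d_j phi] is bounded for the
    [L^2] norm, and the Riesz representation theorem provides the second
    derivatives. *)

Set Implicit Arguments.
Unset Strict Implicit.
Unset Printing Implicit Defensive.

Import Order.TTheory GRing.Theory Num.Theory.
Import numFieldNormedType.Exports.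

Local Open Scope classical_set_scope.
Local Open Scope ring_scope.

(** * Square-integrable functions *)

Section measure_space.
Context d (T : measurableType d) (R : realType) (mu : {measure set T -> \bar R}).
Implicit Types (f g h : T -> R).

(** The obstacle is that minimality only speaks of test functions with compact support in the open
    cylinder, whereas the reflected function must be tested across the faces. Two arguments bridge
    this gap. For the Laplacian bound, the folded test function vanishes on the faces and is
    Lipschitz: cutoffs of slope of order [k] at distance [1/k] from a face keep its gradient
    bounded, so dominated convergence applies. For the integration by parts the test function is
    arbitrary on the faces, and the cutoff leaves a boundary term; this term is controlled by the
    trace, uniformly along the sequence that defines the trace, and vanishes once the affine
    function is subtracted. Reflection is self-adjoint, so each property of the reflected function
    is read off by moving the reflection onto the test function. The Laplacian of [u] is never
    represented by a function: the inequality with [G |psi|] is kept up to mollification, where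
    [psi] is a translate of the mollifier. Riesz is used in the form [2 L f <= \int f^2 + C], which
    Young's inequality delivers directly. *)

Definition intg f := mu.-integrable setT (EFin \o f).
(** Functions live on the whole space and integrals run over [setT]; a function on a domain enters
    through its extension by zero, [f \_ Om]. *)
Definition sqint f := measurable_fun setT f /\ intg (fun x => f x ^+ 2).

Lemma intg_meas f : intg f -> measurable_fun setT f.
Proof. by move=> /integrableP[/measurable_EFinP]. Qed.

Lemma intg_cst0 : intg (fun=> 0).
Proof. exact: integrable0. Qed.

Lemma intgD f g : intg f -> intg g -> intg (fun x => f x + g x).
Proof. by move=> mf mg; have := integrableD measurableT mf mg. Qed.

Lemma intgB f g : intg f -> intg g -> intg (fun x => f x - g x).
Proof. by move=> mf mg; have := integrableB measurableT mf mg. Qed.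

Lemma intgZ a f : intg f -> intg (fun x => a * f x).
Proof. by move=> mf; have := integrableZl measurableT a mf. Qed.

Lemma intg_abs f : intg f -> intg (fun x => `|f x|).
Proof. by move=> mf; have := integrable_abse mf. Qed.

Lemma intg_le f g : measurable_fun setT f -> (forall x, `|f x| <= g x) ->
  intg g -> intg f.
Proof.
move=> mf fg; apply: le_integrable => //; first exact/measurable_EFinP.
move=> x _ /=; rewrite lee_fin (le_trans (fg x))//; exact: ler_norm.
Qed.

Lemma intg_sum (I : Type) (r : seq I) (F : I -> T -> R) :
  (forall i, intg (F i)) -> intg (fun x => \sum_(i <- r) F i x).
Proof.
move=> iF; elim: r => [|i r IH].
  by under eq_fun do rewrite big_nil; exact: intg_cst0.
by under eq_fun do rewrite big_cons; exact: intgD.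
Qed.

Local Notation I f := (\int[mu]_x (f x)).

Lemma RintD f g : intg f -> intg g -> \int[mu]_x (f x + g x) = I f + I g.
Proof. exact: RintegralD. Qed.

Lemma RintB f g : intg f -> intg g -> \int[mu]_x (f x - g x) = I f - I g.
Proof. exact: RintegralB. Qed.

Lemma RintZ a f : intg f -> \int[mu]_x (a * f x) = a * I f.
Proof. by move=> mf; rewrite RintegralZl. Qed.

Lemma RintN f : intg f -> \int[mu]_x (- f x) = - I f.
Proof.
move=> mf; rewrite -[RHS]mulN1r -RintZ//.
by apply: eq_Rintegral => x _; rewrite mulN1r.
Qed.

Lemma Rint_sum (J : Type) (r : seq J) (F : J -> T -> R) :
  (forall i, intg (F i)) ->
  \int[mu]_x (\sum_(i <- r) F i x) = \sum_(i <- r) I (F i).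
Proof.
move=> iF; elim: r => [|i r IH].
  rewrite big_nil; under eq_Rintegral do rewrite big_nil.
  by rewrite /Rintegral integral0.
rewrite big_cons -IH -RintD//; last exact: intg_sum.
by apply: eq_Rintegral => x _; rewrite big_cons.
Qed.

Lemma Rint_le f g : intg f -> intg g -> (forall x, f x <= g x) -> I f <= I g.
Proof. by move=> mf mg fg; apply: le_Rintegral => // x _; exact: fg. Qed.

Lemma Rint_ge0 f : (forall x, 0 <= f x) -> 0 <= I f.
Proof. by move=> f0; apply: Rintegral_ge0. Qed.

Lemma Rint_abs f : intg f -> `|I f| <= \int[mu]_x `|f x|.
Proof. exact: le_normr_Rintegral. Qed.

Lemma Rint_abs_le f g : intg f -> intg g -> (forall x, `|f x| <= g x) ->
  `|I f| <= I g.
Proof.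
move=> mf mg fg; apply: (le_trans (Rint_abs mf)); apply: Rint_le => //.
exact: intg_abs.
Qed.

Lemma EFin_Rint f : intg f -> (I f)%:E = (\int[mu]_x (f x)%:E)%E.
Proof. by move=> mf; rewrite fineK//; exact: integrable_fin_num. Qed.

Lemma ae_eq_Rint f g : measurable_fun setT f -> measurable_fun setT g ->
  ae_eq mu setT f g -> I f = I g.
Proof.
move=> mf mg fg; congr fine; apply: ae_eq_integral => //; try exact/measurable_EFinP.
by apply: filterS fg => x /[apply] ->.
Qed.

Lemma Rint_dct (F : nat -> T -> R) f g : (forall n, measurable_fun setT (F n)) ->
  (forall x, F ^~ x @ \oo --> f x) -> intg g ->
  (forall n x, `|F n x| <= g x) ->
  intg f /\ \int[mu]_x F n x @[n --> \oo] --> I f.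
Proof.
move=> mF Ff ig Fg.
have mf : measurable_fun setT f by apply: measurable_fun_cvg mF _ => x _; exact: Ff.
have [] := @dominated_convergence _ T R mu setT measurableT
  (fun n => EFin \o F n) (EFin \o f) (EFin \o g).
- by move=> n; exact/measurable_EFinP.
- exact/measurable_EFinP.
- by apply: aeW => x _; apply: cvg_EFin; [exact: nearW|exact: Ff].
- exact: ig.
- by apply: aeW => x n _ /=; rewrite lee_fin.
move=> imf _ cv; split => //.
have iF n : intg (F n) by apply: intg_le ig.
by apply: fine_cvg; rewrite fineK//; exact: integrable_fin_num.
Qed.

Lemma sqint_meas f : sqint f -> measurable_fun setT f.
Proof. by case. Qed.

Lemma sqint_intg2 f : sqint f -> intg (fun x => f x ^+ 2).
Proof. by case. Qed.

Lemma normM_le_sqr (a b : R) : `|a * b| <= a ^+ 2 + b ^+ 2.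
Proof.
rewrite normrM -(real_normK (num_real a)) -(real_normK (num_real b)).
have := sqr_ge0 (`|a| - `|b|); have := mulr_ge0 (normr_ge0 a) (normr_ge0 b).
by nra.
Qed.

Lemma sqintM f g : sqint f -> sqint g -> intg (fun x => f x * g x).
Proof.
move=> [mf f2] [mg g2]; apply: intg_le (intgD f2 g2) => [|x].
  exact: measurable_funM.
exact: normM_le_sqr.
Qed.

Lemma sqint_le f g : measurable_fun setT f -> (forall x, `|f x| <= `|g x|) ->
  sqint g -> sqint f.
Proof.
move=> mf fg [mg g2]; split => //; apply: intg_le g2 => [|x].
  exact: measurable_funX.
by rewrite normrX -[leRHS](real_normK (num_real _)) lerXn2r// nnegrE.
Qed.

Lemma sqintD f g : sqint f -> sqint g -> sqint (fun x => f x + g x).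
Proof.
move=> sf sg; split; first by apply: measurable_funD; exact: sqint_meas.
have i := intgD (intgD (sqint_intg2 sf) (intgZ 2 (sqintM sf sg))) (sqint_intg2 sg).
by rewrite (_ : (fun _ => _) = fun x => f x ^+ 2 + 2 * (f x * g x) + g x ^+ 2)//;
  apply/funext => x; ring.
Qed.

Lemma sqintZ a f : sqint f -> sqint (fun x => a * f x).
Proof.
move=> sf; split.
  by apply: measurable_funM; [exact: measurable_cst|exact: sqint_meas].
rewrite (_ : (fun _ => _) = fun x => a ^+ 2 * f x ^+ 2).
  by apply: intgZ; exact: sqint_intg2.
by apply/funext => x; ring.
Qed.

Lemma sqintB f g : sqint f -> sqint g -> sqint (fun x => f x - g x).
Proof.
move=> sf sg; rewrite (_ : (fun _ => _) = fun x => f x + (-1) * g x).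
  by apply: sqintD => //; exact: sqintZ.
by apply/funext => x; ring.
Qed.

Lemma sqint0 : sqint (fun=> 0).
Proof.
split; first exact: measurable_cst.
by rewrite (_ : (fun _ => _) = fun=> 0) ?expr0n//; exact: intg_cst0.
Qed.

Lemma sqint_abs f : sqint f -> sqint (fun x => `|f x|).
Proof.
move=> sf; apply: (sqint_le _ _ sf) => [|x]; last by rewrite normr_id.
exact: measurableT_comp (sqint_meas sf).
Qed.

Lemma sqint_sum (J : Type) (r : seq J) (F : J -> T -> R) :
  (forall i, sqint (F i)) -> sqint (fun x => \sum_(i <- r) F i x).
Proof.
move=> iF; elim: r => [|i r IH].
  by under eq_fun do rewrite big_nil; exact: sqint0.
by under eq_fun do rewrite big_cons; exact: sqintD.
Qed.

Lemma sqintMb f g M : sqint f -> measurable_fun setT g ->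
  (forall x, `|g x| <= M) -> sqint (fun x => f x * g x).
Proof.
move=> sf mg gM; apply: sqint_le (sqintZ M sf) => [|x].
  by apply: measurable_funM => //; exact: sqint_meas.
rewrite !normrM mulrC ler_wpM2r//; exact: le_trans (gM x) (ler_norm _).
Qed.

Lemma intgMb f g M : intg f -> measurable_fun setT g ->
  (forall x, `|g x| <= M) -> intg (fun x => f x * g x).
Proof.
move=> sf mg gM; apply: intg_le (intgZ M (intg_abs sf)) => [|x].
  by apply: measurable_funM => //; exact: intg_meas.
by rewrite !normrM mulrC ler_wpM2r.
Qed.

End measure_space.

(** * Riesz representation for a bounded functional on a space of square-integrable functions *)

Section riesz.
Context d (T : measurableType d) (R : realType) (mu : {measure set T -> \bar R}).
Implicit Types (f g h : T -> R).
Local Notation I f := (\int[mu]_x (f x)).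

Lemma geometric_dominated (f_ : nat -> R) (c : R) :
  (forall k, `|f_ k.+1 - f_ k| <= 2^-1 ^+ k * c) ->
  cvgn f_ /\ forall k, `|f_ k| <= `|f_ 0| + 2 * c.
Proof.
move=> fc; have c0 : 0 <= c.
  by have := fc 0; rewrite expr0 mul1r; exact: le_trans.
split.
  have -> : f_ = fun n => f_ 0 + series (fun k => f_ k.+1 - f_ k) n.
    by apply/funext => n; rewrite /series/= telescope_sumr// addrC subrK.
  apply: is_cvgD; first exact: is_cvg_cst.
  apply: normed_cvg; apply: series_le_cvg (fun k => normr_ge0 _) _ fc _.
    by move=> k; rewrite mulr_ge0// exprn_ge0.
  rewrite (_ : (fun k => _) = geometric c 2^-1); last first.
    by apply/funext => k /=; rewrite mulrC.
  by apply: is_cvg_geometric_series; rewrite ger0_norm ?invf_lt1 ?ltr1n.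
(* Keeping the remainder [2 c 2^-k] of the geometric series lets the induction close. *)
have H k : `|f_ k| <= `|f_ 0| + 2 * c - 2 * c * 2^-1 ^+ k.
  elim: k => [|k IH]; first by rewrite expr0 mulr1 addrK.
  have := fc k; have := ler_normD (f_ k.+1 - f_ k) (f_ k); rewrite subrK exprS.
  set q := _ ^+ k; set a := `|f_ k.+1|; move=> h1 h2.
  have -> : 2 * c * (2^-1 * q) = q * c by field.
  by move: IH h1 h2; rewrite -/q; lra.
move=> k; apply: le_trans (H k) _; rewrite lerBlDr lerDl !mulr_ge0// exprn_ge0.
Qed.

(* With [S := \sum_k 4^k d_k^2], where [d_k := f_ k.+1 - f_ k], one has
   [|d_k| <= 2^-k sqrt S] and [S] is integrable: the sequence converges almost
   everywhere and is dominated by the square integrable [|f_ 0| + 2 sqrt S]. *)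
Lemma sqint_fast_cvg (f_ : nat -> T -> R) : (forall k, sqint mu (f_ k)) ->
  (forall k, \int[mu]_x ((f_ k.+1 x - f_ k x) ^+ 2) <= 8^-1 ^+ k) ->
  exists2 g, sqint mu g & forall h, sqint mu h ->
    \int[mu]_x (f_ k x * h x) @[k --> \oo] --> \int[mu]_x (g x * h x).
Proof.
move=> sf f8; pose D k x := 4 ^+ k * (f_ k.+1 x - f_ k x) ^+ 2.
have D0 k x : 0 <= D k x by rewrite mulr_ge0 ?sqr_ge0 ?exprn_ge0.
have sB k : sqint mu (fun x => f_ k.+1 x - f_ k x) by apply: sqintB.
have iD k : intg mu (D k) by apply: intgZ; exact: (sqint_intg2 (sB k)).
pose S x := (\sum_(0 <= k <oo) (D k x)%:E)%E.
have mS : measurable_fun setT S.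
  apply: ge0_emeasurable_sum => [k x _ _|k _]; first by rewrite lee_fin.
  by apply/measurable_EFinP; exact: intg_meas (iD k).
have S0 x : (0 <= S x)%E by apply: nneseries_ge0 => // k _ _; rewrite lee_fin.
have iS : mu.-integrable setT S.
  apply/integrableP; split => //; under eq_integral do rewrite gee0_abs//.
  rewrite integral_nneseries//; first last.
  - by move=> k x _; rewrite lee_fin.
  - by move=> k; apply/measurable_EFinP; exact: intg_meas (iD k).
  (* The rate [8^-k] beats the weight [4^k]: the integral of [S] is at most the sum of the
     [2^-k]. *)
  apply: (@le_lt_trans _ _ 2%:E); last exact: ltry.
  apply: (@le_trans _ _ (\sum_(0 <= k <oo) ((geometric 1 2^-1) k)%:E)%E).
    apply: lee_nneseries => [k _ _|k _]; first by apply: integral_ge0 => x _; rewrite lee_fin.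
    rewrite -EFin_Rint// lee_fin /D RintZ; last exact: (sqint_intg2 (sB k)).
    rewrite /= mul1r (_ : 2^-1 ^+ k = 4 ^+ k * 8^-1 ^+ k) ?ler_pM2l ?exprn_gt0//.
    by rewrite -exprMn; congr (_ ^+ _); field.
  have h2 : `|2^-1 : R| < 1 by rewrite ger0_norm ?invf_lt1 ?ltr1n.
  have -> : 2%:E = limn (fun n => (series (geometric 1 2^-1) n)%:E) :> \bar R.
    apply/esym/cvg_lim => //; apply: cvg_EFin; first exact: nearW.
    have := @cvg_geometric_series R 1 2^-1 h2.
    by rewrite (_ : 1 / (1 - 2^-1) = 2 :> R)//; field.
  rewrite le_eqVlt; apply/orP; left; apply/eqP; congr (limn _); apply/funext => n.
  by rewrite /series/= sumEFin.
pose A := [set x | (S x < +oo)%E].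
have mA : measurable A.
  by rewrite -[A]setTI; exact: emeasurable_fun_infty_o.
pose s x := Num.sqrt (fine (S x)).
(* Cutting to 0 on the null set where [S] is infinite makes convergence and domination hold at every
   point, as [Rint_dct] asks. *)
pose f' k x := \1_A x * f_ k x.
have aeA : \forall x \ae mu, A x.
  have := integrable_ae measurableT iS; apply: filterS => x /(_ Logic.I).
  by rewrite /A/= ge0_fin_numE.
have dS k x : A x -> `|f_ k.+1 x - f_ k x| <= 2^-1 ^+ k * s x.
  move=> Ax; have fS : S x \is a fin_num by rewrite ge0_fin_numE.
  have DS : D k x <= fine (S x).
    rewrite -lee_fin fineK//; apply: le_trans (nneseries_lim_ge k.+1 _) => //.
      rewrite big_nat_recr//= leeDr// sume_ge0// => i _; by rewrite lee_fin.
    by move=> n _ _; rewrite lee_fin.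
  have q0 : 0 < (2 : R) ^+ k by rewrite exprn_gt0.
  rewrite exprVn mulrC ler_pdivlMr//.
  rewrite -ler_sqr ?nnegrE ?mulr_ge0 ?sqrtr_ge0 ?(ltW q0)//.
  rewrite sqr_sqrtr; last by rewrite fine_ge0.
  apply: le_trans DS; rewrite exprMn real_normK ?num_real// /D mulrC ler_wpM2r ?sqr_ge0//.
  by rewrite -exprM mulnC exprM expr2 -natrM.
have gd x : cvgn (f' ^~ x) /\ forall k, `|f' k x| <= `|f_ 0 x| + 2 * s x.
  have s0 : 0 <= 2 * s x by rewrite mulr_ge0// sqrtr_ge0.
  rewrite /f' indicE; case: (boolP (x \in A)) => xA.
    have [] := @geometric_dominated (f_ ^~ x) (s x) (fun k => dS k x (set_mem xA)).
    by move=> cf bf; split => [|k]; [under eq_fun do rewrite mul1r|rewrite mul1r].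
  split=> [|k]; last by rewrite mul0r normr0 addr_ge0.
  by under eq_fun do rewrite mul0r; exact: is_cvg_cst.
have mf' k : measurable_fun setT (f' k).
  by apply: measurable_funM; [exact: measurable_indic|exact: sqint_meas].
pose g x := limn (f' ^~ x).
have f'g x : f' ^~ x @ \oo --> g x by exact: (gd x).1.
have mg : measurable_fun setT g by apply: measurable_fun_cvg mf' _ => x _; exact: f'g.
have ss : sqint mu s.
  have mfS : measurable_fun setT (fun x => fine (S x)).
    exact: measurableT_comp (fine_measurable measurableT) mS.
  split.
    apply: measurableT_comp mfS; apply: continuous_measurable_fun.
    exact: sqrt_continuous.
  rewrite /intg (_ : EFin \o _ = (fun x => (fine (S x))%:E)).
    apply: (le_integrable measurableT _ _ iS); first exact/measurable_EFinP.
    by move=> x _; move: (S0 x); case: (S x) => //= _; rewrite normr0 leey.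
  by apply/funext => x /=; rewrite sqr_sqrtr// fine_ge0.
have sG : sqint mu (fun x => `|f_ 0 x| + 2 * s x).
  by apply: sqintD; [exact: sqint_abs|exact: sqintZ].
have sg : sqint mu g.
  apply: (sqint_le mg _ sG) => x; apply: (@le_trans _ _ (`|f_ 0 x| + 2 * s x)); last exact: ler_norm.
  rewrite -(cvg_lim _ (cvg_norm (f'g x)))//; apply: limr_le.
    exact: (is_cvg_norm (gd x).1).
  by apply: nearW => k; exact: (gd x).2.
exists g => // h sh.
have mh := sqint_meas sh.
have [] := @Rint_dct _ _ _ mu (fun k x => f' k x * h x) (fun x => g x * h x)
  (fun x => (`|f_ 0 x| + 2 * s x) * `|h x|).
- by move=> n; exact: measurable_funM.
- by move=> x; apply: cvgM; [exact: f'g|exact: cvg_cst].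
- by apply: sqintM => //; exact: sqint_abs.
- by move=> n x; rewrite normrM ler_wpM2r//; exact: (gd x).2.
move=> _ cv; rewrite (_ : (fun k => _) = fun k => \int[mu]_x (f' k x * h x))//.
apply/funext => k; apply/esym.
apply: ae_eq_Rint.
- exact: measurable_funM.
- by apply: measurable_funM => //; exact: sqint_meas.
apply: filterS aeA => x Ax _; rewrite /f' indicE mem_set//.
by rewrite mul1r.
Qed.

Variables (V : (T -> R) -> Prop) (L : (T -> R) -> R) (C : R).
Hypothesis V0 : exists f, V f.
Hypothesis VD : forall f g a, V f -> V g -> V (fun x => f x + a * g x).
Hypothesis Vsq : forall f, V f -> sqint mu f.
Hypothesis LD : forall f g a, V f -> V g ->
  L (fun x => f x + a * g x) = L f + a * L g.
(* For a vector space [V], applying this to the multiples of [f] shows that [L] is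
   bounded for the [L^2] norm. *)
Hypothesis L_bounded : forall f, V f -> 2 * L f <= \int[mu]_x (f x ^+ 2) + C.

(** A nonnegative quadratic that vanishes at 0 has slope 0 there. *)
Lemma quadratic_ge0_lin0 (b s : R) : (forall a, 0 <= 2 * a * b + a ^+ 2 * s) -> b = 0.
Proof.
move=> H; have s0 : 0 <= s by have := H 1; have := H (-1); lra.
(* The minimum is at [- b / s]; [s + 1] also covers [s = 0]. *)
have := H (- b / (s + 1)).
have -> : 2 * (- b / (s + 1)) * b + (- b / (s + 1)) ^+ 2 * s =
    - (b / (s + 1)) ^+ 2 * (s + 2) by field; rewrite gt_eqF//; lra.
rewrite mulNr oppr_ge0 pmulr_lle0; last lra.
rewrite -[_ <= 0]orbF le_eqVlt ltNge sqr_ge0 orbF orbF sqrf_eq0 mulf_eq0 invr_eq0.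
by rewrite [s + 1 == 0]gt_eqF ?orbF => [/eqP|]//; lra.
Qed.

(** Minimize [F f = \int f^2 - 2 L f] over [V]. Since [V] is not complete, the minimum need not be
    attained in [V]; a fast minimizing sequence is Cauchy and its limit [g] is only
    square-integrable, but the stationarity of [F] passes to the limit. *)
Lemma riesz_representation : exists2 g, sqint mu g &
  forall f, V f -> L f = \int[mu]_x (g x * f x).
Proof.
pose F f := \int[mu]_x (f x ^+ 2) - 2 * L f.
pose E := [set F f | f in [set f | V f]].
have FE f : V f -> E (F f) by exists f.
have Elb : has_lbound E.
  by exists (- C) => _ [f /L_bounded Vf <-]; rewrite /F; lra.
have Einf : has_inf E by split => //; have [f Vf] := V0; exists (F f); exists f.
pose m := inf E.
have mF f : V f -> m <= F f by move=> /FE; exact: ge_inf.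
(* With excess [e_k] over the infimum, testing the midpoint gives [\int (f_k+1 - f_k)^2 <= 2 (e_k +
   e_k+1) <= 4 e_k]. This must be [8^-k] for [sqint_fast_cvg]. *)
have e0 k : 0 < 4^-1 * 8^-1 ^+ k :> R by rewrite mulr_gt0// exprn_gt0.
have ch k : exists f, V f /\ F f < m + 4^-1 * 8^-1 ^+ k.
  by have [_ [f Vf <-] Ff] := inf_adherent (e0 k) Einf; exists f.
have [f_ f_P] := choice ch.
have Vf k : V (f_ k) by have [] := f_P k.
have sf k : sqint mu (f_ k) := Vsq (Vf k).
have sqD f g a : sqint mu f -> sqint mu g -> \int[mu]_x ((f x + a * g x) ^+ 2) =
    \int[mu]_x (f x ^+ 2) + 2 * a * \int[mu]_x (f x * g x) +
    a ^+ 2 * \int[mu]_x (g x ^+ 2).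
  move=> hf hg; have i1 := sqint_intg2 hf; have i2 := sqint_intg2 hg.
  have i3 := sqintM hf hg; have i4 := intgZ (2 * a) i3.
  have i5 := intgZ (a ^+ 2) i2; have i6 := intgD i1 i4.
  rewrite -(RintZ _ i3) -(RintZ _ i2) -RintD// -RintD//.
  by apply: eq_Rintegral => x _; ring.
have FD f g a : V f -> V g -> F (fun x => f x + a * g x) = F f +
    2 * a * (\int[mu]_x (f x * g x) - L g) + a ^+ 2 * \int[mu]_x (g x ^+ 2).
  by move=> hf hg; rewrite /F LD// sqD; [ring|exact: Vsq|exact: Vsq].
have f8 k : \int[mu]_x ((f_ k.+1 x - f_ k x) ^+ 2) <= 8^-1 ^+ k.
  have Vd : V (fun x => f_ k.+1 x + (-1) * f_ k x) by exact: VD.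
  have := mF _ (VD 2^-1 (Vf k) Vd); rewrite FD// => h1.
  have h2 := FD _ _ 1 (Vf k) Vd.
  have h3 : F (fun x => f_ k x + 1 * (f_ k.+1 x + -1 * f_ k x)) = F (f_ k.+1).
    by congr F; apply/funext => x; ring.
  have [_ h4] := f_P k; have [_ h5] := f_P k.+1.
  have h6 : 8^-1 ^+ k.+1 <= 8^-1 ^+ k :> R.
    by rewrite exprS ler_piMl ?exprn_ge0// invf_le1 ?ler1n.
  rewrite (_ : Rintegral _ _ _ =
    \int[mu]_x ((f_ k.+1 x + (-1) * f_ k x) ^+ 2)); last first.
    by apply: eq_Rintegral => x _; ring.
  by move: h1 h2 h4 h5 h6; rewrite h3; lra.
have [g sg gP] := sqint_fast_cvg sf f8; exists g => // h Vh.
apply/esym/eqP; rewrite -subr_eq0; apply/eqP.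
have sh := Vsq Vh.
(* Comparing [F (f_k + a h)] with the infimum and letting [k] grow leaves a quadratic in [a] that is
   nonnegative and vanishes at 0. *)
apply: (@quadratic_ge0_lin0 _ (\int[mu]_x (h x ^+ 2))) => a.
have key k : 0 <= 4^-1 * 8^-1 ^+ k + (2 * a * (\int[mu]_x (f_ k x * h x) - L h)
    + a ^+ 2 * \int[mu]_x (h x ^+ 2)).
  by have := mF _ (VD a (Vf k) Vh); rewrite FD//; have [_] := f_P k; lra.
have cv : 4^-1 * 8^-1 ^+ k + (2 * a * (\int[mu]_x (f_ k x * h x) - L h)
    + a ^+ 2 * \int[mu]_x (h x ^+ 2)) @[k --> \oo] -->
    4^-1 * 0 + (2 * a * (\int[mu]_x (g x * h x) - L h)
    + a ^+ 2 * \int[mu]_x (h x ^+ 2)).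
  apply: cvgD; first apply: cvgMr; first by apply: cvg_expr; rewrite ger0_norm ?invf_lt1 ?ltr1n.
  apply: cvgD; last exact: cvg_cst.
  by apply: cvgMr; apply: cvgB; [exact: gP|exact: cvg_cst].
rewrite mulr0 add0r in cv; rewrite -(cvg_lim _ cv)//.
apply: limr_ge; first by apply/cvg_ex; eexists; exact: cv.
by apply: nearW => k; exact: key.
Qed.

End riesz.

(** * Topology and Lebesgue measure on [R^n] *)

Section rV_topology.
Context (R : realType) (N : nat).
Local Notation E := 'rV[R]_N.
Implicit Types (x y : E) (f : E -> R).

Lemma rV_ballP x y (e : R) : 0 < e ->
  ball x e y <-> forall i, `|y ord0 i - x ord0 i| < e.
Proof.
move=> e0; split=> [[_ /(_ ord0) H] i|H]; first by rewrite distrC; exact: H.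
by split => // i j; rewrite [i]ord1 /ball/= distrC; exact: H.
Qed.

Lemma rV_norm_ltP x (e : R) : 0 < e -> (forall i, `|x ord0 i| < e) <-> `|x| < e.
Proof.
move=> e0.
have := @rV_ballP 0 x e e0; rewrite -ball_normE /ball_/= sub0r normrN => ->.
by split => H i; have := H i; rewrite mxE subr0.
Qed.

Lemma rV_norm_leP x (e : R) : 0 <= e -> (forall i, `|x ord0 i| <= e) <-> `|x| <= e.
Proof.
move=> e0; split=> H.
  apply/ler_addgt0Pr => d d0; apply/ltW/rV_norm_ltP; first by rewrite ltr_wpDl.
  by move=> i; rewrite (le_lt_trans (H i))// ltrDl.
move=> i; apply/ler_addgt0Pr => d d0.
have /rV_norm_ltP : `|x| < e + d by rewrite (le_lt_trans H)// ltrDl.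
by move=> /(_ (ltr_wpDl e0 d0) i)/ltW.
Qed.

Lemma rV_coord_le x i : `|x ord0 i| <= `|x|.
Proof. exact: ((rV_norm_leP x (normr_ge0 x)).2 (lexx _) i). Qed.

Lemma rV_measurable_forall (Y : 'I_N -> set R) : (forall i, measurable (Y i)) ->
  measurable ([set x | forall i, Y i (x ord0 i)] : set E).
Proof.
move=> mY.
have -> : ([set x | forall i, Y i (x ord0 i)] : set E) =
    \big[setI/setT]_(i < N) (rV_coord i @^-1` Y i).
  apply/seteqP; split => x; rewrite -bigcap_seq/=; first by move=> h i _; exact: h.
  by move=> h i; apply: h; exact: mem_index_enum.
apply: bigsetI_measurable => i _; rewrite -[_ @^-1` _]setTI.
exact: measurable_rV_coord.
Qed.

(** A countable basis of boxes. The closed version [ratcube] keeps the closure inside the open set,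
    which leaves room for supports of test functions. *)
Definition ratbox (p : 'rV[rat]_N * nat) : set E :=
  [set x | forall i, `|ratr (p.1 ord0 i) - x ord0 i| < p.2.+1%:R^-1].

Definition ratcube (p : 'rV[rat]_N * nat) : set E :=
  [set x | forall i, `|ratr (p.1 ord0 i) - x ord0 i| <= p.2.+1%:R^-1].

Lemma ratbox_cover (A : set E) x : open A -> A x -> exists2 p, ratbox p x & ratcube p `<=` A.
Proof.
move=> oA Ax.
have /nbhs_ballP[e /= e0 eA] := open_nbhs_nbhs (conj oA Ax).
have [k ke] : exists k : nat, k.+1%:R^-1 < e / 2.
  have e2 : 0 < e / 2 by rewrite divr_gt0.
  by have [k _ /(_ k (leqnn _))] := near_infty_natSinv_lt (PosNum e2); exists k.
have k0 : 0 < k.+1%:R^-1 :> R by rewrite invr_gt0.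
have /choice[q qx] i : exists q : rat, `|x ord0 i - ratr q| < k.+1%:R^-1.
  have [q] : exists q : rat, ratr q \in
      `](x ord0 i - k.+1%:R^-1), (x ord0 i + k.+1%:R^-1)[.
    by apply: rat_in_itvoo; rewrite ltrD2l; apply: lt_trans k0; rewrite oppr_lt0.
  by rewrite in_itv/= => qx; exists q; rewrite ltr_distlC.
exists (\row_i q i, k); first by move=> i; rewrite mxE distrC; exact: qx.
move=> y yB; apply: eA; apply/rV_ballP => // i.
have := yB i; rewrite mxE/= distrC => h1; have h2 := qx i.
rewrite -(subrKA (ratr (q i))) (le_lt_trans (ler_normD _ _))//.
rewrite [e]splitr ltr_leD//; first exact: le_lt_trans ke.
by rewrite distrC ltW//; exact: lt_trans ke.
Qed.

(** The sigma-algebra is generated by the coordinates, so openness has to be turned into a countable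
    union of rational boxes. *)
Lemma rV_open_measurable (A : set E) : open A -> measurable A.
Proof.
move=> oA.
have -> : A = \bigcup_(p in [set p | ratcube p `<=` A]) ratbox p.
  apply/seteqP; split => [x Ax|x [p pA Bx]].
    by have [p px pA] := ratbox_cover oA Ax; exists p.
  by apply: pA => i; exact: ltW (Bx i).
rewrite bigcup_mkcond; apply: countable_bigcupT_measurable => [|p].
  exact: countableP.
case: ifPn => // _.
apply: (@rV_measurable_forall (fun i => ball (ratr (p.1 ord0 i) : R) p.2.+1%:R^-1)) => i.
exact: measurable_ball.
Qed.

Lemma rV_continuous_measurable f : continuous f -> measurable_fun setT f.
Proof.
move=> cf; apply: (measurability _ (RGenOpens.measurableE R)) => _ [_ [a [b ->] <-]].
rewrite setTI; apply: rV_open_measurable.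
by move/continuousP : cf; apply; exact: interval_open.
Qed.

End rV_topology.

(** * Invariance of Lebesgue measure, Fubini, and bounded sets *)

Section rV_measure.
Context (R : realType).
Local Notation L1 := (@lebesgue_measure R).

(** The pushforward of the measure agrees with it on half-open intervals, hence everywhere by
    uniqueness. For [s = -1] the preimage is half-open on the other side, with the same length. *)
Lemma lebesgue_integral_affine (s h : R) (f : R -> \bar R) :
  s = 1 \/ s = -1 -> measurable_fun setT f -> (forall t, 0 <= f t)%E ->
  (\int[L1]_t f (s * t + h)%R = \int[L1]_t f t)%E.
Proof.
move=> s1 mf f0; pose phi : R -> measurableTypeR R := fun t => s * t + h.
have mphi : measurable_fun setT phi.
  by apply: measurable_funD => //; exact: measurable_funM.
rewrite -[LHS]/(\int[L1]_(t in phi @^-1` setT) (f \o phi) t)%E.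
rewrite -ge0_integral_pushforward//.
apply: eq_measure_integral => A mA _; apply/esym/lebesgue_measure_unique => //= _ [[a b]] _ <-.
rewrite /pushforward /= -[X in _ = X]/(L1 [set t | phi t \in `]a, b]]).
case: s1 => s1; rewrite /phi s1.
  rewrite [X in _ = L1 X](_ : _ = `]a - h, b - h]%classic); last first.
    by apply/seteqP; split => t /=; rewrite !in_itv/= mul1r; lra.
  rewrite !lebesgue_measure_itv/= !lte_fin ltrD2r; case: ifPn => // _.
  by rewrite -!EFinD; congr EFin; lra.
rewrite [X in _ = L1 X](_ : _ = `[h - b, h - a[%classic); last first.
  by apply/seteqP; split => t /=; rewrite !in_itv/= mulN1r; lra.
rewrite !lebesgue_measure_itv/= !lte_fin ltrD2l ltrN2; case: ifPn => // _.
by rewrite -!EFinD; congr EFin; lra.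
Qed.

Lemma integral_snoc n (f : 'rV[R]_n.+1 -> \bar R) :
  measurable_fun setT f -> (forall x, 0 <= f x)%E ->
  (\int[rV_lebesgue]_x f x = \int[rV_lebesgue]_x \int[L1]_t f (rV_snoc x t))%E.
Proof.
move=> mf f0.
have mj := @measurable_rV_join R n.
have -> : (\int[rV_lebesgue]_x f x =
    \int[pushforward (@rV_lebesgue R n \x L1) (@rV_join R n)]_x f x)%E by [].
rewrite ge0_integral_pushforward//= fubini_tonelli1//.
exact: measurableT_comp.
Qed.

(** One coordinatewise form covers translations ([s] constantly 1), the point reflections of
    convolution ([s] constantly -1) and the reflections across the faces (a single entry -1). *)
Definition aff n (s h x : 'rV[R]_n) : 'rV[R]_n :=
  \row_i (s ord0 i * x ord0 i + h ord0 i).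

Definition unimod n (s : 'rV[R]_n) := forall i, s ord0 i = 1 \/ s ord0 i = -1.

Lemma measurable_aff n (s h : 'rV[R]_n) : measurable_fun setT (aff s h).
Proof.
apply/measurable_fun_rVP => i.
rewrite (_ : _ \o _ = fun x => s ord0 i * rV_coord i x + h ord0 i).
  apply: measurable_funD => //; apply: measurable_funM => //.
  exact: measurable_rV_coord.
by apply/funext => x; rewrite /rV_coord/= mxE.
Qed.

Lemma aff_snoc n (s h : 'rV[R]_n.+1) x t : aff s h (rV_snoc x t) =
  rV_snoc (aff (col' ord_max s) (col' ord_max h) x) (s ord0 ord_max * t + h ord0 ord_max).
Proof.
apply/rowP => i; rewrite !mxE; case: unliftP => [j ->|->] /=.
  by rewrite !mxE.
by [].
Qed.

Lemma measurable_rV_snoc n (x : 'rV[R]_n) : measurable_fun setT (rV_snoc x : measurableTypeR R -> _).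
Proof.
have -> : rV_snoc x = @rV_join R n \o (pair x) by [].
apply: measurableT_comp; first exact: measurable_rV_join.
exact: measurable_pair1.
Qed.

Lemma ge0_integral_aff n (s h : 'rV[R]_n) (f : 'rV[R]_n -> \bar R) : unimod s ->
  measurable_fun setT f -> (forall x, 0 <= f x)%E ->
  (\int[rV_lebesgue]_x f (aff s h x) = \int[rV_lebesgue]_x f x)%E.
Proof.
elim: n s h f => [|n IH] s h f s1 mf f0.
  by apply: eq_integral => x _; rewrite (thinmx0 (aff s h x)) (thinmx0 x).
have mfa : measurable_fun setT (fun x => f (aff s h x)).
  by apply: measurableT_comp mf _; exact: measurable_aff.
rewrite (integral_snoc mfa)// (integral_snoc mf)//.
have s1' : unimod (col' ord_max s) by move=> i; rewrite mxE; exact: s1.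
have mF : measurable_fun setT (fun x => \int[L1]_t f (rV_snoc x t))%E.
  have := @measurable_fun_fubini_tonelli_F _ _ _ (measurableTypeR R) R L1 (f \o @rV_join R n).
  apply => //=; apply: measurableT_comp mf _; exact: measurable_rV_join.
have F0 x : (0 <= \int[L1]_t f (rV_snoc x t))%E by exact: integral_ge0.
rewrite -(IH _ (col' ord_max h) _ s1' mF F0).
apply: eq_integral => x _; under eq_integral do rewrite aff_snoc.
apply: (lebesgue_integral_affine _ (f := fun t => f (rV_snoc _ t))) => //.
by apply: measurableT_comp mf _; exact: measurable_rV_snoc.
Qed.

Lemma integral_aff n (s h : 'rV[R]_n) (f : 'rV[R]_n -> \bar R) : unimod s ->
  measurable_fun setT f ->
  (\int[rV_lebesgue]_x f (aff s h x) = \int[rV_lebesgue]_x f x)%E.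
Proof.
move=> s1 mf; rewrite integralE [RHS]integralE; congr (_ - _)%E.
  rewrite -(ge0_integral_aff h s1 (measurable_funepos mf) (funepos_ge0 f)).
  by apply: eq_integral => x _; rewrite !funeposE.
rewrite -(ge0_integral_aff h s1 (measurable_funeneg mf) (funeneg_ge0 f)).
by apply: eq_integral => x _; rewrite !funenegE.
Qed.

Lemma intg_aff n (s h : 'rV[R]_n) (f : 'rV[R]_n -> R) : unimod s ->
  intg rV_lebesgue f -> intg rV_lebesgue (fun x => f (aff s h x)).
Proof.
move=> s1 /integrableP[mf fi]; apply/integrableP; split.
  by apply: (measurableT_comp mf); exact: measurable_aff.
have := @integral_aff _ s h (fun x => `|(f x)%:E|%E) s1.
by move=> -> //; exact: measurableT_comp.
Qed.

Lemma Rint_aff n (s h : 'rV[R]_n) (f : 'rV[R]_n -> R) : unimod s ->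
  measurable_fun setT f ->
  \int[rV_lebesgue]_x f (aff s h x) = \int[rV_lebesgue]_x f x.
Proof.
move=> s1 mf; congr fine; apply: (integral_aff h (f := EFin \o f)) => //.
exact/measurable_EFinP.
Qed.

Lemma sqint_aff n (s h : 'rV[R]_n) (f : 'rV[R]_n -> R) : unimod s ->
  sqint rV_lebesgue f -> sqint rV_lebesgue (fun x => f (aff s h x)).
Proof.
move=> s1 [mf f2]; split; first by apply: (measurableT_comp mf); exact: measurable_aff.
exact: (intg_aff h s1 f2).
Qed.

Lemma Rint_snoc n (f : 'rV[R]_n.+1 -> R) : intg rV_lebesgue f ->
  [/\ \forall x \ae rV_lebesgue, L1.-integrable setT (fun t => (f (rV_snoc x t))%:E),
    rV_lebesgue.-integrable setT (fun x => \int[L1]_t (f (rV_snoc x t))%:E)%E &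
    \int[rV_lebesgue]_x f x = fine (\int[rV_lebesgue]_x \int[L1]_t (f (rV_snoc x t))%:E)%E].
Proof.
move=> /integrableP[mf fi]; have mj := @measurable_rV_join R n.
have mfj : measurable_fun setT (EFin \o (f \o @rV_join R n)) by exact: measurableT_comp mf mj.
have ij : (@rV_lebesgue R n \x L1)%E.-integrable setT (EFin \o (f \o @rV_join R n)).
  apply/integrableP; split => //.
  rewrite (_ : (\int[_]_x _)%E = \int[rV_lebesgue]_x `|(f x)%:E|)%E//.
  have -> : (\int[rV_lebesgue]_x `|(f x)%:E| =
    \int[pushforward (@rV_lebesgue R n \x L1) (@rV_join R n)]_x `|(f x)%:E|)%E by [].
  rewrite ge0_integral_pushforward//; exact: measurableT_comp.
split.
- by have := ae_integrable1 ij.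
- by have := integrable_fubini_F ij.
- congr fine; rewrite -[RHS]/(\int[rV_lebesgue]_x (fubini_F L1 (EFin \o (f \o @rV_join R n)) x))%E.
  rewrite (integral12_prod_meas1 ij).
  have -> : (\int[rV_lebesgue]_x (f x)%:E =
    \int[pushforward (@rV_lebesgue R n \x L1) (@rV_join R n)]_x (f x)%:E)%E by [].
  by rewrite integral_pushforward.
Qed.

Definition cube n (M : R) : set 'rV[R]_n := [set x | forall i, `|x ord0 i| <= M].

Lemma measurable_cube n M : measurable (@cube n M).
Proof.
rewrite (_ : cube _ = [set x | forall i, `[(- M), M]%classic (x ord0 i)]).
  by apply: (@rV_measurable_forall R n (fun=> `[(- M), M]%classic)) => i; exact: measurable_itv.
by apply/seteqP; split => x h i; have := h i; rewrite /= in_itv/= ler_norml.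
Qed.

Lemma preimage_join_cube n M :
  @rV_join R n @^-1` cube M = @cube n M `*` `[- M, M].
Proof.
apply/seteqP; split => -[x t] /=.
  move=> H; split=> [i|].
    by have := H (lift ord_max i); rewrite /rV_join mxE liftK.
  by have := H ord_max; rewrite /rV_join rV_snoc_last in_itv/= -ler_norml.
move=> [H1 H2] i; rewrite /rV_join mxE; case: unliftP => [j _|_] /=; first exact: H1.
by move: H2; rewrite in_itv/= -ler_norml.
Qed.

Lemma rV_lebesgue_cube n M : (rV_lebesgue (@cube n M) < +oo)%E.
Proof.
elim: n => [|n IH].
  by rewrite /= /rV_lebesgue/= diracE; case: (_ \in _); rewrite /= ltry.
rewrite -[X in (X < _)%E]/((@rV_lebesgue R n \x L1)%E (@rV_join R n @^-1` cube M)).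
rewrite preimage_join_cube product_measure1E//; last exact: measurable_cube.
rewrite lte_mul_pinfty ?ge0_fin_numE//.
rewrite -[X in (X < _)%E]/(L1 `[(- M)%R, M]%classic).
by rewrite lebesgue_measure_itv/=; case: ifPn => // _; rewrite -EFinD ltry.
Qed.

Lemma bounded_cube n (A : set 'rV[R]_n) : bounded_set A -> exists M, A `<=` cube M.
Proof.
move=> [M [_ H]]; exists (M + 1) => x Ax i.
by apply: le_trans (rV_coord_le x i) _; apply: H => //; rewrite ltrDl.
Qed.

Lemma rV_lebesgue_bounded n (A : set 'rV[R]_n) : measurable A -> bounded_set A ->
  (rV_lebesgue A < +oo)%E.
Proof.
move=> mA /bounded_cube[M AM]; apply: le_lt_trans (rV_lebesgue_cube n M).
by apply: le_measure; rewrite ?inE//; exact: measurable_cube.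
Qed.

Lemma sqint_indic n (A : set 'rV[R]_n) : measurable A -> bounded_set A ->
  sqint rV_lebesgue (\1_A : _ -> R).
Proof.
move=> mA bA; split; first exact: measurable_indic.
rewrite (_ : (fun _ => _) = \1_A); last first.
  by apply/funext => x; rewrite indicE; case: (_ \in _); rewrite ?expr1n ?expr0n.
apply/integrableP; split; first exact/measurable_EFinP/measurable_indic.
rewrite (_ : (\int[_]_x _)%E = (\int[rV_lebesgue]_x (\1_A x)%:E)%E); last first.
  by apply: eq_integral => x _; rewrite gee0_abs// lee_fin.
by rewrite integral_indic// setIT rV_lebesgue_bounded.
Qed.

Lemma bounded_cubeP n M : bounded_set (@cube n M).
Proof.
exists `|M|; split; first exact: num_real.
move=> x Mx y /= yM; apply/rV_norm_leP => [|i].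
  by apply: le_trans (ltW Mx).
by apply: le_trans (yM i) _; apply: le_trans (ltW Mx); exact: ler_norm.
Qed.

Lemma sqint_intg n (M : R) (f : 'rV[R]_n -> R) : sqint rV_lebesgue f ->
  (forall x, ~ cube M x -> f x = 0) -> intg rV_lebesgue f.
Proof.
move=> sf f0; have := sqintM sf (sqint_indic (@measurable_cube n M) (@bounded_cubeP n M)).
rewrite (_ : (fun x => _) = f)//; apply/funext => x; rewrite indicE.
by case: (asboolP (cube M x)) => h; [rewrite mem_set ?mulr1|rewrite f0 ?mul0r].
Qed.

Lemma bounded_sqint n (M C : R) (f : 'rV[R]_n -> R) : measurable_fun setT f ->
  (forall x, `|f x| <= C) -> (forall x, ~ cube M x -> f x = 0) -> sqint rV_lebesgue f.
Proof.
move=> mf fC f0.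
have := sqintMb (sqint_indic (@measurable_cube n M) (@bounded_cubeP n M)) mf fC.
rewrite (_ : (fun x => _) = f)//; apply/funext => x; rewrite indicE.
by case: (asboolP (cube M x)) => h; [rewrite mem_set ?mul1r|rewrite f0 ?mulr0].
Qed.

End rV_measure.

(** * Smooth functions and test functions *)

Section smooth1.
Context (R : realType).
Implicit Types (f g h : R -> R).

(* A coinductive definition: [P] is a class of functions closed under derivation. *)
Definition smooth1 h := exists2 P : (R -> R) -> Prop, P h &
  forall g, P g -> exists2 g', P g' & forall t : R, is_derive t 1 g (g' t).

Lemma is_derive1_continuous f (t d : R) : is_derive t 1 f d -> {for t, continuous f}.
Proof. by move=> fd; apply: differentiable_continuous; apply/derivable1_diffP. Qed.

Lemma smooth1_continuous h : smooth1 h -> continuous h.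
Proof. by case=> P Ph /(_ _ Ph)[g' _ hd] t; apply: is_derive1_continuous (hd t). Qed.

(** The powers [t^-p] are included because differentiating [exp (- 1/t)] only produces combinations
    of these functions, so the family supports the coinductive proof of smoothness. *)
Definition expinv (p : nat) (t : R) : R := if 0 < t then t^-1 ^+ p * expR (- t^-1) else 0.

(** Take the [n]-th power of [s / n <= exp (s / n)]. *)
Lemma expR_ge_pow (n : nat) (s : R) : 0 <= s -> s ^+ n <= n%:R ^+ n * expR s.
Proof.
case: n => [|n] s0; first by rewrite !expr0 mul1r; apply: le_trans (expR_ge1Dx s); rewrite lerDl.
have n0 : 0 < n.+1%:R :> R by [].
have {2}-> : s = n.+1%:R * (s / n.+1%:R) by rewrite mulrC divfK// gt_eqF.
rewrite expRM_natl -exprMn lerXn2r ?nnegrE ?mulr_ge0 ?expR_ge0//.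
rewrite -ler_pdivrMl// mulrC; apply: le_trans (expR_ge1Dx _).
by rewrite lerDr.
Qed.

(** Apply [expR_ge_pow] to [s = 1 / t] with exponent [p + 2]: the two surplus powers leave [t ^ 2],
    so that the difference quotient at 0 is [O(t)]. *)
Lemma expinv_bound p (t : R) : `|expinv p t| <= p.+2%:R ^+ p.+2 * t ^+ 2.
Proof.
rewrite /expinv; case: ifPn => [t0|_]; last by rewrite normr0 mulr_ge0 ?sqr_ge0// exprn_ge0.
have s0 : 0 < t^-1 by rewrite invr_gt0.
rewrite ger0_norm; last by rewrite mulr_ge0 ?expR_ge0// exprn_ge0// ltW.
rewrite expRN ler_pdivrMr ?expR_gt0// mulrAC -ler_pdivrMr ?exprn_gt0//.
apply: le_trans (expR_ge_pow p.+2 (ltW s0)).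
by rewrite -exprVn -exprD addn2.
Qed.

Lemma is_derive_expinv p (t : R) :
  is_derive t 1 (expinv p) (- p%:R * expinv p.+1 t + expinv p.+2 t).
Proof.
have [t0|t0|->] := ltgtP t 0.
- have n1 : \near t, 0 = expinv p t.
    by near=> u; rewrite /expinv ltNge ltW//; near: u; exact: lt_nbhsl.
  apply: near_eq_is_derive n1 _.
  rewrite /expinv ltNge (ltW t0)/= mulr0 addr0; exact: is_derive_cst.
- have n1 : \near t, t^-1 ^+ p * expR (- t^-1) = expinv p t.
    by near=> u; rewrite /expinv ifT//; near: u; exact: lt_nbhsr.
  apply: near_eq_is_derive n1 _.
  have dV : is_derive t 1 (fun u : R => u^-1) (- t^-1 ^+ 2).
    apply: is_derive_eq; first by apply: is_deriveV; rewrite gt_eqF.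
    by rewrite /GRing.scale/= mulr1 exprVn.
  have dE : is_derive t 1 (fun u : R => expR (- u^-1)) (expR (- t^-1) * (t^-1 ^+ 2)).
    apply: (is_derive1_comp (f := expR) (g := fun u : R => - u^-1)).
    by apply: is_derive_eq; rewrite opprK.
  have := is_deriveM (is_deriveX p dV) dE.
  rewrite (_ : (_ * _)%R = fun u => u^-1 ^+ p * expR (- u^-1)); last first.
    by apply/funext => u; rewrite !fctE.
  move=> H; apply: is_derive_eq.
  rewrite /expinv t0 /GRing.scale/= !fctE; case: p H => [|p] H /=.
    by rewrite !expr0; ring.
  by rewrite !exprS; ring.
- have E0 q : expinv q 0 = 0 by rewrite /expinv ltxx.
  rewrite !E0 mulr0 addr0.
  have cv : h^-1 *: ((expinv p \o shift 0) (h *: 1) - expinv p 0) @[h --> (0:R)^'] --> (0 : R).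
    apply/cvgr0Pnorm_le => e e0.
    pose M : R := p.+2%:R ^+ p.+2.
    have M0 : 0 < M by rewrite exprn_gt0.
    near=> h; rewrite /= addr0 [h *: 1]mulr1 E0 subr0 /GRing.scale/= normrM.
    have h0 : 0 < `|h| by rewrite normr_gt0; near: h; exact: nbhs_dnbhs_neq.
    rewrite normfV ler_pdivrMl//; apply: le_trans (expinv_bound p h) _.
    rewrite -/M -(real_normK (num_real h)) expr2 mulrA [leRHS]mulrC ler_pM2r//.
    rewrite -ler_pdivlMl//.
    by apply: ltW; near: h; apply: dnbhs0_lt; rewrite mulr_gt0 ?invr_gt0.
  by apply: DeriveDef; [apply/cvg_ex; exists 0|apply/cvg_lim].
Unshelve. all: by end_near. Qed.

(** The derivative of each constructor is again built from constructors, so this class is itself the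
    witness [P] of [smooth1]; no formula for higher derivatives of products or compositions is
    needed. *)
Inductive smooth1_alg : (R -> R) -> Prop :=
| S1_base h : smooth1 h -> smooth1_alg h
| S1_expinv p : smooth1_alg (expinv p)
| S1_cst c : smooth1_alg (fun=> c)
| S1_id : smooth1_alg id
| S1_add f g : smooth1_alg f -> smooth1_alg g -> smooth1_alg (fun t => f t + g t)
| S1_mul f g : smooth1_alg f -> smooth1_alg g -> smooth1_alg (fun t => f t * g t)
| S1_comp f g : smooth1_alg f -> smooth1_alg g -> smooth1_alg (fun t => f (g t)).

Lemma smooth1_algP h : smooth1_alg h -> smooth1 h.
Proof.
move=> Ah; exists smooth1_alg => // {Ah}{}h; elim=> {h}.
- move=> h [P Ph hP]; have [g' Pg' hd] := hP _ Ph; exists g' => //.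
  by apply: S1_base; exists P.
- move=> p; exists (fun t => - p%:R * expinv p.+1 t + expinv p.+2 t).
    apply: S1_add; last exact: S1_expinv.
    by apply: S1_mul; [exact: S1_cst|exact: S1_expinv].
  exact: is_derive_expinv.
- by move=> c; exists (fun=> 0); [exact: S1_cst|move=> t; exact: is_derive_cst].
- by exists (fun=> 1); [exact: S1_cst|move=> t; exact: is_derive_id].
- move=> f g _ [f' Af fd] _ [g' Ag gd]; exists (fun t => f' t + g' t); first exact: S1_add.
  by move=> t; exact: is_deriveD.
- move=> f g Hf [f' Af fd] Hg [g' Ag gd]; exists (fun t => f t * g' t + g t * f' t).
    by apply: S1_add; exact: S1_mul.
  by move=> t; exact: is_deriveM.
- move=> f g Hf [f' Af fd] Hg [g' Ag gd]; exists (fun t => f' (g t) * g' t).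
    by apply: S1_mul => //; exact: S1_comp.
  by move=> t; exact: (is_derive1_comp (f := f)).
Qed.

(** A smooth descent from 1 on [t <= 0] to 0 on [t >= 1]. As [expinv 0 1 = exp (-1)], the factors
    [exp 1] normalize both layers. Composing instead of dividing keeps it inside [smooth1_alg]. *)
Definition step (t : R) : R := expR 1 * expinv 0 (1 - expR 1 * expinv 0 t).

Lemma smooth1_step : smooth1 step.
Proof.
apply: smooth1_algP; apply: S1_mul; first exact: S1_cst.
apply: (S1_comp (f := expinv 0)); first exact: S1_expinv.
apply: S1_add; first exact: S1_cst.
rewrite (_ : (fun _ => _) = fun t => - expR 1 * expinv 0 t).
  by apply: S1_mul; [exact: S1_cst|exact: S1_expinv].
by apply/funext => t; rewrite mulNr.
Qed.

Lemma step_le0 t : t <= 0 -> step t = 1.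
Proof.
move=> t0; rewrite /step {2}/expinv ltNge t0/= mulr0 subr0 /expinv ltr01 expr0 mul1r.
by rewrite invr1 -expRD subrr expR0.
Qed.

Lemma step_ge1 t : 1 <= t -> step t = 0.
Proof.
move=> t1; have t0 : 0 < t by exact: lt_le_trans t1.
rewrite /step /expinv t0 !expr0 !mul1r -expRD ifF ?mulr0//.
by apply/negbTE; rewrite -leNgt subr_le0 -[leLHS]expR0 ler_expR subr_ge0 invf_le1//.
Qed.

Lemma step_ge0 t : 0 <= step t.
Proof.
rewrite mulr_ge0 ?expR_ge0// /expinv; case: ifPn => // _.
by rewrite mulr_ge0 ?expR_ge0// expr0.
Qed.

Lemma step_le1 t : step t <= 1.
Proof.
rewrite /step [X in _ * X]/expinv; case: ifPn => h; last by rewrite mulr0.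
rewrite expr0 mul1r -expRD -[leRHS]expR0 ler_expR subr_le0 invf_ge1//.
rewrite lerBlDr lerDl mulr_ge0 ?expR_ge0// /expinv; case: ifPn => // _.
by rewrite mulr_ge0 ?expR_ge0// expr0.
Qed.

End smooth1.

Lemma is_derive_line (R : realType) (V : normedModType R) (f : V -> R) (x v : V) (d : R) :
  is_derive x v f d <-> is_derive (0 : R) 1 (fun t : R => f (t *: v + x)) d.
Proof.
have e : (fun h : R => h^-1 *: ((f \o shift x) (h *: v) - f x)) =
    (fun h : R => h^-1 *: (((fun t : R => f (t *: v + x)) \o shift 0) (h *: 1)
      - (fun t : R => f (t *: v + x)) 0)).
  by apply/funext => h /=; rewrite addr0 [h *: 1]mulr1 scale0r add0r.
by split=> -[dx dv]; apply: DeriveDef; move: dx dv; rewrite /derivable /derive e.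
Qed.

(** * Smooth functions of several variables *)

Section rV_smooth.
Context (R : realType) (N : nat).
Local Notation E := 'rV[R]_N.
Implicit Types (f g : E -> R) (x y v : E).

Definition dir (i : 'I_N) : E := delta_mx ord0 i.

Lemma is_derive_shift_line f x v (t d : R) : is_derive (t *: v + x) v f d ->
  is_derive t 1 (fun t : R => f (t *: v + x)) d.
Proof.
move=> /is_derive_line H; apply/is_derive_line.
rewrite (_ : (fun s : R => _) = (fun t0 => f (t0 *: v + (t *: v + x))))//.
by apply/funext => s; rewrite scalerDl [s *: 1]mulr1 addrA.
Qed.

(** [smooth] speaks of all iterated partials at once; a class of continuous functions closed under
    partials contains all of them. *)
Lemma smooth_coind (P : (E -> R) -> Prop) :
  (forall f, P f -> continuous f /\ exists2 g : 'I_N -> E -> R, (forall i, P (g i)) &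
     forall i x, is_derive x (dir i) f (g i x)) ->
  forall f, P f -> smooth f.
Proof.
move=> HP f Pf alpha.
have Pa : P (iter_partial alpha f).
  elim: alpha => //= i alpha /HP[_ [g Pg gd]].
  rewrite (_ : partial _ _ = g i)//.
  by apply/funext => x; apply: (@derive_val _ _ _ _ _ _ _ (gd i x)).
by have [cf [g _ gd]] := HP _ Pa.
Qed.

Lemma smooth_partial i f : smooth f -> smooth (partial i f).
Proof.
move=> sf alpha; have := sf (rcons alpha i).
by rewrite /iter_partial foldr_rcons.
Qed.

Lemma smooth_continuous f : smooth f -> continuous f.
Proof. by move=> sf; have [] := sf [::]. Qed.

Lemma smooth_is_derive f : smooth f -> forall i x, is_derive x (dir i) f (partial i f x).
Proof. by move=> sf i x; have [_ /(_ i x)] := sf [::]; exact: derivableP. Qed.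

Lemma partialP f (g : E -> R) i : (forall x, is_derive x (dir i) f (g x)) -> partial i f = g.
Proof. by move=> fg; apply/funext => x; apply: (@derive_val _ _ _ _ _ _ _ (fg x)). Qed.

Lemma aff_shift (s h v x : E) : aff s h (v + x) = (\row_i (s ord0 i * v ord0 i)) + aff s h x.
Proof. by apply/rowP => i; rewrite !mxE; ring. Qed.

Lemma aff_line (s h x : E) i (t : R) :
  aff s h (t *: dir i + x) = (s ord0 i * t) *: dir i + aff s h x.
Proof.
rewrite aff_shift; congr (_ + _); apply/rowP => j; rewrite !mxE eqxx/=.
by case: eqVneq => [->|_]; rewrite ?mulr1 ?mulr0.
Qed.

Lemma is_derive_aff f (s h : E) i x d : is_derive (aff s h x) (dir i) f d ->
  is_derive x (dir i) (fun x => f (aff s h x)) (s ord0 i * d).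
Proof.
move=> /is_derive_line H; apply/is_derive_line.
under eq_fun do rewrite aff_line.
rewrite mulrC; apply: (is_derive1_comp (f := fun t => f (t *: dir i + aff s h x))).
  by rewrite mulr0.
have H1 : is_derive (0 : R) 1 (s ord0 i *: (id : R -> R)) (s ord0 i).
  by apply: is_derive_eq; rewrite [_ *: _]mulr1.
exact: H1.
Qed.

Lemma is_derive_coord (h : R -> R) (i j : 'I_N) x d : is_derive (x ord0 j) 1 h d ->
  is_derive x (dir i) (fun x : E => h (x ord0 j)) ((i == j)%:R * d).
Proof.
move=> hd; apply/is_derive_line; rewrite mulrC.
rewrite (_ : (fun t : R => _) = h \o (fun t : R => (i == j)%:R * t + x ord0 j)); last first.
  by apply/funext => t /=; rewrite !mxE eqxx/= eq_sym mulrC.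
apply: is_derive1_comp; first by rewrite mulr0 add0r.
have H1 : is_derive (0 : R) 1 ((i == j)%:R *: (id : R -> R) + cst (x ord0 j)) (i == j)%:R.
  by apply: is_derive_eq; rewrite [_ *: _]mulr1 addr0.
exact: H1.
Qed.

Lemma continuous_coord j : continuous (fun x : E => x ord0 j).
Proof. exact: coord_continuous. Qed.

Lemma continuous_aff (s h : E) : continuous (aff s h).
Proof.
move=> x A /nbhs_ballP[e /= e0 eA].
have d1 : 0 < `|s| + 1 by rewrite ltr_wpDl.
apply/nbhs_ballP; exists ((`|s| + 1)^-1 * e); first by rewrite /= mulr_gt0 ?invr_gt0.
move=> y; rewrite -ball_normE /ball_/= => xy; apply: eA; apply/rV_ballP => // i; rewrite distrC.
rewrite !mxE opprD addrACA subrr addr0 -mulrBr normrM.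
have s1 : 0 < `|s ord0 i| + 1 by rewrite ltr_wpDl.
apply: (@le_lt_trans _ _ ((`|s ord0 i| + 1) * `|x - y|)).
  apply: ler_pM => //; first by rewrite lerDl.
  by have := rV_coord_le (x - y) i; rewrite !mxE.
apply: (@le_lt_trans _ _ ((`|s| + 1) * `|x - y|)).
  by rewrite ler_wpM2r// lerD2r rV_coord_le.
by rewrite -ltr_pdivlMl.
Qed.

Inductive smooth_alg : (E -> R) -> Prop :=
| SN_base f : smooth f -> smooth_alg f
| SN_cst c : smooth_alg (fun=> c)
| SN_coord h j : smooth1 h -> smooth_alg (fun x => h (x ord0 j))
| SN_add f g : smooth_alg f -> smooth_alg g -> smooth_alg (fun x => f x + g x)
| SN_mul f g : smooth_alg f -> smooth_alg g -> smooth_alg (fun x => f x * g x)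
| SN_aff f s h : smooth_alg f -> smooth_alg (fun x => f (aff s h x)).

Lemma smooth_algP f : smooth_alg f -> smooth f.
Proof.
move: f; apply: smooth_coind => f; elim=> {f}.
- move=> f sf; split; first exact: smooth_continuous.
  exists (fun i => partial i f); last exact: smooth_is_derive.
  by move=> i; apply: SN_base; exact: smooth_partial.
- move=> c; split; first exact: cst_continuous.
  by exists (fun _ _ => 0) => [i|i x]; [exact: SN_cst|exact: is_derive_cst].
- move=> h j sh; split.
    move=> x; apply: (continuous_comp (f := fun x : E => x ord0 j)).
      exact: continuous_coord.
    exact: smooth1_continuous.
  have [P Ph Pd] := sh; have [h' Ph' hd] := Pd _ Ph.
  exists (fun i x => (i == j)%:R * h' (x ord0 j)) => [i|i x]; last exact: is_derive_coord.
  by apply: SN_mul; [exact: SN_cst|apply: SN_coord; exists P].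
- move=> f g _ [cf [f' Af fd]] _ [cg [g' Ag gd]]; split.
    by move=> x; apply: continuousD; [exact: (cf x)|exact: (cg x)].
  exists (fun i x => f' i x + g' i x) => [i|i x]; first exact: SN_add.
  exact: is_deriveD.
- move=> f g Hf [cf [f' Af fd]] Hg [cg [g' Ag gd]]; split.
    by move=> x; apply: continuousM; [exact: (cf x)|exact: (cg x)].
  exists (fun i x => f x * g' i x + g x * f' i x) => [i|i x].
    by apply: SN_add; exact: SN_mul.
  exact: is_deriveM.
- move=> f s h Hf [cf [f' Af fd]]; split.
    by move=> x; apply: (continuous_comp (f := aff s h)); [exact: continuous_aff|exact: cf].
  exists (fun i x => s ord0 i * f' i (aff s h x)) => [i|i x]; last exact: is_derive_aff.
  by apply: SN_mul; [exact: SN_cst|exact: SN_aff].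
Qed.

Lemma smooth_cst (c : R) : smooth (fun _ : E => c).
Proof. by apply: smooth_algP; exact: SN_cst. Qed.

Lemma smooth_coord (h : R -> R) j : smooth1 h -> smooth (fun x : E => h (x ord0 j)).
Proof. by move=> sh; apply: smooth_algP; exact: SN_coord. Qed.

Lemma smoothD f g : smooth f -> smooth g -> smooth (fun x => f x + g x).
Proof. by move=> sf sg; apply: smooth_algP; apply: SN_add; exact: SN_base. Qed.

Lemma smoothM f g : smooth f -> smooth g -> smooth (fun x => f x * g x).
Proof. by move=> sf sg; apply: smooth_algP; apply: SN_mul; exact: SN_base. Qed.

Lemma smoothZ a f : smooth f -> smooth (fun x => a * f x).
Proof. by move=> sf; exact: (@smoothM (fun=> a) f (smooth_cst a) sf). Qed.

Lemma smoothB f g : smooth f -> smooth g -> smooth (fun x => f x - g x).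
Proof.
move=> sf sg; rewrite (_ : (fun _ => _) = fun x => f x + (-1) * g x).
  exact: (@smoothD f (fun x => -1 * g x) sf (smoothZ (-1) sg)).
by apply/funext => x; ring.
Qed.

Lemma smooth_aff f s h : smooth f -> smooth (fun x => f (aff s h x)).
Proof. by move=> sf; apply: smooth_algP; apply: SN_aff; exact: SN_base. Qed.

Lemma smooth_prod (I : Type) (r : seq I) (F : I -> E -> R) :
  (forall i, smooth (F i)) -> smooth (fun x => \prod_(i <- r) F i x).
Proof.
move=> sF; elim: r => [|i r IH].
  by under eq_fun do rewrite big_nil; exact: smooth_cst.
under eq_fun do rewrite big_cons.
exact: (@smoothM (F i) (fun x => \prod_(j <- r) F j x) (sF i) IH).
Qed.

Lemma partialD i f g : smooth f -> smooth g ->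
  partial i (fun x => f x + g x) = fun x => partial i f x + partial i g x.
Proof. by move=> sf sg; apply: partialP => x; apply: is_deriveD; exact: smooth_is_derive. Qed.

Lemma partialM i f g : smooth f -> smooth g ->
  partial i (fun x => f x * g x) = fun x => f x * partial i g x + g x * partial i f x.
Proof. by move=> sf sg; apply: partialP => x; apply: is_deriveM; exact: smooth_is_derive. Qed.

Lemma partial_cst i (c : R) : partial i (fun _ : E => c) = fun=> 0.
Proof. by apply: partialP => x; exact: is_derive_cst. Qed.

Lemma partialZ i a f : smooth f -> partial i (fun x => a * f x) = fun x => a * partial i f x.
Proof.
move=> sf; rewrite (@partialM i (fun=> a) f (smooth_cst a) sf).
by apply/funext => x; rewrite partial_cst mulr0 addr0.
Qed.

Lemma partial_aff i f s h : smooth f ->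
  partial i (fun x => f (aff s h x)) = fun x => s ord0 i * partial i f (aff s h x).
Proof.
move=> sf; apply: partialP => x; apply: is_derive_aff; exact: smooth_is_derive.
Qed.

Lemma partial_coord i (h h' : R -> R) j : (forall t : R, is_derive t 1 h (h' t)) ->
  partial i (fun x : E => h (x ord0 j)) = fun x => (i == j)%:R * h' (x ord0 j).
Proof. by move=> hd; apply: partialP => x; exact: is_derive_coord. Qed.

End rV_smooth.

(** * Test functions: closure properties, Lipschitz bounds and difference quotients *)

Section test_functions.
Context (R : realType) (N : nat).
Local Notation E := 'rV[R]_N.
Implicit Types (f g phi : E -> R) (x y v : E) (Om : set E).
Local Notation mu := (@rV_lebesgue R N).

Lemma rV_compact_closed (K : set E) : compact K -> closed K.
Proof. by apply: compact_closed; exact: norm_hausdorff. Qed.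

Lemma test_smooth Om phi : test_function Om phi -> smooth phi.
Proof. by case. Qed.

Lemma test_sub Om Om' phi : Om `<=` Om' -> test_function Om phi -> test_function Om' phi.
Proof.
by move=> OO [sp [K [cK KO K0]]]; split => //; exists K; split => //; exact: subset_trans OO.
Qed.

Lemma test_out Om phi x : test_function Om phi -> ~ Om x -> phi x = 0.
Proof. by move=> [_ [K [_ KO K0]]] Ox; apply: K0 => /KO. Qed.

Lemma testMr Om phi f : test_function Om phi -> smooth f -> test_function Om (fun x => f x * phi x).
Proof.
move=> [sp [K [cK KO K0]]] sf; split; first exact: (@smoothM _ _ f phi sf sp).
by exists K; split => // x /K0 ->; rewrite mulr0.
Qed.

Lemma testMl Om phi f : test_function Om phi -> smooth f -> test_function Om (fun x => phi x * f x).
Proof.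
move=> tp sf; rewrite (_ : (fun _ => _) = fun x => f x * phi x); first exact: testMr.
by apply/funext => x; rewrite mulrC.
Qed.

Lemma testZ Om phi a : test_function Om phi -> test_function Om (fun x => a * phi x).
Proof. by move=> tp; apply: (@testMr Om phi (fun=> a) tp); exact: smooth_cst. Qed.

Lemma testD Om f g : test_function Om f -> test_function Om g ->
  test_function Om (fun x => f x + g x).
Proof.
move=> [sp [K [cK KO K0]]] [sp' [K' [cK' KO' K0']]]; split.
  exact: (@smoothD _ _ f g sp sp').
exists (K `|` K'); split; first exact: compactU.
  by rewrite subUset.
by move=> x xK; rewrite K0 ?K0' ?addr0// => h; apply: xK; [right|left].
Qed.

Lemma test_cst0 Om : test_function Om (fun _ : E => 0 : R).
Proof. by split; [exact: smooth_cst|exists set0; split => //; exact: compact0]. Qed.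

Lemma test_sum (I : Type) (r : seq I) Om (F : I -> E -> R) :
  (forall i, test_function Om (F i)) -> test_function Om (fun x => \sum_(i <- r) F i x).
Proof.
move=> sF; elim: r => [|i r IH].
  by under eq_fun do rewrite big_nil; exact: test_cst0.
under eq_fun do rewrite big_cons; exact: (@testD _ (F i) (fun x => \sum_(j <- r) F j x)).
Qed.

Lemma test_partial Om phi i : test_function Om phi -> test_function Om (partial i phi).
Proof.
move=> [sp [K [cK KO K0]]]; split; first exact: smooth_partial.
exists K; split => // x xK.
have -> : partial i phi x = 'D_(dir R i) (cst 0 : E -> R) x.
  apply: near_eq_derive; have : nbhs x (~` K).
    by apply: open_nbhs_nbhs; split => //; apply: closed_openC; exact: rV_compact_closed.
  by apply: filterS => y /K0.
by rewrite derive_cst.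
Qed.

Lemma unimod_affK s h : unimod s ->
  cancel (aff s h) (aff s (\row_i (- s ord0 i * h ord0 i)) : E -> E).
Proof.
move=> s1 x; apply/rowP => i; rewrite !mxE.
by case: (s1 i) => ->; ring.
Qed.

Lemma test_aff Om phi (s h : E) : unimod s -> test_function Om phi ->
  test_function (aff s h @^-1` Om) (fun x => phi (aff s h x)).
Proof.
move=> s1 [sp [K [cK KO K0]]]; split; first exact: smooth_aff.
pose h' : E := \row_i (- s ord0 i * h ord0 i).
exists (aff s h' @` K); split.
- by apply: continuous_compact => //; apply: continuous_subspaceT; exact: continuous_aff.
- move=> _ [x Kx <-] /=.
  suff -> : aff s h (aff s h' x) = x by exact: KO.
  by apply/rowP => i; rewrite !mxE; case: (s1 i) => ->; ring.
- move=> x xK; apply: K0 => Kx; apply: xK; exists (aff s h x) => //.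
  exact: unimod_affK.
Qed.

Lemma test_bounded Om phi : test_function Om phi ->
  exists2 M, 0 <= M & forall x, `|phi x| <= M.
Proof.
move=> [sp [K [cK KO K0]]].
have cpK : compact (phi @` K).
  by apply: continuous_compact => //; apply: continuous_subspaceT; exact: smooth_continuous.
have [M [_ HM]] := compact_bounded cpK.
exists (`|M| + 1); first by rewrite addr_ge0.
move=> x; have [xK|xK] := pselect (K x); last by rewrite K0// normr0 addr_ge0.
by apply: (HM (`|M| + 1)) => //; rewrite ltr_pwDr// ler_norm.
Qed.

Lemma test_cube Om phi : test_function Om phi ->
  exists M, forall x, ~ cube M x -> phi x = 0.
Proof.
move=> [sp [K [cK KO K0]]]; have [M KM] := bounded_cube (compact_bounded cK).
by exists M => x xM; apply: K0 => /KM.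
Qed.

Lemma test_meas Om phi : test_function Om phi -> measurable_fun setT phi.
Proof. by move=> [sp _]; apply: rV_continuous_measurable; exact: smooth_continuous. Qed.

Lemma test_sqint Om phi : test_function Om phi -> sqint mu phi.
Proof.
move=> tp; have [M _ pM] := test_bounded tp; have [A pA] := test_cube tp.
exact: (bounded_sqint (test_meas tp) pM pA).
Qed.

Lemma test_intg Om phi : test_function Om phi -> intg mu phi.
Proof. by move=> tp; have [A pA] := test_cube tp; apply: (sqint_intg (test_sqint tp) pA). Qed.

Lemma smooth_mvt f x i (t : R) : smooth f ->
  exists2 c, `|c| <= `|t| & f (t *: dir R i + x) - f x = partial i f (c *: dir R i + x) * t.
Proof.
move=> sf; pose g (t : R) := f (t *: dir R i + x).
have gd (s : R) : is_derive s 1 g (partial i f (s *: dir R i + x)).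
  by apply: is_derive_shift_line; exact: smooth_is_derive.
have gc (a b : R) : {within `[a, b], continuous g}.
  by apply: derivable_within_continuous => s _; case: (gd s).
have g0 : g 0 = f x by rewrite /g scale0r add0r.
have [t0|t0] := leP 0 t.
  have [c cI ce] := MVT_segment t0 (fun s _ => gd s) (gc _ _).
  exists c; last by rewrite -g0 -[t in RHS]subr0.
  by move: cI; rewrite in_itv/= => /andP[c0 ct]; rewrite !ger0_norm.
have [c cI ce] := MVT_segment (ltW t0) (fun s _ => gd s) (gc _ _).
exists c; last by rewrite -g0 -/(g t) -[LHS]opprB ce; ring.
by move: cI; rewrite in_itv/= => /andP[c0 ct]; rewrite !ler0_norm ?lerN2// ltW.
Qed.

(** Only partial derivatives are available, so the displacement [y] is made one coordinate at a
    time, each leg by the mean value theorem. *)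
Lemma test_lip Om phi : test_function Om phi ->
  exists2 L, 0 <= L & forall x y, `|phi (y + x) - phi x| <= L * `|y|.
Proof.
move=> tp; have sp := test_smooth tp.
have /choice[M HM] i : exists M, 0 <= M /\ forall x, `|partial i phi x| <= M.
  by have [M M0 HM] := test_bounded (test_partial i tp); exists M.
exists (\sum_i M i); first by apply: sumr_ge0 => i _; exact: (HM i).1.
have key (r : seq 'I_N) x y :
    `|phi (\sum_(i <- r) y ord0 i *: dir R i + x) - phi x| <= (\sum_(i <- r) M i) * `|y|.
  elim: r x => [|i r IH] x; first by rewrite !big_nil add0r subrr normr0 mul0r.
  rewrite !big_cons mulrDl -addrA.
  set z := _ + x; rewrite -(subrKA (phi z)); apply: le_trans (ler_normD _ _) _.
  apply: lerD; last exact: IH.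
  have [c _ ->] := smooth_mvt z i (y ord0 i) sp.
  by rewrite normrM; apply: ler_pM => //; [exact: (HM i).2|exact: rV_coord_le].
by move=> x y; rewrite {1}(row_sum_delta y); exact: key.
Qed.

(** The mean value theorem turns the quotient into the partial derivative at a point within [|t|] of
    [x], and that derivative is Lipschitz. *)
Lemma test_dq Om phi i : test_function Om phi ->
  exists2 L, 0 <= L & forall x (t : R), t != 0 ->
    `|t^-1 * (phi (t *: dir R i + x) - phi x) - partial i phi x| <= L * `|t|.
Proof.
move=> tp; have [L L0 HL] := test_lip (test_partial i tp); exists L => // x t t0.
have [c ct ->] := smooth_mvt x i t (test_smooth tp).
rewrite mulrC mulfK//; apply: le_trans (HL _ _) _.
rewrite ler_wpM2l//; apply: le_trans ct.
apply/rV_norm_leP => // j; rewrite !mxE normrM eqxx/=.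
by case: (j == i); rewrite ?normr1 ?normr0 ?mulr1 ?mulr0.
Qed.

End test_functions.

(** * Integration by parts, mollification and second derivatives *)

Section parts.
Context (R : realType) (N : nat).
Local Notation E := 'rV[R]_N.
Implicit Types (f g phi : E -> R) (x y v : E) (Om : set E).
Local Notation mu := (@rV_lebesgue R N).

Lemma unimod1 : unimod (const_mx 1 : E).
Proof. by move=> i; rewrite mxE; left. Qed.

Lemma unimodN1 : unimod (const_mx (-1) : E).
Proof. by move=> i; rewrite mxE; right. Qed.

Lemma aff1 v x : aff (const_mx 1) v x = v + x.
Proof. by apply/rowP => i; rewrite !mxE mul1r addrC. Qed.

Lemma affN1 v x : aff (const_mx (-1)) v x = v - x.
Proof. by apply/rowP => i; rewrite !mxE mulN1r addrC. Qed.

Lemma Rint_transl v f : measurable_fun setT f -> \int[mu]_x f (v + x) = \int[mu]_x f x.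
Proof.
move=> mf; rewrite -(Rint_aff v unimod1 mf).
by apply: eq_Rintegral => x _; rewrite aff1.
Qed.

Lemma Rint_refl v f : measurable_fun setT f -> \int[mu]_x f (v - x) = \int[mu]_x f x.
Proof.
move=> mf; rewrite -(Rint_aff v unimodN1 mf).
by apply: eq_Rintegral => x _; rewrite affN1.
Qed.

Lemma test_transl v phi : test_function setT phi -> test_function setT (fun x => phi (v + x)).
Proof.
move=> /(test_aff v unimod1); rewrite preimage_setT.
by under [X in test_function _ X]eq_fun do rewrite aff1.
Qed.

Lemma test_refl v phi : test_function setT phi -> test_function setT (fun x => phi (v - x)).
Proof.
move=> /(test_aff v unimodN1); rewrite preimage_setT.
by under [X in test_function _ X]eq_fun do rewrite affN1.
Qed.

Lemma partial_transl v phi i : smooth phi ->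
  partial i (fun x => phi (v + x)) = fun x => partial i phi (v + x).
Proof.
move=> sp; under [X in partial _ X]eq_fun do rewrite -aff1.
by rewrite partial_aff//; apply/funext => x; rewrite aff1 mxE mul1r.
Qed.

Lemma partial_refl v phi i : smooth phi ->
  partial i (fun x => phi (v - x)) = fun x => - partial i phi (v - x).
Proof.
move=> sp; under [X in partial _ X]eq_fun do rewrite -affN1.
by rewrite partial_aff//; apply/funext => x; rewrite affN1 mxE mulN1r.
Qed.

Lemma intgMtest f phi Om : intg mu f -> test_function Om phi -> intg mu (fun x => f x * phi x).
Proof.
move=> fi tp; have [M _ pM] := test_bounded tp.
exact: (intgMb fi (test_meas tp) pM).
Qed.

(** The explicit rate [C |t|] replaces limits under the integral sign: identities between integrals
    are later obtained by comparing two such bounds through [le_lin_eq0]. *)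
Lemma dq_bound Om f phi i : intg mu f -> test_function Om phi ->
  exists2 C, 0 <= C & forall t : R, t != 0 ->
    `|t^-1 * (\int[mu]_x (f x * phi (t *: dir R i + x)) - \int[mu]_x (f x * phi x))
      - \int[mu]_x (f x * partial i phi x)| <= C * `|t|.
Proof.
move=> fi /(test_sub (@subsetT _ _)) tp; have [L L0 HL] := test_dq i tp.
exists (L * \int[mu]_x `|f x|); first by rewrite mulr_ge0// Rint_ge0.
move=> t t0.
have i1 := intgMtest fi (test_transl (t *: dir R i) tp).
have i2 := intgMtest fi tp.
have i3 := intgMtest fi (test_partial i tp).
have i4 := intgB i1 i2; have i5 := intgZ t^-1 i4; have i6 := intgB i5 i3.
rewrite -(RintB i1 i2) -(RintZ _ i4) -(RintB i5 i3).
rewrite mulrAC -(RintZ _ (intg_abs fi)); apply: Rint_abs_le => //.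
  by apply: intgZ; exact: intg_abs.
move=> x; rewrite -mulrBr mulrCA -mulrBr normrM mulrC ler_wpM2r//.
exact: HL.
Qed.

Lemma le_lin_eq0 (a C : R) : 0 <= C -> (forall t : R, t != 0 -> `|a| <= C * `|t|) -> a = 0.
Proof.
move=> C0 H; apply/eqP; rewrite -normr_le0; apply/ler_addgt0Pr => e e0; rewrite add0r.
have d0 : 0 < e / (C + 1) by rewrite divr_gt0// ltr_wpDl.
apply: le_trans (H (e / (C + 1)) _) _; first by rewrite gt_eqF.
by rewrite gtr0_norm// mulrCA ger_pMr// ler_pdivrMr ?mul1r ?lerDl// ltr_wpDl.
Qed.

(** By translation invariance the integral of each difference quotient of [phi] is 0. *)
Lemma Rint_partial0 Om phi i : test_function Om phi -> \int[mu]_x partial i phi x = 0.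
Proof.
move=> /(test_sub (@subsetT _ _)) tp; have [A0 pA0] := test_cube tp.
have [B pB] := test_cube (test_partial i tp); pose A := Num.max A0 B.
have pA x : ~ cube A x -> phi x = 0.
  by move=> Ax; apply: pA0 => xA; apply: Ax => j; rewrite (le_trans (xA j))// le_max lexx.
(* [dq_bound] needs an integrable factor, so [J] stands for the constant 1: it is 1 on the supports
   of all translates by [|t| < 1]. Larger [t] are absorbed in the constant. *)
pose J : E -> R := \1_(cube (A + 1)).
have iJ : intg mu J.
  apply: (@sqint_intg _ _ (A + 1)).
    by apply: sqint_indic; [exact: measurable_cube|exact: bounded_cubeP].
  by move=> x xc; rewrite /J indicE memNset.
have [C C0 HC] := dq_bound i iJ tp.
have JE (h : E -> R) : (forall x, ~ cube (A + 1) x -> h x = 0) -> (fun x => J x * h x) = h.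
  move=> h0; apply/funext => x; rewrite /J indicE; case: (boolP (x \in _)) => [|/negP].
    by rewrite mul1r.
  by rewrite mul0r inE => /h0.
have cubeS x : cube A x -> cube (A + 1) x by move=> Ax j; rewrite (le_trans (Ax j))// lerDl.
apply: (@le_lin_eq0 _ (C + `|\int[mu]_x partial i phi x|)); first by rewrite addr_ge0.
move=> t t0; have [t1|t1] := leP 1 `|t|.
  by rewrite mulrDl ler_wpDl ?mulr_ge0// ler_peMr.
apply: (@le_trans _ _ (C * `|t|)); last by rewrite ler_wpM2r// lerDl.
have := HC t t0.
rewrite JE; last first.
  move=> x xA; apply: pA => tA; apply: xA => j.
  have -> : x ord0 j = (t *: dir R i + x) ord0 j - (t *: dir R i) ord0 j.
    by rewrite mxE addrAC subrr add0r.
  apply: le_trans (ler_normB _ _) _; apply: lerD => //; apply: le_trans (ltW t1).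
  by rewrite !mxE normrM eqxx/=; case: (j == i); rewrite ?normr1 ?normr0 ?mulr1 ?mulr0.
rewrite JE; last by move=> x xA; apply: pA => /cubeS.
rewrite Rint_transl; last exact: test_meas tp.
rewrite subrr mulr0 sub0r normrN JE// => x xA.
apply: pB => xB; apply: xA => j.
by rewrite (le_trans (xB j))// ler_wpDr// le_max lexx orbT.
Qed.

Lemma Rint_parts Om f phi i : smooth f -> test_function Om phi ->
  \int[mu]_x (f x * partial i phi x) = - \int[mu]_x (partial i f x * phi x).
Proof.
move=> sf tp; have sp := test_smooth tp.
have := Rint_partial0 i (testMr tp sf); rewrite partialM//.
have t1 := testMr (test_partial i tp) sf.
have t2 := testMl tp (smooth_partial i sf).
rewrite RintD//; [|exact: test_intg t1|exact: test_intg t2].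
under [X in _ + X]eq_Rintegral do rewrite mulrC.
by move=> /eqP; rewrite addr_eq0 => /eqP.
Qed.

(** Symmetry of second derivatives in weak form, obtained without Schwarz's theorem. Integrating by
    parts along [j] and translating turns the quotient of [g] along [i] with step [t], tested
    against [partial j f], into the quotient of [f] with step [- t], tested against
    [partial j g]. *)
Lemma Rint_partial_swap f g i j : test_function setT f -> test_function setT g ->
  \int[mu]_x (partial j f x * partial i g x) = \int[mu]_x (partial i f x * partial j g x).
Proof.
move=> tf tg; have sf := test_smooth tf; have sg := test_smooth tg.
have [C1 C10 H1] := dq_bound i (test_intg (test_partial j tf)) tg.
have [C2 C20 H2] := dq_bound i (test_intg (test_partial j tg)) tf.
apply/eqP; rewrite -subr_eq0; apply/eqP; apply: (@le_lin_eq0 _ (C1 + C2)).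
  exact: addr_ge0.
move=> t t0; have Nt0 : - t != 0 by rewrite oppr_eq0.
have := H1 t t0; have := H2 (- t) Nt0.
set X2 := \int[mu]_x (partial j g x * partial i f x).
have -> : X2 = \int[mu]_x (partial i f x * partial j g x).
  by apply: eq_Rintegral => x _; rewrite mulrC.
have shiftE : \int[mu]_x (partial j f x * g (t *: dir R i + x)) =
    - \int[mu]_x (partial j g x * f (- t *: dir R i + x)).
  have tg' := test_transl (t *: dir R i) tg.
  have := Rint_parts j sf tg'; rewrite partial_transl// => h.
  apply/eqP; rewrite -eqr_oppLR -h; apply/eqP.
  have tm : measurable_fun setT (fun x => partial j g x * f (- t *: dir R i + x)).
    apply: measurable_funM; first exact: test_meas (test_partial j tg).
    exact: test_meas (test_transl _ tf).
  rewrite -(Rint_transl (t *: dir R i) tm); apply: eq_Rintegral => x _.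
  by rewrite addrA -scalerDl addNr scale0r add0r mulrC.
have stillE : \int[mu]_x (partial j f x * g x) = - \int[mu]_x (partial j g x * f x).
  apply/eqP; rewrite -eqr_oppLR -(Rint_parts j sf tg); apply/eqP.
  by apply: eq_Rintegral => x _; rewrite mulrC.
rewrite shiftE stillE normrN.
set a := \int[mu]_x _; set b := \int[mu]_x _; set p := \int[mu]_x _; set q := \int[mu]_x _.
have -> : (- t)^-1 * (a - b) = t^-1 * (- a - - b) by rewrite invrN; ring.
rewrite mulrDl; set z := _ * (_ - _) => h1 h2.
rewrite -(subrKA z) addrC; apply: le_trans (ler_normD _ _) _.
by rewrite addrC; apply: lerD => //; rewrite distrC.
Qed.

Lemma Rint_hessian f g i j : test_function setT f -> test_function setT g ->
  \int[mu]_x (f x * partial i (partial j g) x) = \int[mu]_x (partial i (partial j f) x * g x).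
Proof.
move=> tf tg.
rewrite (Rint_parts i (test_smooth tf) (test_partial j tg)) -Rint_partial_swap//.
by rewrite (Rint_parts _ (smooth_partial j (test_smooth tf)) tg) opprK.
Qed.

End parts.

(** * The Hessian identity and convolution with test functions *)

Section convolution.
Context (R : realType) (N : nat).
Local Notation E := 'rV[R]_N.
Implicit Types (f g phi rho theta H : E -> R) (x y v : E) (Om : set E).
Local Notation mu := (@rV_lebesgue R N).

Lemma Rint_partialC f g i j : test_function setT f -> test_function setT g ->
  \int[mu]_x (partial i (partial j f) x * g x) = \int[mu]_x (partial j (partial i f) x * g x).
Proof.
move=> tf tg; have s := fun k => smooth_partial k (test_smooth tf).
have h := Rint_partial_swap i j tf tg.
have h1 := Rint_parts i (s j) tg; have h2 := Rint_parts j (s i) tg.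
rewrite h in h1; exact: (oppr_inj (etrans (esym h1) h2)).
Qed.

(** The two integrations by parts, along [j] and then along [i], are each preceded by an exchange of
    mixed derivatives, which is available under the integral ([Rint_partialC]). *)
Lemma Rint_hessian_sqr f i j : test_function setT f ->
  \int[mu]_x (partial i (partial j f) x ^+ 2) =
  \int[mu]_x (partial i (partial i f) x * partial j (partial j f) x).
Proof.
move=> tf; have t := fun k => test_partial k tf; have tij := test_partial i (t j).
have C1 := Rint_partialC i j tf tij.
have C2 := Rint_partialC j i (t j) (t i).
have P1 := Rint_parts j (test_smooth tij) (t i).
have P2 := Rint_parts i (test_smooth (test_partial j (t j))) (t i).
have com (g h : E -> R) : \int[mu]_x (g x * h x) = \int[mu]_x (h x * g x).
  by apply: eq_Rintegral => x _; rewrite mulrC.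
transitivity (\int[mu]_x (partial i (partial j f) x * partial i (partial j f) x)).
  by apply: eq_Rintegral.
apply: (etrans C1); apply: (etrans (com _ _)); apply: (etrans P1).
apply: (etrans (congr1 -%R C2)); apply: (etrans (esym P2)); exact: com.
Qed.

Definition lap f x := \sum_i partial i (partial i f) x.

Lemma test_lap Om f : test_function Om f -> test_function Om (lap f).
Proof.
by move=> tf; apply: test_sum => i; do 2 apply: test_partial.
Qed.

Lemma ler_sum_term (a : 'I_N -> 'I_N -> R) i j :
  (forall k l, 0 <= a k l) -> a i j <= \sum_k \sum_l a k l.
Proof.
move=> a0; rewrite (bigD1 i)//= (bigD1 j)//= -addrA lerDl addr_ge0 ?sumr_ge0// => k _.
exact: sumr_ge0.
Qed.

Lemma Rint_hessian_lap f i j : test_function setT f ->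
  \int[mu]_x (partial i (partial j f) x ^+ 2) <= \int[mu]_x (lap f x ^+ 2).
Proof.
move=> tf; have t2 k l : test_function setT (partial k (partial l f)).
  by do 2 apply: test_partial.
have i2 k l k' l' : intg mu (fun x => partial k (partial l f) x * partial k' (partial l' f) x).
  by apply: sqintM; exact: test_sqint.
have -> : \int[mu]_x (lap f x ^+ 2) =
    \sum_k \sum_l \int[mu]_x (partial k (partial l f) x ^+ 2).
  transitivity (\int[mu]_x \sum_k \sum_l
      (partial k (partial k f) x * partial l (partial l f) x)).
    by apply: eq_Rintegral => x _; rewrite expr2 /lap big_distrlr.
  have E1 k := Rint_sum (index_enum _) (fun l => i2 k k l l).
  have E2 := Rint_sum (index_enum _) (fun k => intg_sum (index_enum _) (fun l => i2 k k l l)).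
  apply: (etrans E2); apply: eq_bigr => k _; apply: (etrans (E1 k)); apply: eq_bigr => l _.
  exact: (esym (Rint_hessian_sqr k l tf)).
have pos k l : 0 <= \int[mu]_x (partial k (partial l f) x ^+ 2).
  by apply: Rint_ge0 => x; exact: sqr_ge0.
exact: (ler_sum_term i j pos).
Qed.

Definition conv f rho x := \int[mu]_y (f y * rho (x - y)).

Lemma is_derive_bound f x v (d C : R) :
  (forall t : R, t != 0 -> `|t^-1 * (f (t *: v + x) - f x) - d| <= C * `|t|) ->
  is_derive x v f d.
Proof.
move=> H; have cv : h^-1 *: ((f \o shift x) (h *: v) - f x) @[h --> (0:R)^'] --> d.
  apply/cvgrPdist_le => e e0; near=> h.
  have h0 : h != 0 by near: h; exact: nbhs_dnbhs_neq.
  rewrite distrC; apply: le_trans (H h h0) _.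
  apply: (@le_trans _ _ ((`|C| + 1) * `|h|)).
    by rewrite ler_wpM2r// ler_wpDr// ler_norm.
  rewrite -ler_pdivlMl ?ltr_wpDl//; apply: ltW; near: h.
  by apply: dnbhs0_lt; rewrite mulr_gt0 ?invr_gt0 ?ltr_wpDl.
by apply: DeriveDef; [apply/cvg_ex; exists d|apply/cvg_lim].
Unshelve. all: by end_near. Qed.

Lemma lip_continuous f (L : R) : (forall x y, `|f (y + x) - f x| <= L * `|y|) -> continuous f.
Proof.
move=> fL x A /nbhs_ballP[e /= e0 eA].
have L1 : 0 < `|L| + 1 by rewrite ltr_wpDl.
apply/nbhs_ballP; exists ((`|L| + 1)^-1 * e); first by rewrite /= mulr_gt0 ?invr_gt0.
move=> y; rewrite -ball_normE /ball_/= => xy; apply: eA; rewrite -ball_normE /ball_/=.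
rewrite distrC -{1}(subrK x y); apply: le_lt_trans (fL _ _) _.
apply: (@le_lt_trans _ _ ((`|L| + 1) * `|y - x|)).
  by rewrite ler_wpM2r// ler_wpDr// ler_norm.
by rewrite -ltr_pdivlMl// distrC.
Qed.

Lemma intg_conv f rho x : intg mu f -> test_function setT rho ->
  intg mu (fun y => f y * rho (x - y)).
Proof. by move=> fi /(test_refl x) tr; exact: intgMtest fi tr. Qed.

(** Moving [x] by [t] in [rho (x - y)] is moving [y] by [- t], so this is [dq_bound] for the
    reflected test function. *)
Lemma conv_derive f rho i x : intg mu f -> test_function setT rho ->
  is_derive x (dir R i) (conv f rho) (conv f (partial i rho) x).
Proof.
move=> fi tr; have tr' := test_refl x tr.
have [C C0 HC] := dq_bound i fi tr'.
apply: (@is_derive_bound _ _ _ _ C) => t t0.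
have Nt0 : - t != 0 by rewrite oppr_eq0.
have := HC (- t) Nt0; rewrite normrN partial_refl; last exact: test_smooth tr.
have -> : \int[mu]_y (f y * - partial i rho (x - y)) = - conv f (partial i rho) x.
  rewrite /conv -RintN; last by apply: intg_conv => //; exact: test_partial.
  by apply: eq_Rintegral => y _; rewrite mulrN.
have -> : \int[mu]_y (f y * rho (x - (- t *: dir R i + y))) = conv f rho (t *: dir R i + x).
  by apply: eq_Rintegral => y _; rewrite opprD scaleNr opprK addrA [x + _]addrC.
rewrite -/(conv f rho x).
set a := conv f rho _; set b := conv f rho x; set c := conv f _ x.
have -> : (- t)^-1 * (a - b) - - c = - (t^-1 * (a - b) - c) by rewrite invrN; ring.
by rewrite normrN.
Qed.

Lemma conv_smooth f rho : intg mu f -> test_function setT rho -> smooth (conv f rho).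
Proof.
move=> fi tr; pose P g := exists2 r, test_function setT r & g = conv f r.
apply: (@smooth_coind _ _ P); last by exists rho.
move=> _ [r tr' ->]; split.
  have [L L0 HL] := test_lip tr'.
  apply: (@lip_continuous _ (L * \int[mu]_y `|f y|)) => x y.
  have h1 := intg_conv (y + x) fi tr'; have h2 := intg_conv x fi tr'.
  rewrite /conv -RintB// mulrAC -RintZ; last exact: intg_abs.
  apply: Rint_abs_le; [exact: intgB|by apply: intgZ; exact: intg_abs|].
  move=> z; rewrite -mulrBr normrM mulrC ler_wpM2r//.
  by rewrite -addrA; exact: HL.
exists (fun i => conv f (partial i r)) => [i|i x]; last exact: conv_derive.
by exists (partial i r) => //; exact: test_partial.
Qed.

Lemma partial_conv f rho i : intg mu f -> test_function setT rho ->
  partial i (conv f rho) = conv f (partial i rho).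
Proof. by move=> fi tr; apply: partialP => x; exact: conv_derive. Qed.

Lemma cubeD (A B : R) x y : cube A x -> cube B y -> cube (A + B) (x + y).
Proof.
move=> xA yB i; rewrite mxE; apply: le_trans (ler_normD _ _) _.
by apply: lerD; [exact: xA|exact: yB].
Qed.

Lemma compact_cube (A : R) : compact (@cube R N A).
Proof.
apply: bounded_closed_compact; first exact: bounded_cubeP.
rewrite (_ : cube A = \bigcap_(i in [set: 'I_N]) [set x : E | `|x ord0 i| <= A]); last first.
  by apply/seteqP; split => x h i; [move=> _; exact: h|exact: h].
apply: closed_bigI => i _.
rewrite (_ : [set x | _] = (fun x : E => `|x ord0 i|) @^-1` [set t | t <= A])//.
apply: closed_comp; last exact: closed_le.
move=> x _; apply: (continuous_comp (f := fun x : E => x ord0 i)).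
  exact: continuous_coord.
exact: norm_continuous.
Qed.

Lemma conv_test f rho (A : R) : intg mu f -> (forall x, ~ cube A x -> f x = 0) ->
  test_function setT rho -> test_function setT (conv f rho).
Proof.
move=> fi fA tr; split; first exact: conv_smooth.
have [B rB] := test_cube tr; exists (cube (A + B)); split => //.
  exact: compact_cube.
move=> x xAB; rewrite /conv; under eq_Rintegral => y _.
  rewrite (_ : f y * _ = 0); last first.
    have [yA|yA] := pselect (cube A y); last by rewrite fA ?mul0r.
    rewrite rB ?mulr0// => xyB; apply: xAB.
    by rewrite -(subrK y x) addrC; exact: cubeD.
  over.
by rewrite /Rintegral integral0.
Qed.

(** [theta] is only bounded and measurable, so that the case [theta = 1] (conservation of the
    integral) and the case of a test function are both covered. *)
Lemma Rint_conv H rho theta (C : R) : intg mu H -> test_function setT rho ->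
  measurable_fun setT theta -> (forall x, `|theta x| <= C) ->
  [/\ intg mu (fun x => conv H rho x * theta x), intg mu (fun y => H y * \int[mu]_x (rho (x - y) * theta x)) &
  \int[mu]_x (conv H rho x * theta x) = \int[mu]_y (H y * \int[mu]_x (rho (x - y) * theta x))].
Proof.
move=> iH tr mt tC; have mH := intg_meas iH; have mr := test_meas tr.
have tr' y : test_function setT (fun x => rho (x - y)).
  by under [X in test_function _ X]eq_fun do rewrite addrC; exact: test_transl.
have ir y : intg mu (fun x => rho (x - y) * theta x).
  exact: (intgMb (test_intg (tr' y)) mt tC).
pose K (z : E * E) := H z.2 * (rho (z.1 - z.2) * theta z.1).
have msub : measurable_fun setT (fun z : E * E => z.1 - z.2).
  apply/measurable_fun_rVP => i.
  rewrite (_ : _ \o _ = (fun z : E * E => rV_coord i z.1 - rV_coord i z.2)); last first.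
    by apply/funext => z; rewrite /rV_coord/= !mxE.
  apply: measurable_funB; apply: measurableT_comp (measurable_rV_coord i) _.
    exact: measurable_fst.
  exact: measurable_snd.
have mKr : measurable_fun setT K.
  apply: measurable_funM.
    exact: measurableT_comp mH measurable_snd.
  apply: measurable_funM; first exact: measurableT_comp mr msub.
  exact: measurableT_comp mt measurable_fst.
have mK : measurable_fun setT (EFin \o K) by exact/measurable_EFinP.
have C0 : 0 <= C := le_trans (normr_ge0 _) (tC 0).
set I1 := \int[mu]_x `|rho x|.
(* Integrability of the kernel on the product: for fixed [y] the integral in [x] is bounded by a
   multiple of [|H y|]. *)
have bnd y : \int[mu]_x `|H y * (rho (x - y) * theta x)| <= C * I1 * `|H y|.
  have -> : C * I1 * `|H y| = \int[mu]_x (C * `|H y| * `|rho (x - y)|).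
    rewrite RintZ; last exact: intg_abs (test_intg (tr' y)).
    rewrite mulrAC; congr (_ * _); have mar : measurable_fun setT (fun x => `|rho x|).
      by apply: intg_meas; exact: intg_abs (test_intg tr).
    by rewrite /I1 -(Rint_transl (- y) mar); apply: eq_Rintegral => x _; rewrite addrC.
  apply: Rint_le; first exact: intg_abs (intgZ (H y) (ir y)).
    exact: (intgZ _ (intg_abs (test_intg (tr' y)))).
  move=> x; rewrite !normrM [C * _]mulrC -mulrA ler_wpM2l// mulrC ler_wpM2r//.
have iK : (mu \x mu)%E.-integrable setT (EFin \o K).
  apply/(integrable21ltyP mu mu mK).
  apply: (@le_lt_trans _ _ (\int[mu]_y (C * I1 * `|H y|)%:E)%E); last first.
    have h := intgZ (C * I1) (intg_abs iH).
    by rewrite -(EFin_Rint h) ltry.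
  apply: ge0_le_integral => //.
  - by move=> y _; exact: integral_ge0.
  - have mK' : measurable_fun setT (EFin \o (fun z => `|K z|)).
      by apply/measurable_EFinP; exact: measurableT_comp mKr.
    have K0 z : (0 <= (EFin \o (fun z => `|K z|)%R) z)%E by rewrite lee_fin.
    exact: (measurable_fun_fubini_tonelli_G (m1 := mu) _ mK' K0).
  - by have /measurable_EFinP := intg_meas (intgZ (C * I1) (intg_abs iH)).
  move=> y _ /=.
  rewrite (_ : (\int[mu]_x _)%E = (\int[mu]_x `|H y * (rho (x - y) * theta x)|%:E)%E)//.
  rewrite -(EFin_Rint (intg_abs (intgZ (H y) (ir y)))) lee_fin; exact: bnd.
have F1 x : (\int[mu]_y (K (x, y))%:E = (conv H rho x * theta x)%:E)%E.
  have h := intgZ (theta x) (intg_conv x iH tr).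
  rewrite /conv mulrC -(RintZ _ (intg_conv x iH tr)) (EFin_Rint h).
  by apply: eq_integral => y _; rewrite /K/=; congr EFin; ring.
have F2 y : (\int[mu]_x (K (x, y))%:E = (H y * \int[mu]_x (rho (x - y) * theta x))%:E)%E.
  by rewrite -(RintZ _ (ir y)) (EFin_Rint (intgZ _ (ir y))).
have h1 := integrable_fubini_F iK; have h2 := measurable_fubini_G iK.
have e1 : fubini_F mu (EFin \o K) = fun x => (conv H rho x * theta x)%:E.
  by apply/funext => x; exact: F1.
have e2 : fubini_G mu (EFin \o K) = fun y => (H y * \int[mu]_x (rho (x - y) * theta x))%:E.
  by apply/funext => y; exact: F2.
have h3 := integral12_prod_meas1 iK; have h4 := integral21_prod_meas1 iK.
rewrite e1 in h1 h3; rewrite e2 in h2 h4.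
split => //; last by congr fine; rewrite h3 -h4.
apply: intg_le (intgZ (C * I1) (intg_abs iH)); first exact/measurable_EFinP.
move=> y; apply: le_trans (bnd y); rewrite -(RintZ _ (ir y)); apply: Rint_abs.
exact: intgZ.
Qed.

End convolution.

(** * Mollifiers and cutoff functions *)

Section mollifier.
Context (R : realType).

Lemma rV_lebesgue_cube_gt0 N (M : R) : 0 < M -> (0 < rV_lebesgue (@cube R N M))%E.
Proof.
move=> M0; elim: N => [|n IH].
  rewrite /= /rV_lebesgue/= diracE mem_set ?lte01//= => i.
  by rewrite mxE normr0 ltW.
rewrite -[X in (_ < X)%E]/((@rV_lebesgue R n \x lebesgue_measure)%E (@rV_join R n @^-1` cube M)).
rewrite preimage_join_cube product_measure1E//; last exact: measurable_cube.
apply: mule_gt0 => //.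
rewrite -[X in (_ < X)%E]/(lebesgue_measure `[(- M)%R, M]%classic).
rewrite lebesgue_measure_itv/= lte_fin gtrN// -EFinD lte_fin; lra.
Qed.

Variable N : nat.
Local Notation E := 'rV[R]_N.
Implicit Types (f g phi rho theta H : E -> R) (x y v : E) (Om : set E).
Local Notation mu := (@rV_lebesgue R N).

(** Each factor is 1 for [x_i^2 <= r^2 / 2] and 0 for [x_i^2 >= r^2]; squares avoid the absolute
    value, which is not smooth. *)
Definition bump (r : R) x : R := \prod_i step (2 / r ^+ 2 * (x ord0 i * x ord0 i) - 1).

Lemma bump_smooth r : smooth (bump r).
Proof.
apply: smooth_prod => i.
apply: (@smooth_coord _ _ (fun t => step (2 / r ^+ 2 * (t * t) - 1))).
apply: smooth1_algP; apply: (S1_comp (f := @step R)).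
  by apply: S1_base; exact: smooth1_step.
apply: S1_add; last exact: S1_cst.
by apply: S1_mul; [exact: S1_cst|apply: S1_mul; exact: S1_id].
Qed.

Lemma bump_out r x : 0 < r -> ~ cube r x -> bump r x = 0.
Proof.
move=> r0 /existsNP[i /negP]; rewrite -ltNge => xi.
rewrite /bump (bigD1 i)//= step_ge1 ?mul0r//.
have h : r ^+ 2 <= x ord0 i * x ord0 i.
  by rewrite -expr2 -(real_normK (num_real (x ord0 i))) lerXn2r ?nnegrE// ltW.
rewrite lerBrDr mulrAC ler_pdivlMr ?exprn_gt0//; lra.
Qed.

Lemma bump_in r x : 0 < r -> cube (r / 2) x -> bump r x = 1.
Proof.
move=> r0 xr; rewrite /bump big1// => i _; rewrite step_le0//.
rewrite subr_le0 mulrAC ler_pdivrMr ?exprn_gt0// mul1r -expr2 -(real_normK (num_real (x ord0 i))).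
have := xr i; have := normr_ge0 (x ord0 i); set a := `|_|; move=> a0 ar; nra.
Qed.

Lemma bump_ge0 r x : 0 <= bump r x.
Proof. by apply: prodr_ge0 => i _; exact: step_ge0. Qed.

Lemma test_bump r : 0 < r -> test_function setT (bump r).
Proof.
move=> r0; split; first exact: bump_smooth.
by exists (cube r); split => //; [exact: compact_cube|move=> x; exact: bump_out].
Qed.

Lemma exists_mollifier r : 0 < r -> exists rho, [/\ test_function setT rho,
  forall x, 0 <= rho x, \int[mu]_x rho x = 1 & forall x, ~ cube r x -> rho x = 0].
Proof.
move=> r0; have tb := test_bump r0; have ib := test_intg tb.
have pos : 0 < \int[mu]_x bump r x.
  have r20 : 0 < r / 2 by rewrite divr_gt0.
  have mc := @measurable_cube R N (r / 2).
  have fc := @rV_lebesgue_cube R N (r / 2).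
  have sc := sqint_indic mc (@bounded_cubeP R N (r / 2)).
  have ic : intg mu (\1_(cube (r / 2)) : E -> R).
    apply: (@sqint_intg R N (r / 2) _ sc) => x xc.
    by rewrite indicE memNset.
  apply: (@lt_le_trans _ _ (\int[mu]_x (\1_(cube (r / 2)) x))).
    rewrite -lte_fin (EFin_Rint ic) integral_indic// setIT.
    exact: rV_lebesgue_cube_gt0.
  apply: Rint_le => // x; rewrite indicE; case: (boolP (x \in _)) => [|_]; last exact: bump_ge0.
  by rewrite inE => xc; rewrite bump_in.
exists (fun x => (\int[mu]_x bump r x)^-1 * bump r x); split.
- exact: testZ.
- by move=> x; rewrite mulr_ge0 ?bump_ge0// invr_ge0 ltW.
- by rewrite RintZ// mulVf// gt_eqF.
- by move=> x xr; rewrite bump_out// mulr0.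
Qed.

(** A smooth substitute for the maximum: it is 1 where some [b i] is 1 and 0 where all of them
    vanish. *)
Lemma test_cutoff_union (I : Type) (s : seq I) Om (b : I -> E -> R) :
  (forall i, test_function Om (b i)) ->
  test_function Om (fun x => 1 - \prod_(i <- s) (1 - b i x)).
Proof.
move=> tb; have sP (s' : seq I) : smooth (fun x => \prod_(i <- s') (1 - b i x)).
  apply: smooth_prod => i; apply: (@smoothB _ _ (fun=> 1) (b i)); first exact: smooth_cst.
  exact: test_smooth (tb i).
elim: s => [|i s IH].
  by under eq_fun do rewrite big_nil subrr; exact: test_cst0.
rewrite (_ : (fun x => _) = (fun x => (1 - \prod_(j <- s) (1 - b j x)) +
  b i x * \prod_(j <- s) (1 - b j x))); last first.
  by apply/funext => x; rewrite big_cons; ring.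
apply: (@testD _ _ _ (fun x => 1 - \prod_(j <- s) (1 - b j x))
  (fun x => b i x * \prod_(j <- s) (1 - b j x))) => //.
exact: (@testMl _ _ _ (b i) (fun x => \prod_(j <- s) (1 - b j x))).
Qed.

Lemma exists_cutoff (K W : set E) : compact K -> open W -> K `<=` W ->
  exists2 eta, test_function W eta & forall x, K x -> eta x = 1.
Proof.
move=> cK oW KW.
have /choice[r rP] (x : E) : exists r : R, 0 < r /\ (K x -> forall y, cube r (y - x) -> W y).
  have [Kx|nKx] := pselect (K x); last by exists 1; split.
  have /nbhs_ballP[e /= e0 eW] := open_nbhs_nbhs (conj oW (KW _ Kx)).
  exists (e / 2); split; first by rewrite divr_gt0.
  move=> _ y yx; apply: eW; apply/rV_ballP => // i.
  have := yx i; rewrite !mxE => h; apply: (le_lt_trans h).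
  by rewrite ltr_pdivrMr// ltr_pMr// ltr1n.
have tb x : test_function setT (fun y => bump (r x) (- x + y)).
  by apply: test_transl; apply: test_bump; have [] := rP x.
pose B (x : E) : set E := ball x (r x / 2).
have := cK; rewrite compact_cover => /(_ _ K B) [|x Kx|D DK KD].
- by move=> x _; apply: ball_open; rewrite divr_gt0//; have [] := rP x.
- exists x => //; apply: ballxx; rewrite divr_gt0//; by have [] := rP x.
(* Outside the finite set [D] the bump may leave [W]; the default 0 makes every member of the family
   a test function of [W]. *)
pose b (x : E) : E -> R := if x \in D then fun y => bump (r x) (- x + y) else fun=> 0.
have tbW x : test_function W (b x).
  rewrite /b; case: ifPn => xD; last exact: test_cst0.
  have Kx : K x by move/DK: (xD); rewrite inE.
  have [r0 rW] := rP x.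
  split; first exact: test_smooth (tb x).
  exists (aff (const_mx 1) x @` cube (r x)); split.
  - apply: continuous_compact; last exact: compact_cube.
    by apply: continuous_subspaceT; exact: continuous_aff.
  - move=> _ [y yr <-]; rewrite aff1; apply: rW => //.
    by rewrite addrAC subrr add0r.
  - move=> y yn; apply: bump_out => // yc; apply: yn.
    by exists (- x + y) => //; rewrite aff1 addrA subrr add0r.
exists (fun y => 1 - \prod_(x <- D) (1 - b x y)); first exact: test_cutoff_union.
move=> y /KD[x /= xD]; have [r0 _] := rP x; move=> /(rV_ballP _ _ (divr_gt0 r0 _)) xy.
rewrite (big_rem x)//= {1}/b xD bump_in// ?subrr ?mul0r ?subr0// => i.
by rewrite !mxE addrC; apply/ltW/xy.
Qed.

End mollifier.

(** * Second derivatives controlled by a bound on the Laplacian *)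

Section hessian_estimate.
Context (R : realType) (N : nat).
Local Notation E := 'rV[R]_N.
Implicit Types (f g phi rho theta H : E -> R) (x y : E) (Om : set E).
Local Notation mu := (@rV_lebesgue R N).

Lemma lap_refl x phi : smooth phi -> lap (fun y => phi (x - y)) = fun y => lap phi (x - y).
Proof.
move=> sp; apply/funext => y; apply: eq_bigr => i _.
have s1 : smooth (partial i phi) := smooth_partial i sp.
have e1 := partial_refl x i sp.
have e2 : (fun y => - partial i phi (x - y)) = fun y => (-1) * partial i phi (x - y).
  by apply/funext => z; rewrite mulN1r.
have s2 : smooth (fun y => partial i phi (x - y)).
  by under eq_fun do rewrite -affN1; exact: smooth_aff.
by rewrite e1 e2 partialZ// partial_refl// mulN1r opprK.
Qed.

Lemma lap_conv f rho : intg mu f -> test_function setT rho -> lap (conv f rho) = conv f (lap rho).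
Proof.
move=> fi tr; apply/funext => x; rewrite /lap.
have e i : partial i (partial i (conv f rho)) x = conv f (partial i (partial i rho)) x.
  by rewrite !partial_conv//; exact: test_partial.
transitivity (\sum_i conv f (partial i (partial i rho)) x).
  by apply: eq_bigr => i _; exact: e.
have t2 i : test_function setT (partial i (partial i rho)) by do 2 apply: test_partial.
rewrite /conv -(Rint_sum (index_enum _) (fun i => intg_conv x fi (t2 i))).
by apply: eq_Rintegral => y _; rewrite mulr_sumr.
Qed.

(* Jensen: the mean of [H^2] for the probability density [rho (x - .)] is at
   least the square of the mean of [H]. *)
Lemma conv_sqr_le H rho x : sqint mu H -> intg mu H -> test_function setT rho ->
  (forall y, 0 <= rho y) -> \int[mu]_y rho y = 1 ->
  conv H rho x ^+ 2 <= conv (fun y => H y ^+ 2) rho x.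
Proof.
move=> sH iH tr r0 r1; set c := conv H rho x.
have i1 := intg_conv x iH tr.
have i2 := intg_conv x (sqint_intg2 sH) tr.
have i3 := test_intg (test_refl x tr).
have h : 0 <= \int[mu]_y ((H y - c) ^+ 2 * rho (x - y)).
  by apply: Rint_ge0 => y; rewrite mulr_ge0// sqr_ge0.
have e : \int[mu]_y ((H y - c) ^+ 2 * rho (x - y)) =
    \int[mu]_y (H y ^+ 2 * rho (x - y) - 2 * c * (H y * rho (x - y)) + c ^+ 2 * rho (x - y)).
  by apply: eq_Rintegral => y _; ring.
have i4 := intgZ (2 * c) i1; have i5 := intgZ (c ^+ 2) i3.
have e1 := RintD (intgB i2 i4) i5; have e2 := RintB i2 i4.
have e3 := RintZ (2 * c) i1; have e4 := RintZ (c ^+ 2) i3.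
have e5 : \int[mu]_y rho (x - y) = 1 := etrans (Rint_refl x (test_meas tr)) r1.
move: h; rewrite e e1 e2 e3 e4 e5 -/(conv H rho x) -/c.
by rewrite /conv; set S := \int[mu]_y _; lra.
Qed.

Lemma Rint_conv1 H rho : intg mu H -> test_function setT rho -> \int[mu]_y rho y = 1 ->
  intg mu (conv H rho) /\ \int[mu]_x conv H rho x = \int[mu]_y H y.
Proof.
move=> iH tr r1.
have c1 (x : E) : `|1 : R| <= 1 by rewrite normr1.
have [h1 _ h2] := Rint_conv iH tr (measurable_cst (1 : R)) c1.
have e1 : (fun x => conv H rho x * cst 1 x) = conv H rho by apply/funext => x; rewrite mulr1.
have e2 : (fun y => H y * \int[mu]_x (rho (x - y) * cst 1 x)) = H.
  apply/funext => y; rewrite -[RHS]mulr1; congr (_ * _).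
  transitivity (\int[mu]_x rho (- y + x)).
    by apply: eq_Rintegral => x _; rewrite mulr1 addrC.
  exact: (etrans (Rint_transl (- y) (test_meas tr)) r1).
by rewrite e1 in h1 h2; rewrite e2 in h2.
Qed.

Section estimate.
Variables (v G : E -> R) (A : R).
Hypotheses (sv : sqint mu v) (sG : sqint mu G).
Hypotheses (vA : forall x, ~ cube A x -> v x = 0) (GA : forall x, ~ cube A x -> G x = 0).
Hypothesis vG : forall psi, test_function setT psi ->
  `|\int[mu]_x (v x * lap psi x)| <= \int[mu]_x (G x * `|psi x|).
Let iv : intg mu v := sqint_intg sv vA.
Let iG : intg mu G := sqint_intg sG GA.

(** Testing [vG] with [rho (x - .)] bounds the Laplacian at [x] by [conv G rho x]; after Jensen, the
    integral of the square no longer depends on [rho]. *)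
Lemma mollified_hessian_le rho i j : test_function setT rho ->
  (forall y, 0 <= rho y) -> \int[mu]_y rho y = 1 ->
  \int[mu]_x (partial i (partial j (conv v rho)) x ^+ 2) <= \int[mu]_x (G x ^+ 2).
Proof.
move=> tr r0 r1; have tw := conv_test iv vA tr.
apply: (le_trans (Rint_hessian_lap i j tw)).
have [i1 e1] := Rint_conv1 (sqint_intg2 sG) tr r1.
rewrite -e1; apply: Rint_le => //; first exact: sqint_intg2 (test_sqint (test_lap tw)).
move=> x; apply: le_trans (conv_sqr_le x sG iG tr r0 r1).
rewrite -(real_normK (num_real (lap _ x))) lap_conv//.
have tx := test_refl x tr.
have h := vG tx; rewrite lap_refl in h; last exact: test_smooth tr.
have e : \int[mu]_y (G y * `|rho (x - y)|) = conv G rho x.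
  by apply: eq_Rintegral => y _; rewrite ger0_norm.
rewrite e in h; rewrite lerXn2r// nnegrE; exact: le_trans h.
Qed.

(** For the mollified function this is Young's inequality after moving both derivatives off [phi].
    The error of replacing [v] by its mollification is shifted onto the fixed test function [theta],
    which is Lipschitz, so it is [O(r)]. *)
Lemma hessian_estimate phi i j : test_function setT phi ->
  2 * \int[mu]_x (v x * partial i (partial j phi) x) <=
  \int[mu]_x (phi x ^+ 2) + \int[mu]_x (G x ^+ 2).
Proof.
move=> tp; set theta := partial i (partial j phi).
have tt : test_function setT theta by do 2 apply: test_partial.
have [L L0 HL] := test_lip tt; have [C C0 HC] := test_bounded tt.
set I1 := \int[mu]_x `|v x|.
have I10 : 0 <= I1 by apply: Rint_ge0.
apply/ler_addgt0Pr => e e0.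
(* The mollification error will be at most [L * r * I1]; the [+ 1] in the witness avoids dividing by
   0. *)
have [r r0 re] : exists2 r, 0 < r & 2 * (L * r * I1) <= e.
  exists (e / (2 * L * I1 + 1)); first by rewrite divr_gt0// ltr_wpDl// !mulr_ge0.
  have -> : 2 * (L * (e / (2 * L * I1 + 1)) * I1) = e * ((2 * L * I1) / (2 * L * I1 + 1)).
    by ring.
  rewrite ger_pMr// ler_pdivrMr ?mul1r ?lerDl// ltr_wpDl// !mulr_ge0//.
have [rho [tr rho0 rho1 rhor]] := exists_mollifier N r0.
have tw := conv_test iv vA tr.
have [i1 i2 e12] := Rint_conv iv tr (test_meas tt) HC.
have h1 : 2 * \int[mu]_x (conv v rho x * theta x) <=
    \int[mu]_x (phi x ^+ 2) + \int[mu]_x (G x ^+ 2).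
  have h := Rint_hessian i j tw tp.
  apply: le_trans (lerD (lexx _) (mollified_hessian_le i j tr rho0 rho1)).
  set g := partial i (partial j (conv v rho)) in h *.
  have tg : test_function setT g by do 2 apply: test_partial.
  have k1 := sqint_intg2 (test_sqint tp); have k2 := sqint_intg2 (test_sqint tg).
  have k3 := sqintM (test_sqint tg) (test_sqint tp).
  rewrite -(RintD k1 k2); have k4 := RintZ 2 k3.
  apply: (@le_trans _ _ (\int[mu]_x (2 * (g x * phi x)))).
    by rewrite k4 -h.
  apply: Rint_le; [exact: intgZ|exact: intgD|move=> x].
  have := sqr_ge0 (g x - phi x); nra.
have h2 : \int[mu]_x (v x * theta x) - \int[mu]_x (conv v rho x * theta x) <= L * r * I1.
  have iv' := intg_abs iv.
  rewrite e12; have k1 := intgMtest iv tt; rewrite -(RintB k1 i2).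
  apply: (le_trans (ler_norm _)); rewrite -(RintZ _ iv'); apply: Rint_abs_le.
  - exact: intgB.
  - exact: intgZ.
  move=> y; rewrite -mulrBr normrM mulrC ler_wpM2r//.
  have ty : test_function setT (fun x => rho (- y + x)) := test_transl (- y) tr.
  have ey : \int[mu]_x rho (- y + x) = 1 := etrans (Rint_transl (- y) (test_meas tr)) rho1.
  have j1 := intgZ (theta y) (test_intg ty).
  have j2 := intgMtest (test_intg ty) tt.
  have -> : theta y - \int[mu]_x (rho (x - y) * theta x) =
      \int[mu]_x (theta y * rho (- y + x) - rho (- y + x) * theta x).
    rewrite (RintB j1 j2) (RintZ _ (test_intg ty)) ey mulr1; congr (_ - _).
    by apply: eq_Rintegral => x _; rewrite addrC.
  rewrite -[L * r]mulr1 -[X in _ * X]ey -(RintZ _ (test_intg ty)).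
  apply: Rint_abs_le; [exact: intgB|exact: intgZ (test_intg ty)|].
  move=> x; rewrite [theta y * _]mulrC -mulrBr normrM (ger0_norm (rho0 _)) mulrC.
  have [xc|xc] := pselect (cube r (- y + x)); last by rewrite rhor// !mulr0.
  rewrite ler_wpM2r//; have h := HL y (- y + x).
  have eyx : - y + x + y = x by rewrite addrAC addNr add0r.
  rewrite eyx distrC in h; apply: (le_trans h); rewrite ler_wpM2l//.
  by apply/rV_norm_leP => //; exact: ltW.
by move: h1 h2 re; lra.
Qed.

End estimate.
End hessian_estimate.

(** * Reflection across the faces of the cylinder *)

Section reflection.
Context (R : realType) (m : nat).
Local Notation E := 'rV[R]_m.+1.
Implicit Types (f g phi psi X : E -> R) (x y : E) (D : set 'rV[R]_m).
Local Notation mu := (@rV_lebesgue R m.+1).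

Definition tube D : set E := [set x | D (col' ord_max x)].

Definition slab D : set E := [set x | D (col' ord_max x) /\ -1 < x ord0 ord_max < 2].

Definition flipdir : E := \row_i (if i == ord_max then -1 else 1).

(** It sends [x_n] to [a - x_n], so the mirror is [x_n = a / 2]: the two faces correspond to [a = 0]
    and [a = 2]. *)
Definition reflect_at (a : R) : E -> E := aff flipdir (a *: dir R ord_max).

(* For [s = -1] and [f] supported in [D x (0, 1)] this is the odd extension of
   [f] across [x_n = 0] and [x_n = 1], for [s = 1] the even one. *)
Definition fold (s : R) f x : R := f x + s * (f (reflect_at 0 x) + f (reflect_at 2 x)).

Lemma continuous_col' : continuous (col' ord_max : E -> 'rV[R]_m).
Proof.
move=> x A /nbhs_ballP[e /= e0 eA]; apply/nbhs_ballP; exists e => // y /(rV_ballP _ _ e0) xy.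
by apply: eA; apply/(rV_ballP _ _ e0) => k; rewrite !mxE; exact: xy.
Qed.

Lemma open_tube D : open D -> open (tube D).
Proof. by move=> oD; apply: open_comp => // x _; exact: continuous_col'. Qed.

Lemma unimod_flip : unimod flipdir.
Proof. by move=> i; rewrite mxE; case: ifP; [right|left]. Qed.

Lemma flip_sqr i : flipdir ord0 i * flipdir ord0 i = 1.
Proof. by case: (unimod_flip i) => ->; ring. Qed.

Lemma reflect_last a x : (reflect_at a x) ord0 ord_max = a - x ord0 ord_max.
Proof. by rewrite !mxE eqxx/=; ring. Qed.

Lemma reflect_col a x : col' ord_max (reflect_at a x) = col' ord_max x.
Proof.
apply/rowP => i; have h : (lift ord_max i == ord_max) = false.
  by rewrite eq_sym (negbTE (neq_lift _ _)).
by rewrite !mxE !h ?andbF /=; ring.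
Qed.

Lemma reflectK a : involutive (reflect_at a).
Proof.
move=> x; rewrite -[LHS]rV_snoc_eta -[RHS]rV_snoc_eta !reflect_col !reflect_last.
by congr rV_snoc; ring.
Qed.

Lemma Rint_reflect a f : measurable_fun setT f ->
  \int[mu]_x f (reflect_at a x) = \int[mu]_x f x.
Proof. exact: (Rint_aff _ unimod_flip). Qed.

Lemma sqint_reflect a f : sqint mu f -> sqint mu (fun x => f (reflect_at a x)).
Proof. exact: (sqint_aff _ unimod_flip). Qed.

Lemma sqint_fold s f : sqint mu f -> sqint mu (fold s f).
Proof.
move=> sf; have sr a := sqint_reflect a sf.
exact: (sqintD sf (sqintZ s (sqintD (sr 0) (sr 2)))).
Qed.

(** Each reflection is a measure-preserving involution, so [fold s] is self-adjoint. *)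
Lemma Rint_fold s f g : sqint mu f -> sqint mu g ->
  \int[mu]_x (fold s f x * g x) = \int[mu]_x (f x * fold s g x).
Proof.
move=> sf sg; have rf a := sqint_reflect a sf; have rg a := sqint_reflect a sg.
have i0 := sqintM sf sg.
have i1 a := sqintM (rf a) sg; have i2 a := sqintM sf (rg a).
have e a : \int[mu]_x (f (reflect_at a x) * g x) = \int[mu]_x (f x * g (reflect_at a x)).
  rewrite -(Rint_reflect a (intg_meas (i1 a))).
  by apply: eq_Rintegral => x _; rewrite reflectK.
transitivity (\int[mu]_x (f x * g x) + s * (\int[mu]_x (f (reflect_at 0 x) * g x) +
    \int[mu]_x (f (reflect_at 2 x) * g x))).
  have j := intgD (i1 0) (i1 2).
  rewrite -(RintD (i1 0) (i1 2)) -(RintZ _ j) -(RintD i0 (intgZ s j)).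
  by apply: eq_Rintegral => x _; rewrite /fold; ring.
rewrite !e; have j := intgD (i2 0) (i2 2).
rewrite -(RintD (i2 0) (i2 2)) -(RintZ _ j) -(RintD i0 (intgZ s j)).
by apply: eq_Rintegral => x _; rewrite /fold; ring.
Qed.

(** A derivative along [x_n] exchanges odd and even extension; the other directions keep the
    parity. *)
Lemma partial_fold i s f : smooth f ->
  partial i (fold s f) = fold (s * flipdir ord0 i) (partial i f).
Proof.
move=> sf; have sr a : smooth (fun x => f (reflect_at a x)) by exact: smooth_aff.
have srr := smoothD (sr 0) (sr 2).
have e a : partial i (fun x => f (reflect_at a x)) =
    fun x => flipdir ord0 i * partial i f (reflect_at a x) by exact: partial_aff.
rewrite (partialD i sf (smoothZ s srr)) (partialZ i s srr) (partialD i (sr 0) (sr 2)) !e.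
by apply/funext => x; rewrite /fold; ring.
Qed.

Lemma lap_fold s f : smooth f -> lap (fold s f) = fold s (lap f).
Proof.
move=> sf; have e i : partial i (partial i (fold s f)) = fold s (partial i (partial i f)).
  apply: (etrans (congr1 (partial i) (partial_fold i s sf))).
  apply: (etrans (partial_fold i _ (smooth_partial i sf))).
  by rewrite -mulrA flip_sqr mulr1.
apply/funext => x; transitivity (\sum_i fold s (partial i (partial i f)) x).
  by apply: eq_bigr => i _; rewrite -e.
by rewrite big_split/= -mulr_sumr big_split.
Qed.

Lemma fold_normr_le f x : `|fold (-1) f x| <= fold 1 (fun y => `|f y|) x.
Proof.
rewrite /fold; apply: le_trans (ler_normD _ _) _; rewrite lerD2l mul1r mulN1r normrN.
exact: ler_normD.
Qed.

Lemma test_fold s D X : test_function (slab D) X -> test_function (tube D) (fold s X).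
Proof.
move=> tX; have tr a : test_function (tube D) (fun x => X (reflect_at a x)).
  apply: test_sub (test_aff _ unimod_flip tX) => x [+ _].
  by rewrite reflect_col.
have t0 : test_function (tube D) X by apply: test_sub tX => x [].
exact: (testD t0 (testZ s (testD (tr 0) (tr 2)))).
Qed.

(** On a face its own reflection fixes the point and cancels [X x], while the other one lands on
    [x_n = 2] or [x_n = -1], outside the open slab. This is why the slab ends there. *)
Lemma fold_odd_face D X x : test_function (slab D) X ->
  x ord0 ord_max = 0 \/ x ord0 ord_max = 1 -> fold (-1) X x = 0.
Proof.
move=> tX x01; rewrite /fold.
have rfix a : a - x ord0 ord_max = x ord0 ord_max -> reflect_at a x = x.
  move=> h; rewrite -[LHS]rV_snoc_eta -[RHS]rV_snoc_eta reflect_col reflect_last.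
  by rewrite h.
have rout a : ~ (-1 < a - x ord0 ord_max < 2) -> X (reflect_at a x) = 0.
  by move=> h; apply: (test_out tX) => -[_]; rewrite reflect_last.
case: x01 => x01.
  rewrite (rfix 0) ?x01 ?subr0// (rout 2) ?x01 ?subr0 ?ltxx ?andbF//.
  by rewrite addr0 mulN1r subrr.
rewrite (rfix 2); last by rewrite x01; ring.
rewrite (rout 0); last by rewrite x01 sub0r ltxx.
by rewrite add0r mulN1r subrr.
Qed.

Lemma test_in_cube N (Om : set 'rV[R]_N) (phi : 'rV[R]_N -> R) : test_function Om phi ->
  exists A, test_function (cube A) phi.
Proof.
move=> [sp [K [cK KO K0]]]; have [A KA] := bounded_cube (compact_bounded cK).
by exists A; split => //; exists K.
Qed.

Lemma lapM f g : smooth f -> smooth g -> lap (fun x => f x * g x) =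
  fun x => f x * lap g x + 2 * \sum_i (partial i f x * partial i g x) + g x * lap f x.
Proof.
move=> sf sg; apply/funext => x; rewrite /lap !mulr_sumr -!big_split/=.
apply: eq_bigr => i _.
have pf := smooth_partial i sf; have pg := smooth_partial i sg.
rewrite (partialM i sf sg) (partialD i (smoothM sf pg) (smoothM sg pf)).
have /(congr1 (fun h => h x))/= e1 := partialM i sf pg.
have /(congr1 (fun h => h x))/= e2 := partialM i sg pf.
move: e1 e2; rewrite /=; move: (partial i (fun x => _) x) (partial i (fun x => _) x) => a b -> ->.
move: (partial i (partial i f) x) (partial i (partial i g) x) => c d.
by move: (partial i f x) (partial i g x) (f x) (g x) => k l o n; ring.
Qed.

Section estimate.
Variables (D : set 'rV[R]_m) (u0 : E -> R) (p : 'I_m.+1 -> E -> R).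
Hypotheses (oD : open D) (bOm : bounded_set (cylinder D)) (mOm : measurable (cylinder D)).
Hypotheses (su : sqint mu u0) (uout : forall x, ~ cylinder D x -> u0 x = 0).
Hypothesis sp : forall i, sqint mu (p i).
(** The boundary data enter here: [psi] may cross the faces, so that [up] expresses that [u0] has
    trace 0 on them. In [plap] it has to vanish on the faces. *)
Hypothesis up : forall psi i, test_function (tube D) psi ->
  \int[mu]_x (u0 x * partial i psi x) = - \int[mu]_x (p i x * psi x).
Hypothesis plap : forall psi, test_function (tube D) psi ->
  (forall x, x ord0 ord_max = 0 \/ x ord0 ord_max = 1 -> psi x = 0) ->
  `|\int[mu]_x (\sum_i (p i x * partial i psi x))| <=
  \int[mu]_x (\1_(cylinder D) x * `|psi x|).

Local Notation F := (fold (-1) u0).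

(* The test function [fold (-1) X] vanishes on the faces. *)
Lemma fold_lap_bound X : test_function (slab D) X ->
  `|\int[mu]_x (F x * lap X x)| <= \int[mu]_x (fold 1 (\1_(cylinder D)) x * `|X x|).
Proof.
move=> tX; have tY := test_fold (-1) tX; set Y := fold (-1) X in tY.
have tlX := test_lap tX; have sX := test_smooth tX.
have tp i := test_partial i tY; have tpp i := test_partial i (tp i).
have i1 i := sqintM su (test_sqint (tpp i)).
have i2 i := sqintM (sp i) (test_sqint (tp i)).
have e1 : \int[mu]_x (F x * lap X x) = - \int[mu]_x (\sum_i (p i x * partial i Y x)).
  rewrite (Rint_fold _ su (test_sqint tlX)) -(lap_fold _ sX).
  transitivity (\int[mu]_x (\sum_i (u0 x * partial i (partial i Y) x))).
    by apply: eq_Rintegral => x _; rewrite mulr_sumr.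
  apply: (etrans (Rint_sum (index_enum _) i1)).
  apply: (etrans _ (esym (congr1 -%R (Rint_sum (index_enum _) i2)))).
  by rewrite -sumrN; apply: eq_bigr => i _; exact: up (tp i).
rewrite e1 normrN.
have sI := @sqint_indic R m.+1 (cylinder D) mOm bOm.
have saX := sqint_abs (test_sqint tX); have saY := sqint_abs (test_sqint tY).
apply: (le_trans (plap tY _)); first by move=> x; exact: (fold_odd_face tX).
rewrite (Rint_fold 1 sI saX); apply: Rint_le => [||x].
- exact: sqintM.
- by apply: sqintM => //; exact: sqint_fold.
by rewrite ler_wpM2l//; exact: fold_normr_le.
Qed.

(** The odd extension has no jump across the faces, because [up] already integrates by parts across
    them. Its gradient is extended oddly in the directions along the face and evenly along [x_n]. *)
Lemma fold_partial_parts i X : test_function (slab D) X ->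
  \int[mu]_x (F x * partial i X x) = - \int[mu]_x (fold (- flipdir ord0 i) (p i) x * X x).
Proof.
move=> tX; have sX := test_smooth tX.
rewrite (Rint_fold _ su (test_sqint (test_partial i tX))).
rewrite (Rint_fold _ (sp i) (test_sqint tX)) -(up i (test_fold _ tX)) partial_fold//.
by rewrite mulNr flip_sqr.
Qed.

(** [eta lap psi = lap (eta psi) - 2 \sum_k partial_k (psi partial_k eta) + psi lap eta]. The first
    term falls under [fold_lap_bound]; the middle one is a divergence, so an integration by parts
    removes the derivative from [psi]. What remains is [B] times [psi]. *)
Lemma cutoff_hessian_estimate eta i j : test_function (slab D) eta ->
  exists C, forall phi, test_function setT phi ->
    2 * \int[mu]_x (eta x * F x * partial i (partial j phi) x) <= \int[mu]_x (phi x ^+ 2) + C.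
Proof.
move=> te; have [A tA] := test_in_cube te.
have se := test_smooth te; have tpe k := test_partial k te; have tle := test_lap te.
pose q k := fold (- flipdir ord0 k) (p k).
have sq k : sqint mu (q k) by exact: sqint_fold.
have sF : sqint mu F by exact: sqint_fold.
pose J := fold 1 (\1_(cylinder D)).
have sJ : sqint mu J by apply: sqint_fold; exact: sqint_indic.
pose B x := 2 * \sum_k (q k x * partial k eta x) + F x * lap eta x.
have sMt f phi (Om : set E) : sqint mu f -> test_function Om phi -> sqint mu (fun x => f x * phi x).
  move=> sf tp; have [M _ pM] := test_bounded tp.
  exact: (sqintMb sf (test_meas tp) pM).
have sB : sqint mu B.
  apply: (sqintD (sqintZ 2 (sqint_sum (index_enum _) (fun k => sMt _ _ _ (sq k) (tpe k))))).
  exact: sMt sF tle.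
pose G x := `|J x * eta x| + `|B x|.
have sJe := sMt _ _ _ sJ te.
have sG : sqint mu G := sqintD (sqint_abs sJe) (sqint_abs sB).
have sv : sqint mu (fun x => eta x * F x).
  by under eq_fun do rewrite mulrC; exact: sMt sF te.
have vA x : ~ cube A x -> eta x * F x = 0 by move=> /(test_out tA) ->; rewrite mul0r.
have GA x : ~ cube A x -> G x = 0.
  move=> xA; rewrite /G /B (test_out tA xA) (test_out (test_lap tA) xA) !mulr0 normr0 add0r addr0.
  rewrite big1 ?mulr0 ?normr0// => k _.
  by rewrite (test_out (test_partial k tA) xA) mulr0.
exists (\int[mu]_x (G x ^+ 2)) => phi tphi.
apply: (hessian_estimate sv sG vA GA _ i j tphi) => psi tpsi.
have spsi := test_smooth tpsi.
have tX : test_function (slab D) (fun x => eta x * psi x) := testMl te spsi.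
pose Psi k x := psi x * partial k eta x.
have tPsi k : test_function (slab D) (Psi k) := testMr (tpe k) spsi.
have i1 := sqintM sF (test_sqint (test_lap tX)).
have i2 k := sqintM sF (test_sqint (test_partial k (tPsi k))).
have i2s := intg_sum (index_enum _) i2.
have i3 := sqintM (sMt _ _ _ sF tle) (test_sqint tpsi).
have i4 k := sqintM (sq k) (test_sqint (tPsi k)).
have i4s := intg_sum (index_enum _) i4.
have iB := sqintM sB (test_sqint tpsi).
have e1 : \int[mu]_x (eta x * F x * lap psi x) =
    \int[mu]_x (F x * lap (fun x => eta x * psi x) x) + \int[mu]_x (B x * psi x).
  transitivity (\int[mu]_x (F x * lap (fun x => eta x * psi x) x
     - 2 * \sum_k (F x * partial k (Psi k) x) + F x * lap eta x * psi x)).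
    apply: eq_Rintegral => x _; rewrite (lapM se spsi) -mulr_sumr.
    have -> : \sum_k partial k (Psi k) x = \sum_k (partial k eta x * partial k psi x) + psi x * lap eta x.
      rewrite /lap mulr_sumr -big_split/=; apply: eq_bigr => k _.
      by rewrite (partialM k spsi (smooth_partial k se)); ring.
    move: (\sum_k (partial k eta x * partial k psi x)) => a.
    move: (lap psi x) (lap eta x) (F x) => b c d.
    by move: (eta x) (psi x) => k l; ring.
  apply: (etrans (RintD (intgB i1 (intgZ 2 i2s)) i3)).
  rewrite (RintB i1 (intgZ 2 i2s)) -addrA; congr (_ + _).
  have -> : \int[mu]_x (2 * \sum_k (F x * partial k (Psi k) x)) =
      - \int[mu]_x (2 * \sum_k (q k x * Psi k x)).
    rewrite (RintZ 2 i2s) (RintZ 2 i4s) -mulrN; congr (_ * _).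
    apply: (etrans (Rint_sum (index_enum _) i2)).
    apply: (etrans _ (esym (congr1 -%R (Rint_sum (index_enum _) i4)))).
    by rewrite -sumrN; apply: eq_bigr => k _; exact: fold_partial_parts.
  rewrite opprK -(RintD (intgZ 2 i4s) i3); apply: eq_Rintegral => x _.
  rewrite /B [RHS]mulrDl; congr (_ + _); rewrite -[RHS]mulrA mulr_suml; congr (_ * _).
  by apply: eq_bigr => k _; rewrite /Psi; ring.
rewrite e1; apply: (le_trans (ler_normD _ _)).
have h1 := fold_lap_bound tX; have h2 := Rint_abs iB.
apply: (le_trans (lerD h1 h2)).
have k1 := sqintM sJ (sqint_abs (test_sqint tX)); have k2 := intg_abs iB.
rewrite -(RintD k1 k2); apply: Rint_le; first exact: intgD.
  exact: sqintM sG (sqint_abs (test_sqint tpsi)).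
move=> x; rewrite /G [leRHS]mulrDl; apply: lerD; last by rewrite normrM.
rewrite -[leRHS]normrM -mulrA [leRHS]normrM; apply: ler_wpM2r => //.
exact: ler_norm.
Qed.

Lemma local_hessian_estimate D' i j : compactly_contained D' D ->
  exists C, forall phi, test_function (cylinder D') phi ->
    2 * \int[mu]_x (u0 x * partial i (partial j phi) x) <= \int[mu]_x (phi x ^+ 2) + C.
Proof.
move=> [_ cD' D'D].
(* The closed cylinder over [closure D'] is compact inside the slab: the reflection has turned the
   faces into interior points. *)
pose K : set E := [set x | closure D' (col' ord_max x) /\ 0 <= x ord0 ord_max <= 1].
have cK : compact K.
  apply: bounded_closed_compact.
    have [A DA] := bounded_cube (compact_bounded cD').
    have KA : K `<=` cube (Num.max A 1).
      move=> x [/DA xA /andP[x0 x1]] k.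
      case: (unliftP ord_max k) => [l|] ->; last by rewrite ger0_norm// le_max x1 orbT.
      by have := xA l; rewrite mxE => h; rewrite le_max h.
    have [B [rB HB]] := @bounded_cubeP R m.+1 (Num.max A 1); exists B; split => // y /HB h x /KA.
    exact: h.
  rewrite (_ : K = (col' ord_max @^-1` closure D') `&` ((fun x => x ord0 ord_max) @^-1` `[0, 1])).
    apply: closedI; apply: preimage_closed.
    - by move=> x _; exact: continuous_col'.
    - exact: closed_closure.
    - by move=> x _; exact: continuous_coord.
    - exact: itv_closed.
  by apply/seteqP; split => x /=; rewrite in_itv.
have oS : open (slab D).
  rewrite (_ : slab D = tube D `&` ((fun x => x ord0 ord_max) @^-1` `]-1, 2[)).
    apply: openI; first exact: open_tube.
    by apply: open_comp => [x _|]; [exact: continuous_coord|exact: itv_open].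
  by apply/seteqP; split => x /=; rewrite in_itv.
have KS : K `<=` slab D.
  move=> x [/D'D Dx /andP[x0 x1]]; split => //.
  by rewrite (lt_le_trans _ x0) ?(le_lt_trans x1) ?ltr1n// ltrN10.
have [eta te e1] := exists_cutoff cK oS KS.
have [C HC] := cutoff_hessian_estimate i j te.
exists C => phi tphi; have := HC phi (test_sub (@subsetT _ _) tphi).
rewrite (_ : \int[mu]_x (eta x * F x * _) = \int[mu]_x (u0 x * partial i (partial j phi) x))//.
apply: eq_Rintegral => x _; have tpp := test_partial i (test_partial j tphi).
have [xD|xD] := pselect (cylinder D' x); last by rewrite (test_out tpp xD) !mulr0.
have [D'x /andP[x0 x1]] := xD.
rewrite e1 ?mul1r; last first.
  by split; [exact: subset_closure|rewrite !ltW].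
congr (_ * _); rewrite /fold.
(* Both mirror images of a point of the cylinder lie outside it, since [- x_n < 0] and
   [2 - x_n > 1]; hence [F = u0] there. *)
have rout a : a = 0 \/ a = 2 -> u0 (reflect_at a x) = 0.
  move=> a02; apply: uout => -[_]; rewrite reflect_last => /andP[].
  by case: a02 => ->; lra.
by rewrite !rout ?addr0 ?mulr0 ?addr0//; [right|left].
Qed.

End estimate.
End reflection.

(** * Sobolev functions and the Euler-Lagrange inequality *)

Section fundamental_lemma.
Context (R : realType) (N : nat).
Local Notation E := 'rV[R]_N.
Implicit Types (f g h phi : E -> R) (x y a b : E) (Om : set E).
Local Notation mu := (@rV_lebesgue R N).

Definition obox a b : set E := [set x | forall i, a ord0 i < x ord0 i < b ord0 i].
Definition cbox a b : set E := [set x | forall i, a ord0 i <= x ord0 i <= b ord0 i].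

Lemma obox_setI a b a' b' : obox a b `&` obox a' b' =
  obox (\row_i Num.max (a ord0 i) (a' ord0 i)) (\row_i Num.min (b ord0 i) (b' ord0 i)).
Proof.
apply/seteqP; split => [x [h h'] i|x h].
  by rewrite !mxE gt_max lt_min; have /andP[-> ->] := h i; have /andP[-> ->] := h' i.
by split => i; have := h i; rewrite !mxE gt_max lt_min => /andP[/andP[h1 h2] /andP[h3 h4]];
  apply/andP.
Qed.

Lemma measurable_obox a b : measurable (obox a b).
Proof.
rewrite (_ : obox a b = [set x | forall i, `]a ord0 i, b ord0 i[%classic (x ord0 i)]).
  apply: (@rV_measurable_forall R N (fun i => `]a ord0 i, b ord0 i[%classic)) => i.
  exact: measurable_itv.
by apply/seteqP; split => x h i; have := h i; rewrite /= in_itv.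
Qed.

Lemma compact_cbox a b : compact (cbox a b).
Proof.
rewrite (_ : cbox a b = [set x | forall i, `[a ord0 i, b ord0 i]%classic (x ord0 i)]).
  apply: (@rV_compact _ _ (fun i => `[a ord0 i, b ord0 i]%classic)) => i.
  exact: segment_compact.
by apply/seteqP; split => x h i; have := h i; rewrite /= in_itv.
Qed.

Definition oboxes : set (set E) := [set A | exists a b, A = obox a b].

Lemma rV_measurable_oboxes : @measurable _ E = <<s oboxes >>.
Proof.
apply/seteqP; split; last first.
  apply: smallest_sub; first exact: sigma_algebra_measurable.
  by move=> _ [a [b ->]]; exact: measurable_obox.
have mc i : measurable_fun (setT : set (g_sigma_algebraType oboxes)) (fun x : E => x ord0 i).
  apply: (measurability _ (RGenOpens.measurableE R)) => _ [_ [a [b ->]] <-]; rewrite setTI.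
  (* A strip in coordinate [i] is the union of boxes whose other sides are []-k, k[]. *)
  pose B k := obox (\row_j (if j == i then a else - k%:R)) (\row_j (if j == i then b else k%:R)).
  rewrite (_ : _ @^-1` _ = \bigcup_k B k).
    by apply: bigcupT_measurable => k; apply: sub_sigma_algebra; do 2 eexists.
  apply/seteqP; split => [x /= xab|x [k _ /(_ i)]]; last by rewrite !mxE eqxx /= in_itv.
  have [k _ xk] := nbhs_infty_ger (`|x| + 1).
  exists k => // j; rewrite !mxE; case: eqVneq => [->|_]; first by rewrite in_itv in xab.
  rewrite -ltr_norml; apply: le_lt_trans (rV_coord_le x j) _.
  by apply: lt_le_trans (xk k (leqnn _)); rewrite ltrDl.
apply: smallest_sub; first exact: (sigma_algebra_measurable (g_sigma_algebraType oboxes)).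
rewrite -bigcup_seq/=; apply: bigcup_sub => i _ A [B mB <-].
exact: (mc i).
Qed.

(** The indicator of the open box is the pointwise limit of test functions bounded by 1, so
    dominated convergence applies. *)
Lemma test_orthogonal_obox Om g a b : intg mu g ->
  (forall phi, test_function Om phi -> \int[mu]_x (g x * phi x) = 0) ->
  (forall i, a ord0 i < b ord0 i) -> cbox a b `<=` Om ->
  \int[mu]_x (\1_(obox a b) x * g x) = 0.
Proof.
move=> ig gO ab abO.
(* The parabola [k (t - a)(b - t) - 1] is negative off the interval and tends to infinity inside it.
   It is spelled out in sums and products to match the constructors of [smooth1_alg]. *)
pose s (k : nat) i (t : R) : R := k%:R * ((t + - a ord0 i) * (b ord0 i + (-1) * t)) + - 1.
pose phi (k : nat) x := \prod_i (1 + (-1) * step (s k i (x ord0 i))).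
have phi_out k x : ~ obox a b x -> phi k x = 0.
  move=> /existsNP[i xi]; rewrite /phi (bigD1 i)//= step_le0 ?mulr1 ?subrr ?mul0r//.
  have : (x ord0 i - a ord0 i) * (b ord0 i - x ord0 i) <= 0.
    have abi := ab i; have [xa|xa] := leP (x ord0 i) (a ord0 i).
      by rewrite mulr_le0_ge0 ?subr_le0// subr_ge0 (le_trans xa)// ltW.
    have [xb|xb] := leP (b ord0 i) (x ord0 i); last by exfalso; apply: xi; rewrite xa xb.
    by rewrite mulr_ge0_le0 ?subr_le0// subr_ge0 ltW.
  by rewrite /s mulN1r => h; rewrite subr_le0 (@le_trans _ _ 0)// mulr_ge0_le0.
have tphi k : test_function Om (phi k).
  split.
    apply: smooth_prod => i.
    apply: (@smooth_coord _ _ (fun t => 1 + (-1) * step (s k i t))).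
    apply: smooth1_algP; apply: S1_add; first exact: S1_cst.
    apply: S1_mul; first exact: S1_cst.
    apply: (S1_comp (f := @step R)); first by apply: S1_base; exact: smooth1_step.
    apply: S1_add; last exact: S1_cst.
    apply: S1_mul; first exact: S1_cst.
    apply: S1_mul; first by apply: S1_add; [exact: S1_id|exact: S1_cst].
    apply: S1_add; first exact: S1_cst.
    by apply: S1_mul; [exact: S1_cst|exact: S1_id].
  exists (cbox a b); split => //; first exact: compact_cbox.
  move=> x xab; apply: phi_out => h; apply: xab => i.
  by have /andP[/ltW -> /ltW ->] := h i.
have phi1 k x : `|phi k x| <= 1.
  have h i : 0 <= 1 + (-1) * step (s k i (x ord0 i)) <= 1.
    by have := step_ge0 (s k i (x ord0 i)); have := step_le1 (s k i (x ord0 i)); lra.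
  rewrite ger0_norm; last by apply: prodr_ge0 => i _; have /andP[] := h i.
  by apply: prodr_ile1 => i _; exact: h.
have cphi x : phi ^~ x @ \oo --> (\1_(obox a b) x : R).
  rewrite indicE; case: (boolP (x \in _)); last first.
    move=> /negP; rewrite inE => xo; rewrite (_ : phi ^~ x = fun=> 0); first exact: cvg_cst.
    by apply/funext => k; exact: phi_out.
  rewrite inE => xo; apply: cvg_near_cst.
  have : \forall k \near \oo, forall i, 1 <= s k i (x ord0 i).
    apply: filter_forall => i; have /andP[ax xb] := xo i.
    pose c := (x ord0 i - a ord0 i) * (b ord0 i - x ord0 i).
    have c0 : 0 < c by rewrite mulr_gt0 ?subr_gt0.
    near=> k; have h : 2 / c <= k%:R by near: k; exact: nbhs_infty_ger.
    by move: h; rewrite ler_pdivrMr// /s mulN1r -/c => h; lra.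
  apply: filterS => k h; rewrite /phi big1// => i _.
  by rewrite step_ge1// mulr0 addr0.
have [] := @Rint_dct _ _ _ mu (fun k x => g x * phi k x) (fun x => g x * \1_(obox a b) x)
  (fun x => `|g x|).
- move=> k; apply: measurable_funM; [exact: intg_meas ig|exact: test_meas (tphi k)].
- by move=> x; apply: cvgM; [exact: cvg_cst|exact: cphi].
- exact: intg_abs.
- by move=> k x; rewrite normrM ler_piMr.
move=> _; rewrite (_ : (fun k => _) = fun=> 0); last first.
  by apply/funext => k; exact: gO.
move=> cv; transitivity (\int[mu]_x (g x * \1_(obox a b) x)).
  by apply: eq_Rintegral => x _; rewrite mulrC.
by rewrite -(cvg_lim _ cv)// lim_cst.
Unshelve. all: by end_near. Qed.

Lemma intgM_indic (A : set E) h : measurable A -> intg mu h -> intg mu (fun x => \1_A x * h x).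
Proof.
move=> mA ih; under eq_fun do rewrite mulrC.
apply: (@intgMb _ _ _ mu h (\1_A) 1 ih); first exact: measurable_indic.
by move=> x; rewrite indicE; case: (_ \in _); rewrite ?normr1 ?normr0.
Qed.

(** The sets over which [h] integrates to 0 form a Dynkin class containing the boxes, a generating
    pi-system; stability under complement is where [\int h = 0] is used. The sets [h >= 0] and
    [h < 0] then give [\int |h| = 0]. *)
Lemma pi_system_ae0 h : intg mu h -> \int[mu]_x h x = 0 ->
  (forall a b, \int[mu]_x (\1_(obox a b) x * h x) = 0) -> {ae mu, forall x, h x = 0}.
Proof.
move=> ih h0 hbox; have mh := intg_meas ih.
have all0 A : measurable A -> \int[mu]_x (\1_A x * h x) = 0.
  rewrite {1}rV_measurable_oboxes => sA.
  apply: (@dynkin_induction _ E oboxes (fun A => \int[mu]_x (\1_A x * h x) = 0)) sA => //.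
  - exact: rV_measurable_oboxes.
  - by move=> _ _ [a [b ->]] [a' [b' ->]]; rewrite obox_setI; do 2 eexists.
  - rewrite -h0; apply: eq_Rintegral => x _.
    by rewrite indicE mem_set// mul1r.
  - by move=> _ [a [b ->]]; exact: hbox.
  - move=> S mS S0; have i1 := intgM_indic mS ih.
    transitivity (\int[mu]_x (h x - \1_S x * h x)); last by rewrite (RintB ih i1) h0 S0 subrr.
    apply: eq_Rintegral => x _; rewrite !indicE in_setC.
    by case: (_ \in _) => /=; rewrite ?mul1r ?mul0r ?subrr ?subr0.
  - move=> B mB tB B0; pose P n x := \sum_(i < n) (\1_(B i) x * h x).
    have iB i : intg mu (fun x => \1_(B i) x * h x) := intgM_indic (mB i) ih.
    have PE n j x : B j x -> P n x = (j < n)%N%:R * h x.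
      move=> Bj; rewrite /P -mulr_suml; congr (_ * _).
      have e (i : nat) : \1_(B i) x = (i == j)%:R :> R.
        rewrite indicE; congr (_%:R); congr nat_of_bool.
        apply/idP/eqP => [|->]; last by rewrite mem_set.
        by rewrite inE => Bi; apply: tB => //; exists x.
      under eq_bigr do rewrite e.
      case: ltnP => jn; last first.
        by rewrite big1// => i _; rewrite ltn_eqF// (leq_trans _ jn).
      rewrite (bigD1 (Ordinal jn))//= eqxx big1 ?addr0// => i; rewrite -val_eqE/=.
      by move=> /negbTE ->.
    have P0 n x : ~ (\bigcup_k B k) x -> P n x = 0.
      move=> xB; rewrite /P big1// => i _; rewrite indicE memNset ?mul0r// => Bi.
      by apply: xB; exists i.
    have iP n : intg mu (P n) by exact: intg_sum.
    have [] := @Rint_dct _ _ _ mu P (fun x => \1_(\bigcup_k B k) x * h x) (fun x => `|h x|).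
    - by move=> n; exact: intg_meas (iP n).
    - move=> x; apply: cvg_near_cst; have [[j _ Bj]|xB] := pselect ((\bigcup_k B k) x).
        exists j.+1 => // n /= jn; rewrite (PE n j x Bj) jn indicE mem_set//.
        by exists j.
      by apply: nearW => n; rewrite P0// indicE memNset// mul0r.
    - exact: intg_abs.
    - move=> n x; have [[j _ Bj]|xB] := pselect ((\bigcup_k B k) x).
        by rewrite (PE n j x Bj); case: (_ < _)%N; rewrite ?mul1r ?mul0r ?normr0.
      by rewrite P0// normr0.
    move=> _; rewrite (_ : (fun n => Rintegral mu setT (P n)) = fun=> 0); last first.
      apply/funext => n; apply: (etrans (Rint_sum (index_enum _) (fun i : 'I_n => iB i))).
      exact: big1.
    by move=> cv; rewrite -(cvg_lim _ cv)// lim_cst.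
pose A := h @^-1` `[0, +oo[.
have mA : measurable A by rewrite -[A]setTI; apply: mh.
have i1 := intgM_indic mA ih; have i2 := intgM_indic (measurableC mA) ih.
have e : \int[mu]_x `|h x| = 0.
  transitivity (\int[mu]_x (\1_A x * h x - \1_(~` A) x * h x)).
    apply: eq_Rintegral => x _; rewrite !indicE in_setC; case: (boolP (x \in A)) => /=.
      by rewrite inE /A/= in_itv/= andbT => h1; rewrite mul1r mul0r subr0 ger0_norm.
    move=> /negP; rewrite inE /A/= in_itv/= andbT => /negP; rewrite -ltNge => h1.
    by rewrite mul1r mul0r sub0r ltr0_norm.
  by rewrite (RintB i1 i2) !all0 ?subrr//; exact: measurableC.
have /(ae_eq_integral_abs mu measurableT) : measurable_fun setT (EFin \o h) by exact/measurable_EFinP.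
case=> H _; have {}H : ae_eq mu setT (EFin \o h) (cst 0%E).
  by apply: H; rewrite -[LHS]/(\int[mu]_x (`|h x|)%:E)%E -(EFin_Rint (intg_abs ih)) e.
by apply: filterS H => x /(_ Logic.I) /= [].
Qed.

(** Localized to one rational box with closure in [Om], all box integrals of [g] become integrals
    over smaller boxes, where test functions are available. Countably many such boxes cover [Om]. *)
Lemma test_orthogonal_ae0 Om g : open Om -> intg mu g ->
  (forall phi, test_function Om phi -> \int[mu]_x (g x * phi x) = 0) ->
  {ae mu, forall x, Om x -> g x = 0}.
Proof.
move=> oO ig gO.
have box0 p : ratcube p `<=` Om -> {ae mu, forall x, ratbox p x -> g x = 0}.
  move=> pO; pose a : E := \row_i (ratr (p.1 ord0 i) - p.2.+1%:R^-1).
  pose b : E := \row_i (ratr (p.1 ord0 i) + p.2.+1%:R^-1).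
  have e0 : 0 < p.2.+1%:R^-1 :> R by rewrite invr_gt0.
  have pE : ratbox p = obox a b.
    by apply/seteqP; split => x h i; have := h i; rewrite !mxE ltr_distlC.
  have cO : cbox a b `<=` Om.
    by apply: subset_trans pO => x h i; have := h i; rewrite !mxE ler_distlC.
  have ab i : a ord0 i < b ord0 i by rewrite !mxE ltrD2l gtrN.
  pose h x := \1_(obox a b) x * g x.
  have ih : intg mu h := intgM_indic (measurable_obox a b) ig.
  have : {ae mu, forall x, h x = 0}.
    apply: (pi_system_ae0 ih); first exact: test_orthogonal_obox ig gO ab cO.
    move=> a' b'; set a2 : E := \row_i Num.max (a ord0 i) (a' ord0 i).
    set b2 : E := \row_i Num.min (b ord0 i) (b' ord0 i).
    transitivity (\int[mu]_x (\1_(obox a2 b2) x * g x)).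
      apply: eq_Rintegral => x _; rewrite /h mulrA -obox_setI indicI; congr (_ * _).
      exact: mulrC.
    have [ab2|/existsNP[i /negP]] := pselect (forall i, a2 ord0 i < b2 ord0 i).
      apply: test_orthogonal_obox ig gO ab2 _ => x hx; apply: cO => i.
      have := hx i; rewrite !mxE ge_max le_min => /andP[/andP[h1 h2] /andP[h3 h4]].
      by rewrite h1 h3.
    rewrite -leNgt => ba; rewrite (_ : obox a2 b2 = set0).
      transitivity (\int[mu]_x (0 : R)); last by rewrite /Rintegral integral0.
      by apply: eq_Rintegral => x _; rewrite indicE in_set0 mul0r.
    apply/seteqP; split => // x /(_ i) /andP[h1 h2].
    by have := lt_le_trans (lt_trans h1 h2) ba; rewrite ltxx.
  by apply: filterS => x + xp; rewrite /h indicE mem_set ?mul1r// -pE.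
(* The boxes are enumerated by [unpickle]; codes of no box get the trivial statement. *)
pose P (n : nat) x := if (choice.unpickle n : option ('rV[rat]_N * nat)) is Some p then
  ratcube p `<=` Om -> ratbox p x -> g x = 0 else True.
have : {ae mu, forall x, forall n, P n x}.
  apply: ae_foralln => n; rewrite /P; case: (choice.unpickle n) => [p|]; last exact: aeW.
  have [pO|pO] := pselect (ratcube p `<=` Om); last by apply: aeW => x /pO.
  by apply: filterS (box0 p pO) => x.
apply: filterS => x h Ox; have [p px pO] := ratbox_cover oO Ox.
by have := h (choice.pickle p); rewrite /P choice.pickleK; exact.
Qed.

End fundamental_lemma.

(** * Weak derivatives: uniqueness and independence of the representative *)

Section sobolev_theory.
Context (R : realType) (N : nat).
Local Notation E := 'rV[R]_N.
Implicit Types (u v w g phi : E -> R) (x y : E) (Om : set E).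
Local Notation mu := (@rV_lebesgue R N).

Lemma restrictE Om u x : (u \_ Om) x = \1_Om x * u x.
Proof. by rewrite patchE indicE; case: ifPn => _; rewrite ?mul1r ?mul0r. Qed.

Lemma restrict_in Om u x : Om x -> (u \_ Om) x = u x.
Proof. by move=> Ox; rewrite patchE mem_set. Qed.

Lemma restrict_out Om u x : ~ Om x -> (u \_ Om) x = 0.
Proof. by move=> Ox; rewrite patchE memNset. Qed.

Lemma L2P Om u : L2 Om u <-> sqint mu (u \_ Om).
Proof.
split=> [L2u|[mu' u2]].
  split; last exact: Lfun2_integrable_sqr L2u.
  by have := sub_Lfun_mfun L2u; rewrite inE.
rewrite /L2 inE; apply/andP; split; first by rewrite inE.
rewrite inE/= /finite_norm Lnorm.unlock; apply: poweR_lty.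
have := u2 => /integrableP[_]; apply: le_lt_trans.
rewrite le_eqVlt; apply/orP; left; apply/eqP; apply: eq_integral => x _.
rewrite (_ : `|(EFin \o u \_ Om) x|%E = (`|(u \_ Om) x|)%:E)// poweR_EFin.
by rewrite powR_mulrn// -normrX.
Qed.

Lemma Rint_restrict Om u v : \int[mu]_(x in Om) (u x * v x) = \int[mu]_x ((u \_ Om) x * v x).
Proof.
rewrite Rintegral_mkcond; apply: eq_Rintegral => x _; rewrite !patchE.
by case: ifPn => // _; rewrite mul0r.
Qed.

Lemma weak_derivative1P Om i u g : is_weak_derivative Om [:: i] u g <->
  forall phi, test_function Om phi ->
    \int[mu]_x ((u \_ Om) x * partial i phi x) = - \int[mu]_x ((g \_ Om) x * phi x).
Proof.
have e1 phi := Rint_restrict Om u (partial i phi); have e2 phi := Rint_restrict Om g phi.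
split=> H phi tp; first apply: (etrans (esym (e1 phi))); last apply: (etrans (e1 phi)).
  apply: (etrans (H phi tp)); rewrite expr1 mulN1r; exact: (congr1 -%R (e2 phi)).
by apply: (etrans (H phi tp)); rewrite expr1 mulN1r; exact: (congr1 -%R (esym (e2 phi))).
Qed.

Lemma weak_derivative_spec Om u i : sobolev 1 Om u ->
  L2 Om (weak_derivative Om [:: i] u) /\
  is_weak_derivative Om [:: i] u (weak_derivative Om [:: i] u).
Proof.
move=> [_ /(_ [:: i] (leqnn _)) [g [L2g wg]]].
by rewrite /weak_derivative; case: xgetP => [_ -> //|/(_ g)]; case.
Qed.

Lemma sobolev1I Om u : L2 Om u ->
  (forall i, exists g, L2 Om g /\ is_weak_derivative Om [:: i] u g) -> sobolev 1 Om u.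
Proof.
move=> L2u H; split => // -[|i [|//]] _; last exact: H.
by exists u; split => // phi _; rewrite expr0 mul1r.
Qed.

Lemma sqint_restrict_test Om phi : measurable Om -> test_function Om phi ->
  L2 Om phi.
Proof.
move=> mOm tp; apply/L2P; rewrite (_ : phi \_ Om = phi); first exact: test_sqint tp.
apply/funext => x; have [Ox|Ox] := pselect (Om x); first by rewrite restrict_in.
by rewrite restrict_out// (test_out tp).
Qed.

Lemma test_restrictE Om phi : test_function Om phi -> phi \_ Om = phi.
Proof.
move=> tp; apply/funext => x; have [Ox|Ox] := pselect (Om x); first by rewrite restrict_in.
by rewrite restrict_out// (test_out tp).
Qed.

Lemma test_weak_derivative Om phi i : test_function Om phi ->
  is_weak_derivative Om [:: i] phi (partial i phi).
Proof.
move=> tp; apply/weak_derivative1P => psi tpsi.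
rewrite !test_restrictE//; last exact: test_partial.
exact: Rint_parts (test_smooth tp) tpsi.
Qed.

Section bounded.
Variable Om : set E.
Hypotheses (oOm : open Om) (bOm : bounded_set Om).

Let mOm : measurable Om. Proof. exact: rV_open_measurable. Qed.

Lemma sqint_restrict_intg u : sqint mu (u \_ Om) -> intg mu (u \_ Om).
Proof.
move=> su; have [M OM] := bounded_cube bOm.
by apply: (sqint_intg (M := M) su) => x xM; apply: restrict_out => /OM.
Qed.

Lemma weak_derivative_unique u g h i : L2 Om g -> L2 Om h ->
  is_weak_derivative Om [:: i] u g -> is_weak_derivative Om [:: i] u h ->
  {ae mu, forall x, (g \_ Om) x = (h \_ Om) x}.
Proof.
move=> /L2P sg /L2P sh /weak_derivative1P wg /weak_derivative1P wh.
have ig := sqint_restrict_intg sg; have ih := sqint_restrict_intg sh.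
have := @test_orthogonal_ae0 R N Om _ oOm (intgB ig ih).
have H phi : test_function Om phi ->
    \int[mu]_x (((g \_ Om) x - (h \_ Om) x) * phi x) = 0.
  move=> tp; have i1 := intgMtest ig tp; have i2 := intgMtest ih tp.
  transitivity (\int[mu]_x ((g \_ Om) x * phi x - (h \_ Om) x * phi x)).
    by apply: eq_Rintegral => x _; rewrite mulrBl.
  rewrite (RintB i1 i2); apply/eqP; rewrite subr_eq0; apply/eqP.
  by apply: oppr_inj; exact: (etrans (esym (wg _ tp)) (wh _ tp)).
move=> /(_ H); apply: filterS => x h0; have [Ox|Ox] := pselect (Om x).
  by apply/eqP; rewrite -subr_eq0 h0.
by rewrite !restrict_out.
Qed.

(** [weak_derivative] is an arbitrary choice of representative and need not be linear in [u].
    Uniqueness almost everywhere allows the Dirichlet integral to be computed with any family of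
    weak derivatives, such as those of a perturbation of [u]. *)
Lemma Rint_weak_grad_sq u (q : 'I_N -> E -> R) : sobolev 1 Om u ->
  (forall i, L2 Om (q i) /\ is_weak_derivative Om [:: i] u (q i)) ->
  [/\ {ae mu, forall x, ((weak_grad_sq Om u) \_ Om) x = \sum_i (q i \_ Om) x ^+ 2},
   intg mu ((weak_grad_sq Om u) \_ Om) &
   \int[mu]_(x in Om) weak_grad_sq Om u x = \int[mu]_x (\sum_i (q i \_ Om) x ^+ 2)].
Proof.
move=> su hq; pose r i := weak_derivative Om [:: i] u.
have sr i : sqint mu (r i \_ Om) by apply/L2P; have [] := weak_derivative_spec i su.
have sq i : sqint mu (q i \_ Om) by apply/L2P; have [] := hq i.
have rE x : ((weak_grad_sq Om u) \_ Om) x = \sum_i (r i \_ Om) x ^+ 2.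
  have [Ox|Ox] := pselect (Om x).
    by rewrite restrict_in//; apply: eq_bigr => i _; rewrite restrict_in.
  by rewrite restrict_out// big1// => i _; rewrite restrict_out// expr0n.
have ir : intg mu (fun x => \sum_i (r i \_ Om) x ^+ 2).
  by apply: intg_sum => i; exact: sqint_intg2 (sr i).
have iq : intg mu (fun x => \sum_i (q i \_ Om) x ^+ 2).
  by apply: intg_sum => i; exact: sqint_intg2 (sq i).
have ae : {ae mu, forall x, \sum_i (r i \_ Om) x ^+ 2 = \sum_i (q i \_ Om) x ^+ 2}.
  have : {ae mu, forall x, forall i, (r i \_ Om) x = (q i \_ Om) x}.
    apply: filter_forall => i; have [L2r wr] := weak_derivative_spec i su.
    by have [L2q wq] := hq i; exact: weak_derivative_unique wr wq.
  by apply: filterS => x H; apply: eq_bigr => i _; rewrite H.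
split.
- by apply: filterS ae => x <-; rewrite rE.
- by rewrite (_ : _ \_ _ = fun x => \sum_i (r i \_ Om) x ^+ 2)//; apply/funext.
- rewrite Rintegral_mkcond; transitivity (\int[mu]_x (\sum_i (r i \_ Om) x ^+ 2)).
    by apply: eq_Rintegral => x _; exact: rE.
  apply: ae_eq_Rint; [exact: intg_meas ir|exact: intg_meas iq|].
  by apply: filterS ae.
Qed.

End bounded.
End sobolev_theory.

(** * The Euler-Lagrange inequality *)

Lemma intg_fine d (T : measurableType d) (R : realType) (nu : {measure set T -> \bar R}) (F : T -> \bar R) :
  nu.-integrable setT F -> intg nu (fun x => fine (F x)) /\
  \int[nu]_x fine (F x) = fine (\int[nu]_x F x)%E.
Proof.
move=> iF; have [mF _] := integrableP _ _ _ iF.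
have mfF : measurable_fun setT (fun x => fine (F x)).
  exact: measurableT_comp (fine_measurable measurableT) mF.
split.
  apply: (le_integrable measurableT _ _ iF); first exact/measurable_EFinP.
  by move=> x _ /=; case: (F x) => [r| |] //=; rewrite normr0 leey.
congr fine; apply: ae_eq_integral => //; first exact/measurable_EFinP.
have := integrable_ae measurableT iF; apply: filterS => x h _.
by rewrite fineK//; exact: h.
Qed.

(** The maximum of the two functions dominates [F] everywhere and equals [G] almost everywhere. *)
Lemma Rint_le_ae d (T : measurableType d) (R : realType) (nu : {measure set T -> \bar R}) (F G : T -> R) :
  intg nu F -> intg nu G -> {ae nu, forall x, F x <= G x} -> \int[nu]_x F x <= \int[nu]_x G x.
Proof.
move=> iF iG FG.
have iM : intg nu (fun x => Num.max (F x) (G x)).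
  apply: intg_le (intgD (intg_abs iF) (intg_abs iG)) => [|x].
    by apply: measurable_maxr; [exact: intg_meas iF|exact: intg_meas iG].
  by rewrite maxEle; case: ifP => _; rewrite ?lerDl ?lerDr.
apply: (@le_trans _ _ (\int[nu]_x Num.max (F x) (G x))).
  by apply: Rint_le => // x; rewrite le_max lexx.
rewrite le_eqVlt; apply/orP; left; apply/eqP; apply: ae_eq_Rint; [exact: intg_meas iM|exact: intg_meas iG|].
by apply: filterS FG => x h _; rewrite max_r.
Qed.

Lemma intg_pos_part d (T : measurableType d) (R : realType) (nu : {measure set T -> \bar R}) (F : T -> R) :
  intg nu F -> intg nu (fun x => Num.max (F x) 0).
Proof.
move=> iF; apply: intg_le (intg_abs iF) => [|x].
  by apply: measurable_maxr; [exact: intg_meas iF|exact: measurable_cst].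
by rewrite maxEle; case: ifP => _; rewrite ?normr0.
Qed.

Section euler_lagrange.
Context (R : realType) (m : nat).
Local Notation E := 'rV[R]_m.+1.
Implicit Types (f g w phi psi : E -> R) (D : set 'rV[R]_m).
Local Notation mu := (@rV_lebesgue R m.+1).
Local Notation mu' := (@rV_lebesgue R m).

Definition vint f (x' : 'rV[R]_m) : R := \int[lebesgue_measure]_t f (rV_snoc x' t).

Lemma vintP f : intg mu f -> [/\ intg mu' (vint f), \int[mu']_x vint f x = \int[mu]_x f x &
  {ae mu', forall x, intg lebesgue_measure (fun t : measurableTypeR R => f (rV_snoc x t))}].
Proof.
move=> /Rint_snoc[ae i e]; have [i1 e1] := intg_fine i.
by split => //; rewrite e -e1.
Qed.

(** For almost every [x'] the vertical slices are integrable and the vertical integral is linear, so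
    the claim reduces to the Lipschitz bound for the positive part. *)
Lemma pos_part_vint_le f g (e : R) : intg mu f -> intg mu g ->
  \int[mu']_x Num.max (vint (fun y => f y + e * g y) x) 0 <=
  \int[mu']_x Num.max (vint f x) 0 + `|e| * \int[mu]_x `|g x|.
Proof.
move=> ifi ig; have iag := intg_abs ig.
have [h1 _ a1] := vintP ifi; have [h2 e2 a2] := vintP iag.
have [_ _ a3] := vintP ig.
have [h3 _ _] := vintP (intgD ifi (intgZ e ig)).
have k1 := intg_pos_part h1; have k2 := intgZ `|e| h2; have k3 := intg_pos_part h3.
rewrite -e2 -(RintZ _ h2) -(RintD k1 k2); apply: Rint_le_ae => //; first exact: intgD.
apply: filterS3 a1 a2 a3 => x b1 b2 b3.
have -> : vint (fun y => f y + e * g y) x = vint f x + e * vint g x.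
  exact: (etrans (RintD b1 (intgZ e b3)) (congr1 (+%R _) (RintZ e b3))).
have h : `|vint g x| <= vint (fun y => `|g y|) x := Rint_abs b3.
have h' : e * vint g x <= `|e| * vint (fun y => `|g y|) x.
  by apply: (le_trans (ler_norm _)); rewrite normrM ler_wpM2l.
rewrite ge_max; apply/andP; split.
  by apply: lerD => //; rewrite le_max lexx.
apply: addr_ge0; first by rewrite le_max lexx orbT.
by rewrite mulr_ge0//; exact: le_trans h.
Qed.

Lemma potentialE D w :
  \int[mu']_(x' in D) Num.max (\int[lebesgue_measure]_(t in `]0, 1[) w (rV_snoc x' t)) 0 =
  \int[mu']_x' Num.max (vint (w \_ (cylinder D)) x') 0.
Proof.
rewrite Rintegral_mkcond; apply: eq_Rintegral => x _; rewrite patchE.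
case: ifPn => [|/negP]; rewrite inE => Dx.
  congr Num.max; rewrite Rintegral_mkcond /vint; apply: eq_Rintegral => t _.
  rewrite !patchE; congr (if _ then _ else _).
  apply/idP/idP; rewrite !inE /= in_itv /= => h.
    by split; rewrite ?rV_snocK ?rV_snoc_last.
  by case: h => _; rewrite rV_snoc_last.
rewrite (_ : vint _ _ = 0) ?maxxx//.
transitivity (\int[lebesgue_measure]_(t in [set: measurableTypeR R]) (0 : R)); last first.
  by rewrite /Rintegral integral0.
apply: eq_Rintegral => t _; apply: restrict_out => -[].
by rewrite rV_snocK.
Qed.

Section minimizer.
Variables (D : set 'rV[R]_m) (u : E -> R).
Local Notation Om := (cylinder D).
Hypotheses (oOm : open Om) (bOm : bounded_set Om) (umin : is_minimizer D u).

Let mOm : measurable Om. Proof. exact: rV_open_measurable. Qed.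

Definition grad i : E -> R := weak_derivative Om [:: i] u \_ Om.

Lemma sqint_grad i : sqint mu (grad i).
Proof. by apply/L2P; have [] := weak_derivative_spec i umin.1. Qed.

Lemma sobolev1_test phi : test_function Om phi -> sobolev 1 Om phi.
Proof.
move=> tp; apply: sobolev1I => [|i]; first exact: sqint_restrict_test.
exists (partial i phi); split; last exact: test_weak_derivative.
by apply: sqint_restrict_test => //; exact: test_partial.
Qed.

Lemma sobolev10_test phi : test_function Om phi -> sobolev10 Om phi.
Proof.
move=> tp; split; first exact: sobolev1_test.
exists (fun=> phi); split => //.
rewrite /sobolev1_cvg (_ : (fun _ => _) = fun=> 0%E); first exact: cvg_cst.
apply/funext => k; rewrite (_ : phi \- phi = fun=> 0); last first.
  by apply/funext => x /=; rewrite subrr.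
have t0 : test_function Om (fun _ : E => 0 : R) := test_cst0 _.
have z0 : (fun _ : E => 0 : R) \_ Om = fun=> 0 := test_restrictE t0.
have [_ i e] := @Rint_weak_grad_sq R _ Om oOm bOm (fun=> 0) (fun _ _ => 0) (sobolev1_test t0)
  (fun i => conj (sqint_restrict_test mOm t0)
    (eq_ind _ (fun g => is_weak_derivative Om [:: i] (fun=> 0) g)
     (test_weak_derivative i t0) _ (partial_cst i 0))).
rewrite /sobolev1_norm (_ : (\int[_]_(x in Om) _)%E = 0%E); first by rewrite poweR0r.
rewrite integral_mkcond.
transitivity (\int[mu]_x ((weak_grad_sq Om (fun=> 0) \_ Om) x)%:E)%E.
  apply: eq_integral => x _; rewrite !patchE; case: ifP => // _.
  by rewrite expr0n add0r.
rewrite -(EFin_Rint i) -(Rintegral_mkcond mu Om) e; congr EFin.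
transitivity (\int[mu]_x (0 : R)); last by rewrite /Rintegral integral0.
by apply: eq_Rintegral => x _; rewrite z0 big1// => l _; rewrite expr0n.
Qed.

(** The Dirichlet part expands exactly; the potential is only Lipschitz along the perturbation,
    which leaves a term in [|e|] instead of a derivative. *)
Lemma energy_perturb phi (e : R) : test_function Om phi ->
  0 <= 2 * e * \int[mu]_x (\sum_i (grad i x * partial i phi x)) +
       e ^+ 2 * \int[mu]_x (\sum_i (partial i phi x ^+ 2)) + 2 * `|e| * \int[mu]_x `|phi x|.
Proof.
move=> tp; have [su minu] := umin.
pose w x := u x + e * phi x.
have tep := testZ e tp.
have sures : sqint mu (u \_ Om) by apply/L2P; exact: su.1.
have wres f q : (fun x => f x + e * q x) \_ Om = fun x => (f \_ Om) x + e * (q \_ Om) x.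
  apply/funext => x; have [Ox|Ox] := pselect (Om x); first by rewrite !restrict_in.
  by rewrite !restrict_out// mulr0 addr0.
pose q i x := weak_derivative Om [:: i] u x + e * partial i phi x.
have L2q i : L2 Om (q i).
  apply/L2P; rewrite wres (test_restrictE (test_partial i tp)).
  by apply: sqintD; [exact: sqint_grad|apply: sqintZ; exact: test_sqint (test_partial i tp)].
have wq i : is_weak_derivative Om [:: i] w (q i).
  apply/weak_derivative1P => psi tpsi; rewrite !wres.
  have [_ /weak_derivative1P wu] := weak_derivative_spec i su.
  have /weak_derivative1P wp := test_weak_derivative i tp.
  have tpi := test_partial i tpsi.
  have i1 := sqintM sures (test_sqint tpi).
  have i2 := sqintM (test_sqint tp) (test_sqint tpi).
  have i3 := sqintM (sqint_grad i) (test_sqint tpsi).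
  have i4 := sqintM (test_sqint (test_partial i tp)) (test_sqint tpsi).
  have e1 := wu _ tpsi; have e2 := wp _ tpsi.
  rewrite (test_restrictE tp) in e2 *; rewrite (test_restrictE (test_partial i tp)) in e2 *.
  transitivity (\int[mu]_x ((u \_ Om) x * partial i psi x + e * (phi x * partial i psi x))).
    by apply: eq_Rintegral => x _; rewrite mulrDl mulrA.
  apply: (etrans (RintD i1 (intgZ e i2))); rewrite (RintZ e i2) e1 e2 mulrN -opprD.
  congr (- _); rewrite -(RintZ e i4) -(RintD i3 (intgZ e i4)).
  by apply: eq_Rintegral => x _; rewrite mulrDl mulrA.
have sw : sobolev 1 Om w.
  apply: sobolev1I => [|i]; last by exists (q i).
  apply/L2P; rewrite wres (test_restrictE tp); apply: sqintD => //.
  by apply: sqintZ; exact: test_sqint tp.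
have wu10 : sobolev10 Om (w \- u).
  rewrite (_ : w \- u = fun x => e * phi x); first exact: sobolev10_test.
  by apply/funext => x /=; rewrite /w addrAC subrr add0r.
have := minu w sw wu10; rewrite /energy !potentialE.
have [_ _ ->] := Rint_weak_grad_sq oOm bOm su (fun i => weak_derivative_spec i su).
have [_ _ ->] := Rint_weak_grad_sq oOm bOm sw (fun i => conj (L2q i) (wq i)).
have iu := sqint_restrict_intg bOm sures; have ip := test_intg tp.
have := pos_part_vint_le e iu ip.
have -> : vint (fun y => (u \_ Om) y + e * phi y) = vint (w \_ Om).
  by congr vint; rewrite /w wres (test_restrictE tp).
set P1 := \int[mu']_x _; set P2 := \int[mu']_x _; move=> hP.
have sp i := test_sqint (test_partial i tp).
have i1 i := sqint_intg2 (sqint_grad i); have i2 i := sqintM (sqint_grad i) (sp i).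
have i3 i := sqint_intg2 (sp i).
have s1 := intg_sum (index_enum _) i1; have s2 := intg_sum (index_enum _) i2.
have s3 := intg_sum (index_enum _) i3.
have -> : \int[mu]_x (\sum_i (q i \_ Om) x ^+ 2) =
    \int[mu]_x (\sum_i (grad i x) ^+ 2) +
    2 * e * \int[mu]_x (\sum_i (grad i x * partial i phi x)) +
    e ^+ 2 * \int[mu]_x (\sum_i (partial i phi x ^+ 2)).
  transitivity (\int[mu]_x (\sum_i grad i x ^+ 2 +
      2 * e * \sum_i (grad i x * partial i phi x) + e ^+ 2 * \sum_i partial i phi x ^+ 2)).
    apply: eq_Rintegral => x _; rewrite !mulr_sumr -!big_split/=; apply: eq_bigr => i _.
    rewrite /q wres (test_restrictE (test_partial i tp)) -/(grad i).
    by move: (grad i x) (partial i phi x) => a b; ring.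
  have s2' := intgZ (2 * e) s2; have s3' := intgZ (e ^+ 2) s3.
  apply: (etrans (RintD (intgD s1 s2') s3')).
  by rewrite (RintD s1 s2') (RintZ _ s2) (RintZ _ s3).
move: hP; rewrite -/grad; set b := \int[mu]_x `|phi x|.
set A0 := \int[mu]_x (\sum_i _); set A1 := 2 * e * _; set A2 := e ^+ 2 * _.
by move: A0 A1 A2 P1 P2 => A0 A1 A2 P1 P2; lra.
Qed.

(** Divide by [2 |e|] and let [e] tend to 0 from either side. *)
Lemma perturbation_le (a b c : R) :
  (forall e, 0 <= 2 * e * a + e ^+ 2 * b + 2 * `|e| * c) -> `|a| <= c.
Proof.
move=> H; apply/ler_addgt0Pr => d d0.
have key (s : R) : s = 1 \/ s = -1 -> - (s * a) <= c + d.
  move=> s1; have s2 : s ^+ 2 = 1 by case: s1 => ->; ring.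
  have ns : `|s| = 1 by case: s1 => ->; rewrite ?normrN normr1.
  (* Small enough that [t * b <= d], whatever the sign of [b]. *)
  pose t := d / (`|b| + 1); have b1 : 0 < `|b| + 1 by rewrite ltr_wpDl.
  have t0 : 0 < t by rewrite divr_gt0.
  have tb : t * b <= d.
    apply: (le_trans (ler_norm _)); rewrite normrM gtr0_norm// /t -mulrA ger_pMr//.
    by rewrite mulrC ler_pdivrMr// mul1r lerDl.
  have := H (s * t); rewrite exprMn s2 mul1r normrM ns mul1r gtr0_norm// => h.
  have : 0 <= 2 * (s * a) + t * b + 2 * c.
    by rewrite -(pmulr_rge0 _ t0); move: h; rewrite expr2; lra.
  by lra.
rewrite ler_norml; apply/andP; split.
  by have := key 1 (or_introl erefl); rewrite mul1r; lra.
by have := key (-1) (or_intror erefl); rewrite mulN1r opprK.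
Qed.

Lemma euler_lagrange phi : test_function Om phi ->
  `|\int[mu]_x (\sum_i (grad i x * partial i phi x))| <= \int[mu]_x `|phi x|.
Proof. by move=> tp; apply: perturbation_le => e; exact: energy_perturb. Qed.

End minimizer.
End euler_lagrange.

(** * Traces on the faces *)

Lemma step_derivative (R : realType) : exists d : R -> R, exists M : R,
  [/\ 0 <= M, forall t : R, is_derive t 1 (@step R) (d t), forall t, `|d t| <= M &
      forall t, t < 0 \/ 1 < t -> d t = 0].
Proof.
have [P Ph HP] := smooth1_step R; have [d Pd dd] := HP _ Ph.
have [d2 _ dd2] := HP _ Pd.
have cd : continuous d by move=> t; exact: is_derive1_continuous (dd2 t).
have d0 (t : R) : t < 0 \/ 1 < t -> d t = 0.
  move=> t01; have <- : 'D_1 (@step R) t = d t by apply: (@derive_val _ _ _ _ _ _ _ (dd t)).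
  case: t01 => h.
    rewrite -(@derive_cst R R R (1 : R) t 1); apply: near_eq_derive; near=> s.
    by rewrite step_le0// ltW//; near: s; exact: lt_nbhsl.
  rewrite -(@derive_cst R R R (0 : R) t 1); apply: near_eq_derive; near=> s.
  by rewrite step_ge1// ltW//; near: s; exact: lt_nbhsr.
have cc : compact (d @` `[0, 1]).
  by apply: continuous_compact; [exact: continuous_subspaceT|exact: segment_compact].
have [M [_ HM]] := compact_bounded cc.
exists d, (`|M| + 1); split => // t.
have [t0|t0] := ltP t 0; first by rewrite d0 ?normr0 ?addr_ge0//; left.
have [t1|t1] := ltP 1 t; first by rewrite d0 ?normr0 ?addr_ge0//; right.
apply: (HM (`|M| + 1)); first by rewrite ltr_pwDr// ler_norm.
by exists t => //=; rewrite in_itv/= t0 t1.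
Unshelve. all: by end_near. Qed.

Section face_cutoff.
Context (R : realType) (m : nat).
Local Notation E := 'rV[R]_m.+1.
Implicit Types (f g w phi psi : E -> R) (D : set 'rV[R]_m).
Local Notation mu := (@rV_lebesgue R m.+1).

Lemma test_cut (Om1 Om2 F : set E) phi zeta : test_function Om1 phi -> smooth zeta ->
  closed F -> (forall x, ~ F x -> zeta x = 0) -> Om1 `&` F `<=` Om2 ->
  test_function Om2 (fun x => phi x * zeta x).
Proof.
move=> [sp [K [cK KO K0]]] sz cF zF OF; split; first exact: (smoothM sp sz).
exists (K `&` F); split; first exact: compact_closedI.
  by move=> x [/KO Kx Fx]; exact: OF.
move=> x KFx; have [Fx|Fx] := pselect (F x); last by rewrite zF ?mulr0.
by rewrite K0 ?mul0r// => Kx; apply: KFx.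
Qed.

(* [(s, a) = (1, 0)] and [(-1, 1)]: the distance to the face [x_n = a]. *)
Definition facedist (s a : R) (x : E) : R := s * (x ord0 ord_max - a).

(** It vanishes up to distance [1 / (k + 1)] from the face and is 1 from distance [2 / (k + 1)]
    on. *)
Definition zeta (s a : R) (k : nat) (x : E) : R := 1 - step (k.+1%:R * facedist s a x - 1).

Variables (s a : R).
Hypothesis s1 : s = 1 \/ s = -1.

Lemma smooth_zeta k : smooth (zeta s a k).
Proof.
apply: (@smooth_coord _ _ (fun t => 1 - step (k.+1%:R * (s * (t - a)) - 1))).
rewrite (_ : (fun t => _) = fun t => 1 + (-1) * step (k.+1%:R * (s * (t + - a)) + - 1)).
  apply: smooth1_algP; apply: S1_add; first exact: S1_cst.
  apply: S1_mul; first exact: S1_cst.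
  apply: (S1_comp (f := @step R)); first by apply: S1_base; exact: smooth1_step.
  apply: S1_add; last exact: S1_cst.
  do 2 (apply: S1_mul; first exact: S1_cst).
  by apply: S1_add; [exact: S1_id|exact: S1_cst].
by apply/funext => t; rewrite mulN1r.
Qed.

Lemma zeta_ge0 k x : 0 <= zeta s a k x.
Proof. by rewrite subr_ge0 step_le1. Qed.

Lemma zeta_le1 k x : zeta s a k x <= 1.
Proof. by rewrite lerBlDr lerDl step_ge0. Qed.

Lemma zeta_norm_le1 k x : `|zeta s a k x| <= 1.
Proof. by rewrite ger0_norm ?zeta_ge0// zeta_le1. Qed.

Lemma zeta_near k x : facedist s a x <= k.+1%:R^-1 -> zeta s a k x = 0.
Proof.
move=> h; rewrite /zeta step_le0 ?subrr// subr_le0 mulrC -ler_pdivlMr//.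
by rewrite div1r.
Qed.

Lemma zeta_cvg1 x : 0 < facedist s a x -> \forall k \near \oo, zeta s a k x = 1.
Proof.
move=> d0; near=> k; rewrite /zeta step_ge1 ?subr0//.
rewrite lerBrDr -ler_pdivrMr//.
have : 2 / facedist s a x <= k%:R by near: k; exact: nbhs_infty_ger.
by rewrite -(natr1 k) (_ : 1 + 1 = 2)//; lra.
Unshelve. all: by end_near. Qed.

Lemma partial_zeta (d : R -> R) i k : (forall t : R, is_derive t 1 (@step R) (d t)) ->
  partial i (zeta s a k) =
  fun x => (i == ord_max)%:R * (- (k.+1%:R * s * d (k.+1%:R * facedist s a x - 1))).
Proof.
move=> dd; apply: (@partial_coord _ _ i (fun t => 1 - step (k.+1%:R * (s * (t - a)) - 1))
  (fun t => - (k.+1%:R * s * d (k.+1%:R * (s * (t - a)) - 1)))) => t.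
have dl : is_derive t 1 (fun t : R => k.+1%:R * (s * (t - a)) - 1) (k.+1%:R * s).
  rewrite (_ : (fun t : R => _) = (k.+1%:R * s) *: (id : R -> R) + cst (- (k.+1%:R * s * a) - 1)).
    by apply: is_derive_eq; rewrite addr0 [_ *: _]mulr1.
  by apply/funext => r; rewrite !fctE /GRing.scale/=; ring.
have dc := is_derive1_comp (dd _) dl.
have := is_deriveB (is_derive_cst (1 : R) t 1) dc.
by rewrite sub0r [d _ * _]mulrC.
Qed.

Lemma facedist_shift x t : facedist s a (t *: dir R ord_max + x) = s * t + facedist s a x.
Proof. by rewrite /facedist !mxE !eqxx/= mulr1; ring. Qed.

(* Where the derivative of [zeta] is large, [psi] is small. *)
Lemma partial_zeta_bound psi Om : test_function Om psi ->
  (forall x, facedist s a x = 0 -> psi x = 0) ->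
  exists C, forall i k x, `|psi x * partial i (zeta s a k) x| <= C.
Proof.
move=> tpsi psi0; have [d [M [M0 dd dM d0]]] := step_derivative R.
(* The derivative of the cutoff is at most [(k + 1) M] and vanishes where [(k + 1) dist > 2].
   Comparison with the projection of [x] on the face gives [|psi x| <= L dist], hence the product
   [2 L M]. *)
have [L L0 HL] := test_lip tpsi; exists (2 * L * M) => i k x.
rewrite (partial_zeta i k dd); case: (i == ord_max); last by rewrite mul0r mulr0 normr0 !mulr_ge0.
rewrite mul1r mulrN normrN; set y := k.+1%:R * facedist s a x - 1.
have C0 : 0 <= 2 * L * M by rewrite !mulr_ge0.
have [y01|] := pselect (y < 0 \/ 1 < y); first by rewrite (d0 _ y01) !mulr0 normr0.
move=> /not_orP[/negP]; rewrite -leNgt => y0 /negP; rewrite -leNgt => y1.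
have dist0 : 0 <= facedist s a x.
  by rewrite -(pmulr_rge0 _ (ltr0Sn R k)); move: y0; rewrite /y; lra.
have ss : s * s = 1 by case: s1 => ->; ring.
have sn : `|s| = 1 by case: s1 => ->; rewrite ?normrN normr1.
have px : `|psi x| <= L * facedist s a x.
  have := HL x (- (s * facedist s a x) *: dir R ord_max).
  rewrite psi0; last by rewrite facedist_shift mulrN mulrA ss mul1r addNr.
  rewrite sub0r normrN => h; apply: (le_trans h); rewrite ler_wpM2l//.
  apply/rV_norm_leP => // l; rewrite !mxE eqxx/= normrM normrN normrM sn mul1r (ger0_norm dist0).
  by case: (l == ord_max); rewrite ?normr1 ?normr0 ?mulr1 ?mulr0.
rewrite !normrM sn mulr1 (ger0_norm (ler0n R k.+1)).
have kd : k.+1%:R * facedist s a x <= 2 by move: y1; rewrite /y; lra.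
rewrite mulrA; apply: ler_pM => //.
apply: (le_trans (ler_wpM2r _ px)) => //.
by rewrite -mulrA [_ * k.+1%:R]mulrC [2 * L]mulrC ler_wpM2l.
Qed.

End face_cutoff.

(** * The Euler-Lagrange inequality for test functions that vanish on the faces *)

Section corrected_gradient.
Context (R : realType) (m : nat).
Local Notation E := 'rV[R]_m.+1.
Implicit Types (f g w phi psi : E -> R).
Local Notation mu := (@rV_lebesgue R m.+1).
Variables (D : set 'rV[R]_m) (u : E -> R) (c : R).
Local Notation Om := (cylinder D).
Hypotheses (oOm : open Om) (bOm : bounded_set Om) (umin : is_minimizer D u).

Let mOm : measurable Om. Proof. exact: rV_open_measurable. Qed.

(* The gradient of [u - l], where [l] is affine in [x_n] with slope [c]. *)
Definition cgrad i x : R := grad D u i x - (i == ord_max)%:R * c * \1_Om x.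

Lemma sqint_cgrad i : sqint mu (cgrad i).
Proof.
apply: sqintB; first exact: sqint_grad.
by apply: sqintZ; exact: sqint_indic.
Qed.

Lemma cgrad_out i x : ~ Om x -> cgrad i x = 0.
Proof. by move=> Ox; rewrite /cgrad /grad restrict_out// indicE memNset// mulr0 subr0. Qed.

(** The correction is constant on the cylinder and the partials of a test function have integral 0,
    so the left-hand side is that of [euler_lagrange]. *)
Lemma cgrad_euler_lagrange phi : test_function Om phi ->
  `|\int[mu]_x (\sum_i (cgrad i x * partial i phi x))| <= \int[mu]_x `|phi x|.
Proof.
move=> tp; apply: le_trans (euler_lagrange oOm bOm umin tp).
rewrite le_eqVlt; apply/orP; left; apply/eqP; congr (`| _ |).
have tpi i := test_partial i tp.
have i1 i := sqintM (sqint_grad umin i) (test_sqint (tpi i)).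
have i2 i := sqintM (sqint_cgrad i) (test_sqint (tpi i)).
apply: (etrans (Rint_sum (index_enum _) i2)).
apply: (etrans _ (esym (Rint_sum (index_enum _) i1))).
apply: eq_bigr => i _; have i3 := intgZ ((i == ord_max)%:R * c) (test_intg (tpi i)).
transitivity (\int[mu]_x (grad D u i x * partial i phi x - (i == ord_max)%:R * c * partial i phi x)).
  apply: eq_Rintegral => x _.
  have [Ox|Ox] := pselect (Om x); first by rewrite /cgrad indicE mem_set// mulr1 mulrBl.
  by rewrite (test_out (tpi i) Ox) !mulr0 subr0.
by rewrite (RintB (i1 i) i3) (RintZ _ (test_intg (tpi i))) (Rint_partial0 i tp) mulr0 subr0.
Qed.

Lemma closed_facedist (s a r : R) : closed [set x : E | r <= facedist s a x].
Proof.
rewrite (_ : [set x | _] = (fun x : E => x ord0 ord_max) @^-1` [set t | r <= s * (t - a)])//.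
apply: preimage_closed; first by move=> x _; exact: continuous_coord.
rewrite (_ : [set t | _] = (fun t : R => s * (t - a)) @^-1` `[r, +oo[); last first.
  by apply/seteqP; split => t /=; rewrite in_itv/= andbT.
apply: preimage_closed; last exact: itv_closed_ends_closed.
move=> t _; apply: (@cvgM _ _ _ _ (fun=> s) (fun t => t - a)); first exact: cvg_cst.
by apply: (@cvgB _ _ _ _ _ id (fun=> a)); [exact: cvg_id|exact: cvg_cst].
Qed.

Let product_ring (p z w dp dz dw : R) :
  p * (z * dw + w * dz) + z * w * dp = dp * (z * w) + (p * dz * w + p * dw * z).
Proof. by ring. Qed.

Let product_ring0 (p z w dp dz dw : R) : z = 1 -> w = 1 -> dz = 0 -> dw = 0 ->
  dp * (z * w) + (p * dz * w + p * dw * z) = dp.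
Proof. by move=> -> -> -> ->; ring. Qed.

(** Cut [psi] off near both faces. Since [psi] vanishes there, the gradients of the products stay
    bounded, and at each point of the cylinder they eventually equal the gradient of [psi]; a
    multiple of the sum of the [|cgrad i|] dominates. *)
Lemma cgrad_face_euler_lagrange psi : test_function (tube D) psi ->
  (forall x : E, x ord0 ord_max = 0 \/ x ord0 ord_max = 1 -> psi x = 0) ->
  `|\int[mu]_x (\sum_i (cgrad i x * partial i psi x))| <=
  \int[mu]_x (\1_Om x * `|psi x|).
Proof.
move=> tpsi psi0; have s1 : (1 : R) = 1 \/ (1 : R) = -1 by left.
have sN1 : (-1 : R) = 1 \/ (-1 : R) = -1 by right.
pose z0 k := @zeta R m 1 0 k; pose z1 k := @zeta R m (-1) 1 k.
have sz0 k : smooth (z0 k) := @smooth_zeta R m 1 0 k.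
have sz1 k : smooth (z1 k) := @smooth_zeta R m (-1) 1 k.
have sz k := smoothM (sz0 k) (sz1 k).
have spsi := test_smooth tpsi.
pose phi k x := psi x * (z0 k x * z1 k x).
have tphi k : test_function Om (phi k).
  pose F := [set x : E | k.+1%:R^-1 <= facedist 1 0 x] `&` [set x : E | k.+1%:R^-1 <= facedist (-1) 1 x].
  have cF : closed F by apply: closedI; exact: closed_facedist.
  have F0 x : ~ F x -> z0 k x * z1 k x = 0.
    move=> /not_andP[|] /negP; rewrite -ltNge => /ltW h.
      by rewrite /z0 zeta_near// mul0r.
    by rewrite /z1 (zeta_near (s := -1))// mulr0.
  apply: (@test_cut R m (tube D) Om F psi (fun x => z0 k x * z1 k x) tpsi (sz k) cF F0).
  move=> x [Dx [h1 h2]]; split; first exact: Dx.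
  have k0 : 0 < k.+1%:R^-1 :> R by rewrite invr_gt0.
  have := lt_le_trans k0 h1; have := lt_le_trans k0 h2.
  rewrite /facedist mul1r subr0 mulN1r opprB subr_gt0 => -> ->//.
have [C0 HC0] : exists C, forall i k x, `|psi x * partial i (z0 k) x| <= C.
  apply: (partial_zeta_bound s1 tpsi) => x; rewrite /facedist mul1r subr0 => h.
  by apply: psi0; left.
have [C1 HC1] : exists C, forall i k x, `|psi x * partial i (z1 k) x| <= C.
  apply: (partial_zeta_bound sN1 tpsi) => x; rewrite /facedist => h.
  by apply: psi0; right; lra.
have [B [B0 HB]] : exists B, 0 <= B /\ forall i x, `|partial i psi x| <= B.
  have /choice[B HB] i : exists M, 0 <= M /\ forall x, `|partial i psi x| <= M.
    by have [M M0 HM] := test_bounded (test_partial i tpsi); exists M.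
  exists (\sum_i B i); split; first by apply: sumr_ge0 => i _; exact: (HB i).1.
  move=> i x; apply: (le_trans ((HB i).2 x)); rewrite (bigD1 i)//= lerDl.
  by apply: sumr_ge0 => l _; exact: (HB l).1.
have pphi k i x : partial i (phi k) x = partial i psi x * (z0 k x * z1 k x) +
    (psi x * partial i (z0 k) x * z1 k x + psi x * partial i (z1 k) x * z0 k x).
  have e1 := partialM i spsi (sz k); have e2 := partialM i (sz0 k) (sz1 k).
  have -> : partial i (phi k) x = psi x * partial i (fun x => z0 k x * z1 k x) x +
      z0 k x * z1 k x * partial i psi x := congr1 (fun h => h x) e1.
  have -> : partial i (fun x => z0 k x * z1 k x) x = z0 k x * partial i (z1 k) x +
      z1 k x * partial i (z0 k) x := congr1 (fun h => h x) e2.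
  exact: product_ring.
have pphi_le k i x : `|partial i (phi k) x| <= B + (C0 + C1).
  rewrite pphi; apply: (le_trans (ler_normD _ _)); apply: lerD.
    rewrite normrM -[B]mulr1; apply: ler_pM; [exact: normr_ge0|exact: normr_ge0|exact: HB|]; rewrite normrM -[leRHS]mulr1.
    by apply: ler_pM => //; exact: zeta_norm_le1.
  apply: (le_trans (ler_normD _ _)); apply: lerD.
    by rewrite normrM -[C0]mulr1; apply: ler_pM; [exact: normr_ge0|exact: normr_ge0|exact: HC0|exact: zeta_norm_le1].
  by rewrite normrM -[C1]mulr1; apply: ler_pM; [exact: normr_ge0|exact: normr_ge0|exact: HC1|exact: zeta_norm_le1].
have [d [M [_ dd _ d0]]] := step_derivative R.
have pz0 s a k i x : 2 < k.+1%:R * facedist s a x -> partial i (@zeta R m s a k) x = 0.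
  move=> h; rewrite (partial_zeta s a i k dd) d0 ?mulr0 ?oppr0 ?mulr0//.
  by right; rewrite ltrBrDr (_ : 1 + 1 = 2).
have cvx x : (fun k => \sum_i (cgrad i x * partial i (phi k) x)) @ \oo -->
    \sum_i (cgrad i x * partial i psi x).
  apply: cvg_near_cst; have [Ox|Ox] := pselect (Om x); last first.
    by apply: nearW => k; apply: eq_bigr => i _; rewrite cgrad_out// !mul0r.
  have [Dx /andP[x0 x1]] := Ox.
  have f0 : 0 < facedist 1 0 x by rewrite /facedist mul1r subr0.
  have f1 : 0 < facedist (-1) 1 x by rewrite /facedist; lra.
  have big (r : R) : 0 < r -> \forall k \near \oo, 2 < k.+1%:R * r.
    move=> r0; near=> k; have : 2 / r <= k%:R by near: k; exact: nbhs_infty_ger.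
    by rewrite ler_pdivrMr// => h; rewrite -(natr1 k) mulrDl mul1r; lra.
  have n0 : \forall k \near \oo, z0 k x = 1 := @zeta_cvg1 R m 1 0 x f0.
  have n1 : \forall k \near \oo, z1 k x = 1 := @zeta_cvg1 R m (-1) 1 x f1.
  apply: filter_app n0; apply: filter_app n1; apply: filter_app (big _ f0).
  apply: filter_app (big _ f1); exists 0%N => [//|k _ b1 b0 e1 e0].
  apply: eq_bigr => i _; congr (_ * _); rewrite (pphi k i x).
  have q0 : partial i (z0 k) x = 0 := pz0 1 0 k i x b0.
  have q1 : partial i (z1 k) x = 0 := pz0 (-1) 1 k i x b1.
  exact: (product_ring0 _ _ e0 e1 q0 q1).
have sc i := sqint_cgrad i.
have ic i : intg mu (cgrad i).
  have [A OA] := bounded_cube bOm; apply: (sqint_intg (M := A) (sc i)) => x xA.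
  by apply: cgrad_out => /OA.
have [] := @Rint_dct _ _ _ mu (fun k x => \sum_i (cgrad i x * partial i (phi k) x))
  (fun x => \sum_i (cgrad i x * partial i psi x))
  (fun x => \sum_i ((B + (C0 + C1)) * `|cgrad i x|)).
- move=> k; apply: (@intg_meas _ _ _ mu); apply: intg_sum => i.
  by apply: sqintM => //; exact: test_sqint (test_partial i (tphi k)).
- exact: cvx.
- by apply: intg_sum => i; apply: intgZ; exact: intg_abs.
- move=> k x; apply: (le_trans (ler_norm_sum _ _ _)); apply: ler_sum => i _.
  by rewrite normrM mulrC; apply: ler_wpM2r.
move=> _ cv; rewrite -(cvg_lim _ (cvg_norm cv))//; apply: limr_le.
  by apply/cvg_ex; eexists; exact: (cvg_norm cv).
apply: nearW => k; apply: (le_trans (cgrad_euler_lagrange (tphi k))).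
apply: Rint_le; first exact: intg_abs (test_intg (tphi k)).
  apply: sqintM (sqint_indic mOm bOm) (sqint_abs (test_sqint tpsi)).
move=> x; have [Ox|Ox] := pselect (Om x); last first.
  by rewrite (test_out (tphi k) Ox) normr0 mulr_ge0// indicE.
rewrite indicE mem_set// mul1r /phi normrM -[leRHS]mulr1; apply: ler_pM => //.
by rewrite normrM -[leRHS]mulr1; apply: ler_pM => //; exact: zeta_norm_le1.
Unshelve. all: by end_near. Qed.

End corrected_gradient.

(** * Boundary terms on thin strips along a face *)

Section face_integral.
Context (R : realType) (m : nat).
Local Notation E := 'rV[R]_m.+1.
Local Notation mu := (@rV_lebesgue R m.+1).
Local Notation mu' := (@rV_lebesgue R m).

Lemma measurable_col' : measurable_fun setT (col' ord_max : E -> 'rV[R]_m).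
Proof.
apply/measurable_fun_rVP => i.
rewrite (_ : _ \o _ = rV_coord (lift ord_max i)); first exact: measurable_rV_coord.
by apply/funext => y; rewrite /rV_coord/= mxE.
Qed.

Lemma integral_tensor (f : 'rV[R]_m -> R) (g : R -> R) :
  measurable_fun setT f -> measurable_fun setT g -> (forall x, 0 <= f x) -> (forall t, 0 <= g t) ->
  (\int[mu]_x (f (col' ord_max x) * g (x ord0 ord_max))%:E =
   \int[mu']_x (f x)%:E * \int[lebesgue_measure]_t (g t)%:E)%E.
Proof.
move=> mf mg f0 g0.
have mfg : measurable_fun setT (fun x : E => (f (col' ord_max x) * g (x ord0 ord_max))%:E).
  apply/measurable_EFinP; apply: measurable_funM.
    by apply: measurableT_comp mf _; exact: measurable_col'.
  by apply: measurableT_comp mg _; exact: (measurable_rV_coord ord_max).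
rewrite integral_snoc//; last by move=> x; rewrite lee_fin mulr_ge0.
rewrite -ge0_integralZr//; first last.
- by apply: integral_ge0 => t _; rewrite lee_fin.
- by move=> x _; rewrite lee_fin.
- exact/measurable_EFinP.
apply: eq_integral => x _.
rewrite -ge0_integralZl_EFin//; first last.
- exact/measurable_EFinP.
- by move=> t _; rewrite lee_fin.
by apply: eq_integral => t _; rewrite rV_snocK rV_snoc_last EFinM.
Qed.

Lemma Rint_slab (f : 'rV[R]_m -> R) (a r : R) : 0 < r -> intg mu' f -> (forall x, 0 <= f x) ->
  let F (x : E) := f (col' ord_max x) * \1_(`[a - r, a + r]%classic) (x ord0 ord_max) in
  intg mu F /\ \int[mu]_x F x = 2 * r * \int[mu']_x f x.
Proof.
move=> r0 fi f0 F; pose g : R -> R := \1_(`[a - r, a + r]%classic).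
have mg : measurable_fun setT g by apply: measurable_indic.
have g0 t : 0 <= g t by rewrite /g indicE.
have ar : a - r < a + r by lra.
have gE : (\int[lebesgue_measure]_t (g t)%:E = (2 * r)%:E)%E.
  transitivity (lebesgue_measure (`[a - r, a + r]%classic : set R)).
    by rewrite /g integral_indic// setIT.
  rewrite lebesgue_measure_itv/= lte_fin ar.
  by rewrite -EFinB; congr EFin; lra.
have e := integral_tensor (intg_meas fi) mg f0 g0; rewrite gE in e.
have fE := EFin_Rint fi; rewrite -fE -EFinM in e.
have F0 x : 0 <= F x by rewrite /F mulr_ge0.
split; last by rewrite /Rintegral [X in fine X]e/= mulrC.
apply/integrableP; split.
  apply/measurable_EFinP; apply: measurable_funM.
    by apply: measurableT_comp (intg_meas fi) _; exact: measurable_col'.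
  by apply: measurableT_comp mg _; exact: (measurable_rV_coord ord_max).
rewrite (eq_integral (fun x => (F x)%:E)) ?e ?ltry// => x _.
by rewrite /= ger0_norm.
Qed.

Lemma measurable_restrict_continuous n (D : set 'rV[R]_n) (f : 'rV[R]_n -> R) : open D ->
  (forall x, D x -> {for x, continuous f}) -> measurable_fun setT (f \_ D).
Proof.
move=> oD cf; apply: (measurability _ (RGenOpens.measurableE R)) => _ [_ [a [b ->] <-]].
rewrite setTI; set B := `]a, b[%classic.
have oDB : open (D `&` f @^-1` B).
  rewrite openE => x [Dx Bx]; apply: filterI; first exact: (open_nbhs_nbhs (conj oD Dx)).
  by apply: (cf x Dx); apply: open_nbhs_nbhs; split => //; exact: interval_open.
have -> : (f \_ D) @^-1` B = (D `&` f @^-1` B) `|` (~` D `&` [set _ | B 0]).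
  apply/seteqP; split => x /=.
    have [Dx|Dx] := pselect (D x); first by rewrite restrict_in//; left.
    by rewrite restrict_out//; right.
  by move=> [[Dx Bx]|[Dx B0]]; [rewrite restrict_in|rewrite restrict_out].
apply: measurableU; first exact: rV_open_measurable.
apply: measurableI; first by apply: measurableC; exact: rV_open_measurable.
have [B0|B0] := pselect (B 0).
  by rewrite (_ : [set _ | _] = setT)//; apply/funext => x; apply/propext.
by rewrite (_ : [set _ | _] = set0)//; apply/funext => x; apply/propext.
Qed.

End face_integral.

Section face_estimate.
Context (R : realType) (m : nat).
Local Notation E := 'rV[R]_m.+1.
Implicit Types (f g w phi psi : E -> R).
Local Notation mu := (@rV_lebesgue R m.+1).
Local Notation mu' := (@rV_lebesgue R m).
Variables (D : set 'rV[R]_m) (s a : R).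
Local Notation Om := (cylinder D).
Hypotheses (oD : open D) (bD : bounded_set D).
Hypothesis face : (s = 1 /\ a = 0) \/ (s = -1 /\ a = 1).

(* One half of the tube, extending across the face [x_n = a] of the cylinder. *)
Definition halftube : set E := [set x | tube D x /\ facedist s a x < 1].

Let s1 : s = 1 \/ s = -1. Proof. by case: face => -[]; [left|right]. Qed.

Lemma halftube_cylinder x : halftube x -> 0 < facedist s a x -> Om x.
Proof.
by rewrite /halftube /facedist /=; case: face => -[-> ->] [Dx h1] h2; split => //;
  apply/andP; split; lra.
Qed.

Lemma cylinder_facedist x : Om x -> 0 < facedist s a x.
Proof.
by rewrite /facedist; case: face => -[-> ->] [Dx /andP[h1 h2]]; lra.
Qed.

Lemma normr_facedist (x : E) : 0 < facedist s a x -> `|x ord0 ord_max - a| = facedist s a x.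
Proof.
rewrite /facedist; case: face => -[-> _] h; first by rewrite mul1r ger0_norm//; lra.
by rewrite mulN1r ler0_norm//; lra.
Qed.

(** [w] is continuous up to the open face only and may blow up near the lateral boundary. Uniformity
    in [x'] comes from the compact projection of the support of [psi], by a near-covering
    argument. *)
Lemma near_face w psi (d : R) : {within Om `|` slice D a, continuous w} ->
  test_function halftube psi -> 0 < d ->
  \forall j \near \oo, forall x, Om x -> `|x ord0 ord_max - a| <= 2 / j.+1%:R ->
   `|w x * psi x| <=
   `|w (rV_snoc (col' ord_max x) a) * psi (rV_snoc (col' ord_max x) a)| + d.
Proof.
move=> cw tpsi d0; have [sp [K [cK KU K0]]] := tpsi.
pose A := Om `|` slice D a; pose G x := `|w x * psi x|.
pose K' := col' ord_max @` K.
have cK' : compact K'.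
  by apply: continuous_compact cK; apply: continuous_subspaceT; exact: continuous_col'.
have K'D : K' `<=` D by move=> _ [x /KU[Dx _] <-].
pose P (j : nat) (z : 'rV[R]_m) := forall t, Om (rV_snoc z t) -> `|t - a| <= 2 / j.+1%:R ->
  G (rV_snoc z t) <= G (rV_snoc z a) + d.
have key z : K' z -> \forall z' \near z & j \near \oo, P j z'.
  move=> /K'D Dz; pose x0 := rV_snoc z a.
  have Ax0 : A x0 by right; rewrite /slice/= rV_snocK rV_snoc_last.
  have cG : G x @[x --> within A (nbhs x0)] --> G x0.
    apply: (@cvg_norm _ R); apply: cvgM.
      by move/subspace_continuousP : cw; exact.
    by apply: cvg_within_filter; exact: smooth_continuous.
  have d2 : 0 < d / 2 by rewrite divr_gt0.
  have h1 : \forall x \near within A (nbhs x0), G x < G x0 + d / 2.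
    by apply: (cvgr_lt (G x0)) cG _ _; rewrite ltrDl.
  have h2 : \forall x \near within A (nbhs x0), G x0 - d / 2 < G x.
    by apply: (cvgr_gt (G x0)) cG _ _; rewrite ltrBlDr ltrDl.
  have /nbhs_ballP[e /= e0 eG] : \forall x \near nbhs x0, A x ->
      G x < G x0 + d / 2 /\ G x0 - d / 2 < G x.
    by apply: filterS2 h1 h2 => x g1 g2; split.
  exists (ball z e `&` D, [set j | 2 / j.+1%:R < e]).
    split => /=; first by apply: filterI; [exact: nbhsx_ballx|exact: (open_nbhs_nbhs (conj oD Dz))].
    near=> j; rewrite /= ltr_pdivrMr//; have : 2 / e <= j%:R by near: j; exact: nbhs_infty_ger.
    by rewrite ler_pdivrMr// -(natr1 j) mulrDr mulr1 mulrC; lra.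
  move=> [z' j] /= [[/(rV_ballP _ _ e0) zz' Dz'] je] t Omt ta.
  have inball r : `|r - a| < e -> ball x0 e (rV_snoc z' r).
    move=> ra; apply/(rV_ballP _ _ e0) => i; rewrite !mxE.
    by case: (unlift _ _) => [k|] /=; [exact: zz'|].
  have [g1 _] := eG _ (inball t (le_lt_trans ta je)) (or_introl Omt).
  have [_ g2] : G (rV_snoc z' a) < G x0 + d / 2 /\ G x0 - d / 2 < G (rV_snoc z' a).
    apply: eG; first by apply: inball; rewrite subrr normr0.
    by right; rewrite /slice/= rV_snocK rV_snoc_last.
  by move: g1 g2; lra.
have nP : \forall j \near \oo, K' `<=` P j := (compact_near_coveringP K').1 cK' nat \oo P _ key.
near=> j; have PK : K' `<=` P j by near: j; exact: nP.
move=> x Ox xa.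
have [K'x|nK'] := pselect (K' (col' ord_max x)).
  by have := PK _ K'x (x ord0 ord_max); rewrite rV_snoc_eta; exact.
rewrite K0; last by move=> Kx; apply: nK'; exists x.
by rewrite mulr0 normr0 addr_ge0// ltW.
Unshelve. all: by end_near. Qed.

Lemma facedist_zeta_bound : exists2 M, 0 <= M & forall i j x, Om x ->
  `|partial i (@zeta R m s a j) x| <=
  j.+1%:R * M * \1_(`[a - 2 / j.+1%:R, a + 2 / j.+1%:R]%classic) (x ord0 ord_max).
Proof.
have [d [M [M0 dd dM d0]]] := step_derivative R; exists M => // i j x Ox.
have f0 := cylinder_facedist Ox.
have C0 : 0 <= j.+1%:R * M by rewrite mulr_ge0.
have -> : partial i (@zeta R m s a j) x = (i == ord_max)%:R * - (j.+1%:R * s * d (j.+1%:R * facedist s a x - 1))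
  := congr1 (fun h => h x) (partial_zeta s a i j dd).
case: (i == ord_max); last by rewrite mul0r normr0 mulr_ge0.
rewrite mul1r normrN; set y := j.+1%:R * facedist s a x - 1.
have sn : `|s| = 1 by case: s1 => ->; rewrite ?normrN normr1.
rewrite !normrM sn mulr1 (ger0_norm (ler0n R j.+1)).
have [y1|y1] := ltP 1 y.
  by rewrite (d0 y (or_intror y1)) normr0 mulr0 mulr_ge0.
have : `|x ord0 ord_max - a| <= 2 / j.+1%:R.
  rewrite (normr_facedist f0) ler_pdivlMr// mulrC.
  by move: y1; rewrite /y; lra.
rewrite ler_distl => /andP[h1 h2]; rewrite indicE mem_set.
  by rewrite mulr1 ler_wpM2l.
by rewrite /= in_itv/= h1 h2.
Qed.

(* That [M] does not depend on [w] allows the passage to the limit in the sequence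
   defining a trace. *)
Lemma face_estimate : exists2 M, 0 <= M & forall (w q psi : E -> R) (B : R) i,
  {within Om `|` slice D a, continuous w} -> sqint mu (w \_ Om) ->
  sqint mu' ((fun z => w (rV_snoc z a)) \_ D) ->
  sqint mu q -> (forall x, ~ Om x -> q x = 0) ->
  (forall phi, test_function Om phi ->
    \int[mu]_x ((w \_ Om) x * partial i phi x) = - \int[mu]_x (q x * phi x)) ->
  test_function halftube psi -> (forall x, `|psi x| <= B) ->
  `|\int[mu]_x ((w \_ Om) x * partial i psi x) + \int[mu]_x (q x * psi x)| <=
  M * B * \int[mu']_z `|((fun z => w (rV_snoc z a)) \_ D) z|.
Proof.
(* The strip [|x_n - a| <= 2 / (j + 1)] has width [4 / (j + 1)] and the cutoff has slope at most
   [(j + 1) M]: the product does not depend on [j]. *)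
have [M M0 HM] := facedist_zeta_bound; exists (4 * M); first by rewrite mulr_ge0.
move=> w q psi B i cw sw sh sq q0 wq tpsi psiB.
pose W := w \_ Om; pose h := (fun z => w (rV_snoc z a)) \_ D.
have spsi := test_smooth tpsi.
have sz j : smooth (@zeta R m s a j) := @smooth_zeta R m s a j.
have zn j x : `|@zeta R m s a j x| <= 1 := @zeta_norm_le1 R m s a j x.
have mz j : measurable_fun setT (@zeta R m s a j).
  exact: rV_continuous_measurable (smooth_continuous (sz j)).
pose phi j x := psi x * @zeta R m s a j x.
have tphi j : test_function Om (phi j).
  pose F := [set x : E | j.+1%:R^-1 <= facedist s a x].
  have F0 x : ~ F x -> @zeta R m s a j x = 0.
    by move=> /negP; rewrite -ltNge => /ltW; exact: zeta_near.
  apply: (@test_cut R m halftube Om F psi (@zeta R m s a j) tpsi (sz j) (@closed_facedist R m s a _) F0).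
  by move=> x [Hx Fx]; apply: (halftube_cylinder Hx); apply: lt_le_trans Fx; rewrite invr_gt0.
have tp i := test_partial i tpsi.
have [C C0 HC] := test_bounded (tp i).
(* Testing with [psi * zeta] gives [X j = - T j]. [X j] tends to the quantity to be estimated, and
   [T j] carries the derivative of the cutoff, so it lives on the thin strip. *)
pose X j := \int[mu]_x (W x * (@zeta R m s a j x * partial i psi x)) + \int[mu]_x (q x * phi j x).
pose T j := \int[mu]_x (W x * (psi x * partial i (@zeta R m s a j) x)).
have i1 j : intg mu (fun x => W x * (@zeta R m s a j x * partial i psi x)).
  exact: sqintM sw (test_sqint (testMr (tp i) (sz j))).
have i2 j : intg mu (fun x => W x * (psi x * partial i (@zeta R m s a j) x)).
  exact: sqintM sw (test_sqint (testMl tpsi (smooth_partial i (sz j)))).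
have XT j : X j = - T j.
  have e := wq _ (tphi j).
  have e1 : \int[mu]_x (W x * partial i (phi j) x) = T j + \int[mu]_x (W x * (@zeta R m s a j x * partial i psi x)).
    apply: (etrans _ (RintD (i2 j) (i1 j))); apply: eq_Rintegral => x _.
    have -> : partial i (phi j) x = psi x * partial i (@zeta R m s a j) x + @zeta R m s a j x * partial i psi x
      := congr1 (fun h => h x) (partialM i spsi (sz j)).
    by rewrite mulrDr.
  have aux (t x y : R) : t + x = - y -> x + y = - t by lra.
  exact: aux (etrans (esym e1) e).
have W0 x : ~ Om x -> W x = 0 by exact: restrict_out.
have zcv x : Om x -> \forall j \near \oo, @zeta R m s a j x = 1.
  by move=> /cylinder_facedist; exact: zeta_cvg1.
have cv1 : \int[mu]_x (W x * (@zeta R m s a j x * partial i psi x)) @[j --> \oo] -->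
    \int[mu]_x (W x * partial i psi x).
  have [] := @Rint_dct _ _ _ mu (fun j x => W x * (@zeta R m s a j x * partial i psi x))
    (fun x => W x * partial i psi x) (fun x => `|W x * partial i psi x|) => //.
  - by move=> j; exact: intg_meas (i1 j).
  - move=> x; apply: cvg_near_cst; have [Ox|Ox] := pselect (Om x).
      by move: (zcv x Ox); apply: (@filterS _ _ eventually_filter) => j ->; rewrite mul1r.
    by rewrite (W0 x Ox); apply: nearW => j; rewrite !mul0r.
  - exact: intg_abs (sqintM sw (test_sqint (tp i))).
  - move=> j x; rewrite mulrCA normrM -[leRHS]mul1r; apply: ler_wpM2r => //.
have iqp := sqintM sq (test_sqint tpsi).
have cv2 : \int[mu]_x (q x * phi j x) @[j --> \oo] --> \int[mu]_x (q x * psi x).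
  have [] := @Rint_dct _ _ _ mu (fun j x => q x * phi j x)
    (fun x => q x * psi x) (fun x => `|q x * psi x|) => //.
  - by move=> j; exact: intg_meas (sqintM sq (test_sqint (tphi j))).
  - move=> x; apply: cvg_near_cst; have [Ox|Ox] := pselect (Om x).
      by move: (zcv x Ox); apply: (@filterS _ _ eventually_filter) => j e; rewrite /phi e mulr1.
    by rewrite (q0 x Ox); apply: nearW => j; rewrite !mul0r.
  - exact: intg_abs iqp.
  - move=> j x; rewrite /phi mulrA normrM -[leRHS]mulr1; apply: ler_wpM2l => //.
have cvX : `|X j| @[j --> \oo] -->
    `|\int[mu]_x (W x * partial i psi x) + \int[mu]_x (q x * psi x)|.
  exact: (cvg_norm (cvgD cv1 cv2)).
have iD : sqint mu' (\1_D : _ -> R) := sqint_indic (rV_open_measurable oD) bD.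
have iD1 : intg mu' (\1_D : _ -> R).
  have [A DA] := bounded_cube bD; apply: (sqint_intg (M := A) iD) => z zA.
  by rewrite indicE memNset// => /DA.
have ih : intg mu' h.
  have hE : (fun z => h z * \1_D z) = h.
    apply/funext => z; rewrite indicE /h patchE.
    by case: ifP => _; rewrite ?mulr1// mul0r.
  by rewrite -hE; exact: sqintM sh iD.
have B0 : 0 <= B := le_trans (normr_ge0 _) (psiB 0).
have key d : 0 < d -> `|\int[mu]_x (W x * partial i psi x) + \int[mu]_x (q x * psi x)| <=
    4 * M * (B * \int[mu']_z `|h z| + d * \int[mu']_z (\1_D z : R)).
  move=> d0; rewrite -(cvg_lim _ cvX)//; apply: limr_le; first by apply/cvg_ex; eexists; exact: cvX.
  move: (near_face cw tpsi d0); apply: (@filterS _ _ eventually_filter) => j Hj; rewrite XT normrN.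
  pose f z := B * `|h z| + d * \1_D z.
  have fi : intg mu' f by apply: intgD; apply: intgZ => //; exact: intg_abs.
  have f0 z : 0 <= f z by rewrite addr_ge0 ?mulr_ge0 ?indicE// ltW.
  have r0 : 0 < 2 / j.+1%:R :> R by rewrite divr_gt0.
  have [iF FE] := Rint_slab a r0 fi f0.
  have fE : \int[mu']_z f z = B * \int[mu']_z `|h z| + d * \int[mu']_z (\1_D z : R).
    rewrite (RintD (intgZ B (intg_abs ih)) (intgZ d iD1)).
    by rewrite (RintZ _ (intg_abs ih)) (RintZ _ iD1).
  rewrite -fE (_ : 4 * M * _ = j.+1%:R * M * (2 * (2 / j.+1%:R) * \int[mu']_z f z)); last first.
    have : j.+1%:R != 0 :> R by rewrite pnatr_eq0.
    by move: (j.+1%:R) (\int[mu']_z f z) => c I c0; field.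
  rewrite -FE -(RintZ _ iF); apply: Rint_abs_le; [exact: i2|exact: intgZ|] => x.
  have [Ox|Ox] := pselect (Om x); last first.
    rewrite (W0 x Ox) mul0r normr0; apply: mulr_ge0; first by rewrite mulr_ge0.
    by rewrite mulr_ge0// indicE.
  rewrite /W restrict_in// mulrA normrM mulrC.
  have pz := HM i j x Ox; have Dx := Ox.1.
  have fx : f (col' ord_max x) = B * `|w (rV_snoc (col' ord_max x) a)| + d.
    by rewrite /f /h restrict_in// indicE mem_set// mulr1.
  have [xa|xa] := pselect (`|x ord0 ord_max - a| <= 2 / j.+1%:R).
    have Hx := Hj x Ox xa.
    have Gf : `|w x * psi x| <= f (col' ord_max x).
      by apply: (le_trans Hx); rewrite fx lerD2r normrM mulrC; apply: ler_wpM2r.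
    apply: (le_trans (ler_pM (normr_ge0 _) (normr_ge0 _) pz Gf)).
    by rewrite le_eqVlt; apply/orP; left; apply/eqP; ring.
  have -> : partial i (@zeta R m s a j) x = 0.
    apply/eqP; rewrite -normr_le0; apply: (le_trans pz).
    rewrite indicE memNset ?mulr0//= in_itv/= => h2; apply: xa.
    by rewrite ler_distl.
  by rewrite normr0 mul0r; apply: mulr_ge0; [exact: mulr_ge0|rewrite mulr_ge0// indicE].
have A0 : 0 <= \int[mu']_z (\1_D z : R) by apply: Rint_ge0 => z; rewrite indicE.
move: key A0; rewrite -/h; move: (\int[mu']_z (\1_D z : R)) => A key A0.
apply/ler_addgt0Pr => e e0.
have c0 : 0 < 4 * M * A + 1 by rewrite ltr_wpDl// !mulr_ge0.
have d0 := divr_gt0 e0 c0; apply: (le_trans (key _ d0)).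
have := divfK (lt0r_neq0 c0) e; move: (e / _) d0 => d d0 dc.
have -> : 4 * M * (B * \int[mu']_z `|h z| + d * A) =
  4 * M * B * \int[mu']_z `|h z| + d * (4 * M * A) by ring.
by rewrite lerD2l; lra.
Qed.

End face_estimate.

(** * Passing to the limit in the definition of a trace *)

Section small_norms.
Context (R : realType).

Lemma sqrt_poweR_lt (X : \bar R) (e : R) : (0 <= X)%E -> 0 < e ->
  (X `^ 2^-1 < e%:E)%E -> (X <= (e ^+ 2)%:E)%E.
Proof.
move=> X0 e0; rewrite poweR12_sqrt//; case: X X0 => [r| |]//=; rewrite !lee_fin lte_fin => r0 re.
rewrite -(sqr_sqrtr r0) lerXn2r ?nnegrE ?sqrtr_ge0//; exact: ltW.
Qed.

Lemma cvge0_near_lt (X : nat -> \bar R) (e : R) : X k @[k --> \oo] --> 0%E -> 0 < e ->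
  \forall k \near \oo, (X k < e%:E)%E.
Proof.
move=> cX e0; apply: (cX [set y | (y < e%:E)%E]); apply: open_nbhs_nbhs; split.
  exact: open_ereal_lt_ereal.
by rewrite /= lte_fin.
Qed.

(** [is_trace] does not state that the face values of its approximations are square-integrable up to
    the trace; a finite norm provides it. *)
Lemma Lnorm2_lt n (h : 'rV[R]_n -> R) (e : R) : measurable_fun setT h -> 0 < e ->
  (Lnorm rV_lebesgue 2%:E (EFin \o h) < e%:E)%E ->
  sqint rV_lebesgue h /\ \int[rV_lebesgue]_x (h x ^+ 2) <= e ^+ 2.
Proof.
move=> mh e0; rewrite Lnorm.unlock.
have -> : (\int[rV_lebesgue]_x `|(EFin \o h) x| `^ 2 = \int[rV_lebesgue]_x (h x ^+ 2)%:E)%E.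
  apply: eq_integral => x _; rewrite (_ : `|(EFin \o h) x|%E = (`|h x|)%:E)// poweR_EFin.
  by rewrite powR_mulrn// real_normK// num_real.
have X0 : (0 <= \int[rV_lebesgue]_x (h x ^+ 2)%:E)%E.
  by apply: integral_ge0 => x _; rewrite lee_fin sqr_ge0.
move=> /(sqrt_poweR_lt X0 e0) he.
have ih : intg rV_lebesgue (fun x => h x ^+ 2).
  apply/integrableP; split; first exact/measurable_EFinP/measurable_funX.
  apply: (le_lt_trans _ (ltry (e ^+ 2))); apply: le_trans he.
  rewrite le_eqVlt; apply/orP; left; apply/eqP; apply: eq_integral => x _.
  by rewrite /= ger0_norm// sqr_ge0.
by split; [split|rewrite -lee_fin EFin_Rint].
Qed.

Lemma sobolev1_norm_lt N (Om : set 'rV[R]_N) f (e : R) : sobolev 1 Om f -> 0 < e ->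
  (sobolev1_norm Om f < e%:E)%E ->
  \int[rV_lebesgue]_x ((f \_ Om) x ^+ 2) <= e ^+ 2 /\
  forall i, \int[rV_lebesgue]_x ((weak_derivative Om [:: i] f \_ Om) x ^+ 2) <= e ^+ 2.
Proof.
move=> sf e0; rewrite /sobolev1_norm.
have s0 : sqint rV_lebesgue (f \_ Om) by apply/L2P; have [] := sf.
have si i : sqint rV_lebesgue (weak_derivative Om [:: i] f \_ Om).
  by apply/L2P; have [] := weak_derivative_spec i sf.
pose F x := (f \_ Om) x ^+ 2 + \sum_i (weak_derivative Om [:: i] f \_ Om) x ^+ 2.
have iF : intg rV_lebesgue F.
  by apply: intgD; [exact: sqint_intg2|apply: intg_sum => i; exact: sqint_intg2].
have -> : (\int[rV_lebesgue]_(x in Om) (f x ^+ 2 + weak_grad_sq Om f x)%:E =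
    \int[rV_lebesgue]_x (F x)%:E)%E.
  rewrite integral_mkcond; apply: eq_integral => x _; rewrite patchE /F.
  case: ifPn => [|/negP]; rewrite inE => Ox.
    by rewrite restrict_in//; congr (EFin (_ + _)); apply: eq_bigr => i _; rewrite restrict_in.
  rewrite restrict_out// big1 ?expr0n ?addr0// => i _.
  by rewrite restrict_out// expr0n.
have X0 : (0 <= \int[rV_lebesgue]_x (F x)%:E)%E.
  by apply: integral_ge0 => x _; rewrite lee_fin addr_ge0 ?sqr_ge0// sumr_ge0// => i _; exact: sqr_ge0.
move=> /(sqrt_poweR_lt X0 e0); rewrite -(EFin_Rint iF) lee_fin => Fe.
split=> [|i]; apply: le_trans Fe; apply: Rint_le => //; try exact: sqint_intg2.
  by move=> x; rewrite lerDl sumr_ge0// => i _; exact: sqr_ge0.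
move=> x; rewrite /F (bigD1 i)//= addrCA lerDl addr_ge0 ?sqr_ge0//.
by rewrite sumr_ge0// => l _; exact: sqr_ge0.
Qed.

End small_norms.

Lemma sobolev1B (R : realType) N (Om : set 'rV[R]_N) (u v : 'rV[R]_N -> R) : open Om -> bounded_set Om ->
  sobolev 1 Om u -> sobolev 1 Om v -> sobolev 1 Om (u \- v).
Proof.
move=> oOm bOm su sv.
have B (f g : 'rV[R]_N -> R) : (f \- g) \_ Om = fun x => (f \_ Om) x - (g \_ Om) x.
  apply/funext => x; have [Ox|Ox] := pselect (Om x); first by rewrite !restrict_in.
  by rewrite !restrict_out// subrr.
have sB (f g : 'rV[R]_N -> R) : L2 Om f -> L2 Om g -> L2 Om (f \- g).
  by move=> /L2P sf /L2P sg; apply/L2P; rewrite B; exact: sqintB.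
apply: sobolev1I => [|i]; first exact: sB su.1 sv.1.
have [l1 w1] := weak_derivative_spec i su; have [l2 w2] := weak_derivative_spec i sv.
exists (weak_derivative Om [:: i] u \- weak_derivative Om [:: i] v); split; first exact: sB.
have [i1 i2] := (sqint_restrict_intg bOm ((L2P _ _).1 su.1), sqint_restrict_intg bOm ((L2P _ _).1 sv.1)).
have [j1 j2] := (sqint_restrict_intg bOm ((L2P _ _).1 l1), sqint_restrict_intg bOm ((L2P _ _).1 l2)).
have D (f g psi : 'rV[R]_N -> R) : intg rV_lebesgue (f \_ Om) -> intg rV_lebesgue (g \_ Om) ->
    test_function Om psi -> \int[rV_lebesgue]_x (((f \- g) \_ Om) x * psi x) =
    \int[rV_lebesgue]_x ((f \_ Om) x * psi x) - \int[rV_lebesgue]_x ((g \_ Om) x * psi x).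
  move=> f1 g1 tpsi; rewrite B; apply: (etrans _ (RintB (intgMtest f1 tpsi) (intgMtest g1 tpsi))).
  by apply: eq_Rintegral => x _; rewrite mulrBl.
move/weak_derivative1P: w1 => w1; move/weak_derivative1P: w2 => w2.
apply/weak_derivative1P => phi tp; apply: (etrans (D _ _ _ i1 i2 (test_partial i tp))).
apply: (etrans _ (esym (congr1 -%R (D _ _ _ j1 j2 tp)))).
by rewrite (w1 _ tp) (w2 _ tp) opprB opprK addrC.
Qed.

Section face_trace.
Context (R : realType) (m : nat).
Local Notation E := 'rV[R]_m.+1.
Implicit Types (f g w phi psi : E -> R).
Local Notation mu := (@rV_lebesgue R m.+1).
Local Notation mu' := (@rV_lebesgue R m).

(** Young's inequality with weight [e] in place of Cauchy-Schwarz: a bound that tends to 0 with [e]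
    is all that is used. *)
Lemma Rint_abs_prod_le d (T : measurableType d) (nu : {measure set T -> \bar R}) (f g : T -> R) (e : R) :
  sqint nu f -> sqint nu g -> 0 < e -> \int[nu]_x (f x ^+ 2) <= e ^+ 2 ->
  \int[nu]_x `|f x * g x| <= e * (1 + \int[nu]_x (g x ^+ 2)).
Proof.
move=> sf sg e0 fe; have i2 := sqint_intg2 sf; have j2 := sqint_intg2 sg.
have pw (a b : R) : `|a * b| <= e^-1 * a ^+ 2 + e * b ^+ 2.
  rewrite normrM -(real_normK (num_real a)) -(real_normK (num_real b)).
  move: `|a| `|b| (normr_ge0 a) (normr_ge0 b) => x y x0 y0.
  have -> : e^-1 * x ^+ 2 + e * y ^+ 2 = e^-1 * ((x - e * y) ^+ 2 + x * y * e) + x * y.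
    by field; rewrite gt_eqF.
  by rewrite lerDr mulr_ge0// ?invr_ge0 ?addr_ge0 ?sqr_ge0 ?mulr_ge0// ltW.
apply: (le_trans (Rint_le (intg_abs (sqintM sf sg)) (intgD (intgZ e^-1 i2) (intgZ e j2)) _)).
  by move=> x; exact: pw.
rewrite (RintD (intgZ e^-1 i2) (intgZ e j2)) (RintZ _ i2) (RintZ _ j2) mulrDr mulr1.
by rewrite lerD2r mulrC ler_pdivrMr// -expr2.
Qed.

Lemma within_continuous_slice (D : set 'rV[R]_m) (A : set E) (a : R) w : open D ->
  (forall z, D z -> A (rV_snoc z a)) -> {within A, continuous w} ->
  forall z, D z -> {for z, continuous (fun z => w (rV_snoc z a))}.
Proof.
move=> oD DA /subspace_continuousP cw z Dz; apply: (cvg_comp _ _ _ (cw _ (DA z Dz))).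
move=> P /nbhs_ballP[e /= e0 eP].
have Dn : \forall z' \near z, D z' := open_nbhs_nbhs (conj oD Dz).
have Bn : \forall z' \near z, ball z e z' by exact: nbhsx_ballx.
apply: filterS2 Bn Dn => z' /(rV_ballP _ _ e0) zz' Dz'; apply: eP; last exact: DA.
apply/(rV_ballP _ _ e0) => i; rewrite !mxE.
by case: (unlift _ _) => [k|] /=; [exact: zz'|rewrite subrr normr0].
Qed.

Variables (D : set 'rV[R]_m) (s a : R) (u l : E -> R) (p : E -> R) (c : R) (i : 'I_m.+1).
Local Notation Om := (cylinder D).
Hypotheses (oD : open D) (bD : bounded_set D) (oOm : open Om) (bOm : bounded_set Om).
Hypothesis face : (s = 1 /\ a = 0) \/ (s = -1 /\ a = 1).
Hypotheses (su : sobolev 1 Om u) (cl : continuous l) (lc : forall z, l (rV_snoc z a) = c).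
Hypotheses (sul : sqint mu ((u \- l) \_ Om)) (sp : sqint mu p) (p0 : forall x, ~ Om x -> p x = 0).
Hypothesis wp : forall phi, test_function Om phi ->
  \int[mu]_x (((u \- l) \_ Om) x * partial i phi x) = - \int[mu]_x (p x * phi x).

(** Apply [face_estimate] to [v k - l]. Its values on the face are those of [v k - c], small in
    [L^2]; inside, it differs from [u - l] by a function small in [W^{1,2}]. The constant of the
    estimate does not depend on [k]. *)
Lemma face_parts psi : is_trace D u a (cst c) -> test_function (halftube D s a) psi ->
  \int[mu]_x (((u \- l) \_ Om) x * partial i psi x) = - \int[mu]_x (p x * psi x).
Proof.
move=> [v [vP cv tv]] tpsi.
have mOm := rV_open_measurable oOm.
have [M M0 HM] := face_estimate oD bD face.
have [B B0 psiB] := test_bounded tpsi.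
have sD : sqint mu' (\1_D : _ -> R) := sqint_indic (rV_open_measurable oD) bD.
have tdpsi := test_partial i tpsi.
pose A := Om `|` slice D a.
have DA z : D z -> A (rV_snoc z a) by move=> Dz; right; rewrite /slice/= rV_snocK rV_snoc_last.
pose X := \int[mu]_x (((u \- l) \_ Om) x * partial i psi x) + \int[mu]_x (p x * psi x).
(* Three errors, each at most [e] times a fixed factor: the boundary term, and the contributions of
   [v k - u] and of its weak derivative. *)
pose C := M * B * (1 + \int[mu']_z ((\1_D z : R) ^+ 2)) +
  (1 + \int[mu]_x (partial i psi x ^+ 2)) + (1 + \int[mu]_x (psi x ^+ 2)).
have C0 : 0 < C.
  have I0 d (T : measurableType d) (nu : {measure set T -> \bar R}) (f : T -> R) :
    0 <= \int[nu]_x (f x ^+ 2) by apply: Rint_ge0 => x; exact: sqr_ge0.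
  have k1 := I0 _ _ mu (partial i psi); have k2 := I0 _ _ mu psi.
  have k3 : 0 <= M * B * (1 + \int[mu']_z ((\1_D z : R) ^+ 2)) by rewrite !mulr_ge0// addr_ge0.
  by rewrite /C -addrA ltr_wpDl// addr_gt0// ltr_pwDl.
suff key e : 0 < e -> `|X| <= e * C.
  have X0 : X = 0.
    apply/eqP; rewrite -normr_le0; apply/ler_addgt0Pr => e e0; rewrite add0r.
    by rewrite -(divfK (lt0r_neq0 C0) e); apply: key; exact: divr_gt0.
  by apply/eqP; rewrite -subr_eq0 opprK; apply/eqP.
move=> e0.
have [k [n1 n2]] : exists k, (sobolev1_norm Om (v k \- u)%R < e%:E)%E /\
    (Lnorm mu' 2%:E (EFin \o (fun x' => v k (rV_snoc x' a) - (cst c) x')%R \_ D) < e%:E)%E.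
  near \oo => k; exists k; split.
    by near: k; exact: (cvge0_near_lt cv e0).
  by near: k; exact: (cvge0_near_lt tv e0).
have [svk cvk] := vP k.
have svu := sobolev1B oOm bOm svk su.
have [a1 b1] := sobolev1_norm_lt svu e0 n1.
have [/L2P sr wr] := weak_derivative_spec i svu.
have st : sqint mu ((v k \- u) \_ Om) by apply/L2P; exact: svu.1.
pose t := (v k \- u) \_ Om; pose r := weak_derivative Om [:: i] (v k \- u) \_ Om.
have hE : (fun x' => v k (rV_snoc x' a) - (cst c) x') \_ D =
    (fun z => (v k \- l) (rV_snoc z a)) \_ D.
  by apply/funext => z; rewrite !restrictE /= lc.
have cw : {within A, continuous (v k \- l)}.
  apply/subspace_continuousP => x Ax; apply: cvgB.
    by move/subspace_continuousP : cvk; exact.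
  by apply: cvg_within_filter; exact: cl.
have mh : measurable_fun setT ((fun z => (v k \- l) (rV_snoc z a)) \_ D).
  apply: measurable_restrict_continuous => // z Dz.
  exact: (within_continuous_slice oD DA cw Dz).
rewrite hE in n2; have [sh hh] := Lnorm2_lt mh e0 n2.
have WE : (v k \- l) \_ Om = fun x => ((u \- l) \_ Om) x + t x.
  by apply/funext => x; rewrite /t !restrictE /=; ring.
have sW : sqint mu ((v k \- l) \_ Om) by rewrite WE; exact: sqintD.
have sq : sqint mu (fun x => p x + r x) by exact: sqintD.
have q0 x : ~ Om x -> p x + r x = 0 by move=> Ox; rewrite p0// /r restrict_out// addr0.
have split_l g : sqint mu g -> \int[mu]_x (((v k \- l) \_ Om) x * g x) =
    \int[mu]_x (((u \- l) \_ Om) x * g x) + \int[mu]_x (t x * g x).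
  move=> sg; rewrite WE; apply: (etrans _ (RintD (sqintM sul sg) (sqintM st sg))).
  by apply: eq_Rintegral => x _; rewrite mulrDl.
have split_r g : sqint mu g -> \int[mu]_x ((p x + r x) * g x) =
    \int[mu]_x (p x * g x) + \int[mu]_x (r x * g x).
  move=> sg; apply: (etrans _ (RintD (sqintM sp sg) (sqintM sr sg))).
  by apply: eq_Rintegral => x _; rewrite mulrDl.
have wq phi : test_function Om phi -> \int[mu]_x (((v k \- l) \_ Om) x * partial i phi x) =
    - \int[mu]_x ((p x + r x) * phi x).
  move=> tp; rewrite (split_l _ (test_sqint (test_partial i tp))) (split_r _ (test_sqint tp)).
  move/weak_derivative1P: wr => wr.
  by rewrite (wp tp) opprD; congr (_ + _); exact: wr.
have est := HM (v k \- l) (fun x => p x + r x) psi B i cw sW sh sq q0 wq tpsi psiB.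
rewrite (split_l _ (test_sqint tdpsi)) (split_r _ (test_sqint tpsi)) in est.
have e1 := Rint_abs_prod_le st (test_sqint tdpsi) e0 a1.
have e2 := Rint_abs_prod_le sr (test_sqint tpsi) e0 (b1 i).
have e3 := Rint_abs_prod_le sh sD e0 hh.
have h1 := Rint_abs (sqintM st (test_sqint tdpsi)).
have h2 := Rint_abs (sqintM sr (test_sqint tpsi)).
have e4 : M * B * \int[mu']_z `|((fun z => (v k \- l) (rV_snoc z a)) \_ D) z| <=
    M * B * (e * (1 + \int[mu']_z ((\1_D z : R) ^+ 2))).
  rewrite ler_wpM2l ?mulr_ge0//; apply: le_trans e3; rewrite le_eqVlt; apply/orP; left; apply/eqP.
  apply: eq_Rintegral => z _; rewrite indicE patchE; case: ifP => _; rewrite ?mulr1//.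
  by rewrite mul0r.
have aux (x1 x2 y1 y2 m1 m2 z1 z2 : R) : `|x1 + y1 + (x2 + y2)| <= m1 -> m1 <= m2 ->
    `|y1| <= z1 -> `|y2| <= z2 -> `|x1 + x2| <= m2 + z1 + z2.
  move=> k1 k2 k3 k4; rewrite (_ : x1 + x2 = (x1 + y1 + (x2 + y2)) - y1 - y2); last by ring.
  apply: (le_trans (ler_normB _ _)); apply: lerD => //.
  by apply: (le_trans (ler_normB _ _)); apply: lerD => //; exact: le_trans k2.
rewrite (_ : e * C = M * B * (e * (1 + \int[mu']_z ((\1_D z : R) ^+ 2))) +
  e * (1 + \int[mu]_x (partial i psi x ^+ 2)) + e * (1 + \int[mu]_x (psi x ^+ 2))).
  exact: (aux _ _ _ _ _ _ _ _ est e4 (le_trans h1 e1) (le_trans h2 e2)).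
rewrite /C; move: (\int[mu']_z _) (\int[mu]_x (partial i psi x ^+ 2)) (\int[mu]_x (psi x ^+ 2)) => x y z.
by ring.
Unshelve. all: by end_near. Qed.

End face_trace.

(** * Integration by parts across both faces *)

Section tube_parts.
Context (R : realType) (m : nat).
Local Notation E := 'rV[R]_m.+1.
Implicit Types (f g w phi psi : E -> R).
Local Notation mu := (@rV_lebesgue R m.+1).

Lemma open_cylinder (D : set 'rV[R]_m) : open D -> open (cylinder D).
Proof.
move=> oD; rewrite (_ : cylinder D = tube D `&` (fun x : E => x ord0 ord_max) @^-1` `]0, 1[).
  apply: openI; first exact: open_tube.
  apply: open_comp; last exact: interval_open.
  by move=> x _; exact: continuous_coord.
by apply/seteqP; split => x [Dx /=]; rewrite ?in_itv.
Qed.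

(** The section at height 1/2 transfers openness and boundedness from the cylinder to its base. *)
Lemma cylinder_base (D : set 'rV[R]_m) :
  D = (fun z => rV_snoc z (2^-1 : R)) @^-1` cylinder D.
Proof.
apply/seteqP; split => z; rewrite /cylinder/= rV_snocK; last by case.
by move=> Dz; split => //; rewrite rV_snoc_last; apply/andP; split; lra.
Qed.

Lemma continuous_snoc (t : R) : continuous (fun z : 'rV[R]_m => rV_snoc z t).
Proof.
move=> z A /nbhs_ballP[e /= e0 eA]; apply/nbhs_ballP; exists e => // y /(rV_ballP _ _ e0) zy.
apply: eA; apply/(rV_ballP _ _ e0) => i; rewrite !mxE.
by case: (unlift _ _) => [k|] /=; [exact: zy|rewrite subrr normr0].
Qed.

Lemma open_cylinder_base (D : set 'rV[R]_m) : open (cylinder D) -> open D.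
Proof.
move=> oOm; rewrite (cylinder_base D); apply: open_comp => // z _.
exact: continuous_snoc.
Qed.

Lemma bounded_cylinder_base (D : set 'rV[R]_m) : bounded_set (cylinder D) -> bounded_set D.
Proof.
move=> [M [Mr HM]]; exists M; split => // x Mx z; rewrite {1}(cylinder_base D) => Oz.
have nx := HM x Mx _ Oz.
have x0 : 0 <= x := le_trans (normr_ge0 _) nx.
apply/(rV_norm_leP _ x0) => i.
have /(rV_norm_leP _ x0) /(_ (lift ord_max i)) := nx.
by rewrite !mxE liftK.
Qed.

Variables (D : set 'rV[R]_m) (u : E -> R) (c0 c1 : R).
Local Notation Om := (cylinder D).
Hypotheses (oOm : open Om) (bOm : bounded_set Om) (umin : is_minimizer D u).

Definition affine_between (x : E) : R := c0 + (c1 - c0) * x ord0 ord_max.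
Local Notation l := affine_between.

Lemma smooth_affine_between : smooth l.
Proof.
apply: (@smooth_coord _ _ (fun t => c0 + (c1 - c0) * t)); apply: smooth1_algP.
apply: S1_add; first exact: S1_cst.
by apply: S1_mul; [exact: S1_cst|exact: S1_id].
Qed.

Lemma partial_affine_between i : partial i l = fun=> (i == ord_max)%:R * (c1 - c0).
Proof.
apply: (@partial_coord _ _ i (fun t => c0 + (c1 - c0) * t) (fun=> c1 - c0)) => t.
rewrite (_ : (fun t : R => _) = (c1 - c0) *: (id : R -> R) + cst c0).
  by apply: is_derive_eq; rewrite addr0 [_ *: _]mulr1.
by apply/funext => r; rewrite !fctE addrC.
Qed.

Let mOm : measurable Om. Proof. exact: rV_open_measurable. Qed.

Lemma sqint_sub_affine : sqint mu ((u \- l) \_ Om).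
Proof.
have [A OA] := bounded_cube bOm.
have sl : sqint mu (fun x => \1_Om x * l x).
  apply: (@bounded_sqint R m.+1 A (`|c0| + `|c1 - c0|)).
  - apply: measurable_funM; first exact: measurable_indic.
    exact: rV_continuous_measurable (smooth_continuous smooth_affine_between).
  - move=> x; rewrite indicE; have [Ox|Ox] := pselect (Om x); last first.
      by rewrite memNset// mul0r normr0 addr_ge0.
    rewrite mem_set// mul1r; apply: (le_trans (ler_normD _ _)); rewrite lerD2l normrM.
    rewrite -[leRHS]mulr1; apply: ler_wpM2l => //.
    by have [_ /andP[/ltW x0 /ltW x1]] := Ox; rewrite ger0_norm.
  - by move=> x xA; rewrite indicE memNset ?mul0r// => /OA.
have su : sqint mu (u \_ Om) by apply/L2P; exact: umin.1.1.
rewrite (_ : _ \_ Om = fun x => (u \_ Om) x - \1_Om x * l x); first exact: sqintB.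
by apply/funext => x; rewrite !restrictE mulrBr.
Qed.

Lemma sub_affine_parts phi i : test_function Om phi ->
  \int[mu]_x (((u \- l) \_ Om) x * partial i phi x) =
  - \int[mu]_x (cgrad D u (c1 - c0) i x * phi x).
Proof.
move=> tp; have tpi := test_partial i tp.
have su : sqint mu (u \_ Om) by apply/L2P; exact: umin.1.1.
have [_ /weak_derivative1P wu] := weak_derivative_spec i umin.1.
have i1 := sqintM su (test_sqint tpi).
have i2 := test_intg (testMr tpi smooth_affine_between).
have i3 := sqintM (sqint_grad umin i) (test_sqint tp).
have i4 := intgZ ((i == ord_max)%:R * (c1 - c0)) (test_intg tp).
transitivity (\int[mu]_x ((u \_ Om) x * partial i phi x - l x * partial i phi x)).
  apply: eq_Rintegral => x _; rewrite -mulrBl.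
  have [Ox|Ox] := pselect (Om x); first by rewrite !restrict_in.
  by rewrite (test_out tpi Ox) !mulr0.
have e2 : \int[mu]_x (l x * partial i phi x) =
    - ((i == ord_max)%:R * (c1 - c0) * \int[mu]_x phi x).
  apply: (etrans (Rint_parts i smooth_affine_between tp)); congr (- _).
  apply: (etrans _ (RintZ _ (test_intg tp))); apply: eq_Rintegral => x _.
  exact: (congr1 (fun h => h x * phi x) (partial_affine_between i)).
have e3 : \int[mu]_x (cgrad D u (c1 - c0) i x * phi x) =
    \int[mu]_x (grad D u i x * phi x) - (i == ord_max)%:R * (c1 - c0) * \int[mu]_x phi x.
  apply: (etrans _ (congr1 (fun t => _ - t) (RintZ _ (test_intg tp)))).
  apply: (etrans _ (RintB i3 i4)); apply: eq_Rintegral => x _; rewrite /cgrad mulrBl.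
  have [Ox|Ox] := pselect (Om x); first by rewrite indicE mem_set// mulr1.
  by rewrite (test_out tp Ox) !mulr0.
apply: (etrans (RintB i1 i2)); apply: (etrans (congr2 (fun a b => a - b) (wu _ tp) e2)).
by apply: (etrans _ (esym (congr1 -%R e3))); rewrite opprB opprK addrC.
Qed.

Lemma tube_parts psi i : is_trace D u 0 (cst c0) -> is_trace D u 1 (cst c1) ->
  test_function (tube D) psi ->
  \int[mu]_x (((u \- l) \_ Om) x * partial i psi x) =
  - \int[mu]_x (cgrad D u (c1 - c0) i x * psi x).
Proof.
move=> tr0 tr1 tpsi.
have oD := open_cylinder_base oOm; have bD := bounded_cylinder_base bOm.
have sg := sqint_cgrad (c1 - c0) oOm bOm umin i.
have g0 x := @cgrad_out R m D u (c1 - c0) i x.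
have cl : continuous l := smooth_continuous smooth_affine_between.
(* Index 2 makes [z] vanish for [x_n <= 1/3] and equal 1 for [x_n >= 2/3], so [psi * (1 - z)] and
   [psi * z] each meet a single face and [face_parts] applies to both. *)
pose z := @zeta R m 1 0 2; have sz : smooth z := @smooth_zeta R m 1 0 2.
have z3 (x : E) : 2 <= 3 * x ord0 ord_max -> 1 - z x = 0.
  move=> h; rewrite /z /zeta step_ge1 ?subr0 ?subrr//.
  by rewrite /facedist mul1r subr0; lra.
have s1z : smooth (fun x => 1 - z x) := smoothB (smooth_cst _) sz.
have t0 : test_function (halftube D 1 0) (fun x => psi x * (1 - z x)).
  apply: (@test_cut R m (tube D) _ _ psi (fun x => 1 - z x) tpsi s1z (@closed_facedist R m (-1) 0 (- (2 / 3)))).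
    by move=> x /negP; rewrite -ltNge /facedist => h; apply: z3; lra.
  by move=> x [Dx]; rewrite /halftube /facedist/= => h; split => //; lra.
have t1 : test_function (halftube D (-1) 1) (fun x => psi x * z x).
  apply: (@test_cut R m (tube D) _ _ psi z tpsi sz (@closed_facedist R m 1 0 3^-1)).
    by move=> x /negP; rewrite -ltNge => h; apply: zeta_near; exact: ltW.
  by move=> x [Dx]; rewrite /halftube /facedist/= => h; split => //; lra.
have e0 := face_parts oD bD oOm bOm (or_introl (conj erefl erefl)) umin.1 cl
  (fun y => etrans (congr1 (fun t => c0 + (c1 - c0) * t) (rV_snoc_last y 0))
    (etrans (congr1 (fun t => c0 + t) (mulr0 _)) (addr0 _)))
  sqint_sub_affine sg g0 (fun phi tp => sub_affine_parts i tp) tr0 t0.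
have lc1 y : l (rV_snoc y 1) = c1 by rewrite /l rV_snoc_last mulr1 addrC subrK.
have e1 := face_parts oD bD oOm bOm (or_intror (conj erefl erefl)) umin.1 cl lc1
  sqint_sub_affine sg g0 (fun phi tp => sub_affine_parts i tp) tr1 t1.
have sp0 := test_smooth t0; have sp1 := test_smooth t1.
have i1 := sqintM sqint_sub_affine (test_sqint (test_partial i t0)).
have i2 := sqintM sqint_sub_affine (test_sqint (test_partial i t1)).
have i3 := sqintM sg (test_sqint t0); have i4 := sqintM sg (test_sqint t1).
have psiE : psi = fun x => psi x * (1 - z x) + psi x * z x.
  by apply/funext => x; rewrite -mulrDr subrK mulr1.
have dE x : partial i psi x = partial i (fun x => psi x * (1 - z x)) x + partial i (fun x => psi x * z x) x.
  by rewrite {1}psiE; exact: (congr1 (fun h => h x) (partialD i sp0 sp1)).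
transitivity (\int[mu]_x (((u \- l) \_ Om) x * partial i (fun x => psi x * (1 - z x)) x +
    ((u \- l) \_ Om) x * partial i (fun x => psi x * z x) x)).
  by apply: eq_Rintegral => x _; rewrite dE mulrDr.
apply: (etrans (RintD i1 i2)); apply: (etrans (congr2 +%R e0 e1)).
rewrite -opprD; congr (- _); apply: (etrans (esym (RintD i3 i4))).
by apply: eq_Rintegral => x _; rewrite -mulrDr -mulrDr subrK mulr1.
Qed.

End tube_parts.

(** * Second weak derivatives and conclusion *)

Lemma sqint_restrict (R : realType) n (A : set 'rV[R]_n) (f : 'rV[R]_n -> R) : measurable A ->
  sqint rV_lebesgue f -> sqint rV_lebesgue (f \_ A).
Proof.
move=> mA sf; rewrite (_ : f \_ A = fun x => \1_A x * f x).
  apply: sqint_le (sf) => [|x].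
    by apply: measurable_funM; [exact: measurable_indic|exact: sqint_meas sf].
  by rewrite normrM indicE; case: (_ \in _); rewrite ?normr1 ?normr0 ?mul1r ?mul0r.
by apply/funext => x; rewrite restrictE.
Qed.

Lemma Rint_restrict_sub (R : realType) n (A B : set 'rV[R]_n) (f phi : 'rV[R]_n -> R) : A `<=` B ->
  (forall x, ~ A x -> phi x = 0) ->
  \int[rV_lebesgue]_x ((f \_ A) x * phi x) = \int[rV_lebesgue]_x ((f \_ B) x * phi x).
Proof.
move=> AB p0; apply: eq_Rintegral => x _; have [Ax|Ax] := pselect (A x).
  by rewrite !restrict_in//; exact: AB.
by rewrite p0// !mulr0.
Qed.

Lemma weak_second_derivative (R : realType) N (Om : set 'rV[R]_N) (u : 'rV[R]_N -> R) (C : R) i j :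
  sqint rV_lebesgue u ->
  (forall phi, test_function Om phi ->
    2 * \int[rV_lebesgue]_x (u x * partial i (partial j phi) x) <=
    \int[rV_lebesgue]_x (phi x ^+ 2) + C) ->
  exists2 g, sqint rV_lebesgue g & forall phi, test_function Om phi ->
    \int[rV_lebesgue]_x (u x * partial i (partial j phi) x) = \int[rV_lebesgue]_x (g x * phi x).
Proof.
move=> su HC.
have iij phi : test_function Om phi ->
    intg rV_lebesgue (fun x => u x * partial i (partial j phi) x).
  by move=> tp; exact: sqintM su (test_sqint (test_partial i (test_partial j tp))).
have lin k (f g : 'rV[R]_N -> R) (a : R) : smooth f -> smooth g ->
    partial k (fun x => f x + a * g x) = fun x : 'rV[R]_N => partial k f x + a * partial k g x.
  move=> sf sg; apply: (etrans (partialD k sf (smoothZ a sg))).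
  by apply/funext => x; congr (_ + _); exact: (congr1 (fun h => h x) (partialZ k a sg)).
apply: (riesz_representation _ _ _ _ HC).
- by exists (fun=> 0); exact: test_cst0.
- by move=> f g a tf tg; exact: testD tf (testZ a tg).
- by move=> f tf; exact: test_sqint tf.
move=> f g a tf tg; have sf := test_smooth tf; have sg := test_smooth tg.
have e := etrans (congr1 (partial i) (lin j _ _ a sf sg))
  (lin i _ _ a (smooth_partial j sf) (smooth_partial j sg)).
apply: (etrans _ (etrans (RintD (iij f tf) (intgZ a (iij g tg)))
  (congr1 (fun t => _ + t) (RintZ a (iij g tg))))).
apply: eq_Rintegral => x _.
apply: (etrans (congr1 (fun h => u x * h x) e)); move: (partial i _ x) (partial i _ x) => b b'.
by ring.
Qed.

Theorem corollary5p1 (R : realType) (m : nat) (hm : (1 <= m)%N)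
  (D : set 'rV[R]_m) (u : 'rV[R]_m.+1 -> R)
  (hdom : bounded_domain (cylinder D))
  (hbd : piecewise_smooth_boundary (cylinder D))
  (hmin : is_minimizer D u)
  (h0 : constant_on_slice D u 0%R)
  (h1 : constant_on_slice D u 1%R) :
  forall D' : set 'rV[R]_m, compactly_contained D' D ->
    sobolev 2 (cylinder D') u.
Proof.
move=> D' cD'; have [_ oOm _ bOm] := hdom; have [c0 tr0] := h0; have [c1 tr1] := h1.
have oD := open_cylinder_base oOm; have mOm := rV_open_measurable oOm.
have [oD' _ clD'] := cD'.
have sub : cylinder D' `<=` cylinder D.
  by move=> x [Dx xn]; split => //; apply: clD'; exact: subset_closure.
have mOm' : measurable (cylinder D') by exact: rV_open_measurable (open_cylinder oD').
have out phi x : test_function (cylinder D') phi -> ~ cylinder D' x -> phi x = 0.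
  by move=> tp; exact: test_out tp.
have L2sub f : L2 (cylinder D) f -> L2 (cylinder D') f.
  move=> /L2P sf; apply/L2P; have := sqint_restrict mOm' sf.
  rewrite (_ : (f \_ _) \_ _ = f \_ (cylinder D'))//; apply/funext => x.
  have [Dx|Dx] := pselect (cylinder D' x); last by rewrite !restrict_out.
  by rewrite !restrict_in//; exact: sub.
have Lu : L2 (cylinder D') u by apply: L2sub; exact: hmin.1.1.
split => // -[|i [|j [|//]]] _.
- by exists u; split => // phi _; rewrite expr0 mul1r.
- have [L2w /weak_derivative1P ww] := weak_derivative_spec i hmin.1.
  exists (weak_derivative (cylinder D) [:: i] u); split; first exact: L2sub.
  apply/weak_derivative1P => phi tp; have tpi := test_partial i tp.
  apply: (etrans (Rint_restrict_sub _ sub (fun x => @out _ x tpi))).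
  apply: (etrans (ww _ (test_sub sub tp))).
  exact: (congr1 -%R (esym (Rint_restrict_sub _ sub (fun x => @out _ x tp)))).
pose l := @affine_between R m c0 c1; pose u0 := (u \- l) \_ (cylinder D).
have su0 : sqint rV_lebesgue u0 := sqint_sub_affine c0 c1 oOm bOm hmin.
have [C HC] := local_hessian_estimate oD bOm mOm su0 (fun x => @restrict_out _ _ _ _ x)
  (sqint_cgrad (c1 - c0) oOm bOm hmin)
  (fun psi i tpsi => tube_parts oOm bOm hmin i tr0 tr1 tpsi)
  (fun psi => @cgrad_face_euler_lagrange R m D u (c1 - c0) oOm bOm hmin psi) i j cD'.
have [g sg gE] := weak_second_derivative su0 HC.
exists g; split; first by apply/L2P; exact: sqint_restrict.
move=> phi tp; have tj := test_partial j tp; have tij := test_partial i tj.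
have sl : smooth l := @smooth_affine_between R m c0 c1.
(* The first derivatives of the affine function are constant, so it contributes nothing and [g]
   serves for [u] as well as for [u - l]. *)
have lij : \int[rV_lebesgue]_x (l x * partial i (partial j phi) x) = 0.
  apply: (etrans (Rint_parts i sl tj)); apply/eqP; rewrite oppr_eq0; apply/eqP.
  transitivity (\int[rV_lebesgue]_x ((i == ord_max)%:R * (c1 - c0) * partial j phi x)).
    apply: eq_Rintegral => x _.
    exact: (congr1 (fun h => h x * partial j phi x) (@partial_affine_between R m c0 c1 i)).
  by apply: (etrans (RintZ _ (test_intg tj))); rewrite (Rint_partial0 j tp) mulr0.
rewrite expr2 mulrNN !mul1r.
apply: (etrans (Rint_restrict _ u (partial i (partial j phi)))).
have i1 := sqintM su0 (test_sqint tij); have i2 := test_intg (testMr tij sl).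
transitivity (\int[rV_lebesgue]_x (u0 x * partial i (partial j phi) x +
    l x * partial i (partial j phi) x)).
  apply: eq_Rintegral => x _; rewrite -mulrDl; have [Dx|Dx] := pselect (cylinder D' x).
    by rewrite /u0 !restrict_in//= ?subrK//; exact: sub.
  by rewrite (out _ x tij Dx) !mulr0.
apply: (etrans (RintD i1 i2)); apply: (etrans (congr1 (fun t => _ + t) lij)); rewrite addr0.
apply: (etrans (gE _ tp)); apply: (etrans _ (esym (Rint_restrict _ g phi))).
apply: eq_Rintegral => x _; have [Dx|Dx] := pselect (cylinder D' x).
  by rewrite restrict_in.
by rewrite (out _ x tp Dx) !mulr0.
Qed.
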